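(* Assume (H1), (H2), (H3). Let $a>0$. Then there exist $\varepsilon_0\in(0,1/4)$, a constant $c>0$ (which may depend on $a$) and, for every $\varepsilon\in(0,\varepsilon_0)$, a constant $c_\varepsilon>0$ (which may depend on $\varepsilon$ and $a$) such that for any $\varepsilon\in(0,\varepsilon_0)$, any non-negative function $\psi:\mathbb X\to\mathbb R_+$, any $y\in\mathbb R$ and any integer $n\geqslant 3\varepsilon^{-3}$, \[ \sup_{x\in\mathbb X,\ z\geqslant 0} n\left|\mathbb E_x\big(\psi(X_n)\,;\,y+S_n\in[z,z+a],\ \tau_y>n\big)-\frac{2a\,\nu(\psi)\,V(x,y)}{\sqrt{2\pi}\,\sigma^2\,n}\,\varphi_+\!\Big(\frac{z}{\sqrt n\,\sigma}\Big)\right| \leqslant c\,(1+\max(y,0))\,\|\psi\|_\infty\Big(\sqrt{\varepsilon}+\frac{c_\varepsilon(1+\max(y,0))}{n^{\varepsilon}}\Big), \] where $\varphi_+(t)=t e^{-t^2/2}\mathbf 1_{\{t\geqslant0\}}$.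
   Context: Let $\mathbb X$ be a finite set and $(X_n)_{n\geqslant0}$ a homogeneous Markov chain on $\mathbb X$ with transition matrix $\mathbf P$; $\mathbb P_x,\mathbb E_x$ denote probability and expectation when $X_0=x$. For $g:\mathbb X\to\mathbb C$, $\|g\|_\infty=\max_{x}|g(x)|$ and $\mathbf Pg(x)=\sum_{x'}g(x')\mathbf P(x,x')$. (H1): there exists $k_0\geqslant1$ such that $\mathbf P^{k_0}g(x)>0$ for all $x\in\mathbb X$ and every non-negative, not identically zero $g$. Under (H1) there is a unique invariant probability $\nu$ of $\mathbf P$, and $\nu(x)>0$ for all $x$; write $\nu(g)=\sum_x g(x)\nu(x)$. Let $f:\mathbb X\to\mathbb R$, $S_0=0$, $S_n=f(X_1)+\dots+f(X_n)$, and for $y\in\mathbb R$ let $\tau_y=\inf\{k\geqslant1:\ y+S_k\leqslant0\}$. (H2): $\nu(f)=0$. (H3): for every $(\theta,a)\in\mathbb R^2$ there exist $n\geqslant0$ and $x_0,\dots,x_n\in\mathbb X$ with $\mathbf P(x_0,x_1)\cdots\mathbf P(x_{n-1},x_n)\mathbf P(x_n,x_0)>0$ and $f(x_0)+\dots+f(x_n)-(n+1)\theta\notin a\mathbb Z$. Let $\sigma^2=\nu(f^2)+2\sum_{n\geqslant1}\nu(f\,\mathbf P^nf)$ (which is $>0$ under (H1)–(H3)). Under (H1)–(H3) it is known that for every $x\in\mathbb X$, $y\in\mathbb R$ the limit $\lim_{n\to\infty}\sqrt n\,\mathbb P_x(\tau_y>n)$ exists and is finite; define $V(x,y)=\frac{\sqrt{2\pi}\,\sigma}{2}\lim_{n\to\infty}\sqrt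 n\,\mathbb P_x(\tau_y>n)$ (this is a non-negative function, non-decreasing in $y$, with $\mathbb E_x(V(X_n,y+S_n);\tau_y>n)=V(x,y)$). *)

(* Defs.v *)
From HB Require Import structures.
From mathcomp Require Import all_boot all_order all_algebra.
From mathcomp Require Import all_classical all_reals all_analysis.
Set Implicit Arguments. Unset Strict Implicit. Unset Printing Implicit Defensive.
Import Order.TTheory GRing.Theory Num.Theory numFieldNormedType.Exports.
Local Open Scope ring_scope.

Section Defs.
Variables (R : realType) (T : finType).

Definition stochastic (P : T -> T -> R) : Prop :=
  (forall x x', 0 <= P x x') /\ (forall x, \sum_(x' : T) P x x' = 1).

Definition Pop (P : T -> T -> R) (g : T -> R) : T -> R :=
  fun x => \sum_(x' : T) g x' * P x x'.

Definition Ppow (P : T -> T -> R) (k : nat) (g : T -> R) : T -> R :=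
  iter k (Pop P) g.

Definition nuE (nu : T -> R) (g : T -> R) : R := \sum_(x : T) g x * nu x.

Definition invariant_prob (P : T -> T -> R) (nu : T -> R) : Prop :=
  (forall x, 0 <= nu x) /\ \sum_(x : T) nu x = 1 /\
  (forall x', \sum_(x : T) nu x * P x x' = nu x').

Definition H1 (P : T -> T -> R) : Prop :=
  exists k0 : nat, (1 <= k0)%N /\
    forall g : T -> R, (forall x, 0 <= g x) -> (exists x, g x != 0) ->
      forall x, 0 < Ppow P k0 g x.

Definition H2 (nu f : T -> R) : Prop := nuE nu f = 0.

Fixpoint cycle_w (P : T -> T -> R) (x0 prev : T) (xs : seq T) : R :=
  match xs with
  | [::] => P prev x0
  | x :: s => P prev x * cycle_w P x0 x s
  end.

Definition H3 (P : T -> T -> R) (f : T -> R) : Prop :=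
  forall theta a : R, exists (x0 : T) (xs : seq T),
    0 < cycle_w P x0 x0 xs /\
    ~ (exists k : int,
         \sum_(x <- x0 :: xs) f x - (size xs).+1%:R * theta = a * k%:~R).

(* E_x F(X_1, ..., X_n) for the Markov chain with transition matrix P *)
Fixpoint pathE (P : T -> T -> R) (n : nat) (x : T) (F : seq T -> R) : R :=
  match n with
  | O => F [::]
  | S m => \sum_(x' : T) P x x' * pathE P m x' (fun s => F (x' :: s))
  end.

(* survival: y + S_k > 0 for every k = 1..size s, i.e. tau_y > size s *)
Fixpoint surv (f : T -> R) (y : R) (s : seq T) : bool :=
  match s with
  | [::] => true
  | x :: s' => (0 < y + f x) && surv f (y + f x) s'
  end.

Definition Ssum (f : T -> R) (s : seq T) : R := \sum_(x <- s) f x.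

Definition prob_surv (P : T -> T -> R) (f : T -> R) (n : nat) (x : T) (y : R) : R :=
  pathE P n x (fun s => if surv f y s then 1 else 0).

Definition Eloc (P : T -> T -> R) (f psi : T -> R) (n : nat) (x : T)
  (y z a : R) : R :=
  pathE P n x (fun s => if surv f y s && (z <= y + Ssum f s <= z + a)
                        then psi (last x s) else 0).

Definition sigma2 (P : T -> T -> R) (nu f : T -> R) : R :=
  nuE nu (fun x => f x ^+ 2) +
  2 * limn (fun N : nat => \sum_(1 <= k < N) nuE nu (fun x => f x * Ppow P k f x)).

Definition sigma (P : T -> T -> R) (nu f : T -> R) : R := Num.sqrt (sigma2 P nu f).

Definition Vfun (P : T -> T -> R) (nu f : T -> R) (x : T) (y : R) : R :=
  Num.sqrt (2 * pi) * sigma P nu f / 2 *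
  limn (fun n : nat => Num.sqrt (n%:R) * prob_surv P f n x y).

Definition supnorm (psi : T -> R) : R := \big[Num.max/0]_(x : T) `|psi x|.

End Defs.

Definition phiplus {R : realType} (t : R) : R :=
  if 0 <= t then t * expR (- (t ^+ 2) / 2) else 0.

(* Main.v *)
Require Import Defs.
From HB Require Import structures.
From mathcomp Require Import all_boot all_order all_algebra.
From mathcomp Require Import all_classical all_reals all_analysis.
From mathcomp Require Import ring lra zify.
Set Implicit Arguments. Unset Strict Implicit. Unset Printing Implicit Defensive.
Import Order.TTheory GRing.Theory Num.Theory numFieldNormedType.Exports.
Local Open Scope ring_scope.

(* The proof is Fourier-free and works with the operators Q (free) and K (killed below 0)
   of the walk (X_n, w + S_n).  Lindeberg's replacement argument, with correctors r and rho
   solving Poisson equations, shows that Q and K carry a solution G(t, .) of the heat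
   equation to G(t + sigma2, .) up to small errors (for K, if G is odd); H3 gives regularity
   of Q^n 1_I under small shifts, and the two together yield a local limit theorem for Q.
   For K, odd heat functions behave near 0 like G'(t, 0) (w + r), and K^n (w + r) converges
   to a harmonic function, identified with V by taking for G the error function.
   Finally K^n = K^(n - l) K^l with l of order kappa^34 n: K^l of the window indicator is
   close to the odd Gaussian kernel, except within kappa^12 sqrt n of the boundary, a region
   of small enough mass, and K^(n - l) acts on this odd kernel as described. *)

(** Odd heat functions suit the killing because they are small on the bounded region where the walk
    lands when it dies. Each path dies at most once, so this loss is charged to the decrements of
    the survival probability, which telescope. The exponents come from the last step. With [l] about
    [kappa^34 n] the kernel has width [kappa^17 sqrt n] and height [1 / (kappa^17 sqrt n)]. In the
    strip of width [kappa^12 sqrt n] this height is the only available bound on the error, so the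
    surviving mass of the strip must be [kappa^18 / sqrt n]. Concentration alone gives [kappa^12];
    comparison with an odd kernel improves this to the power 3/2, hence 18. Outside the strip,
    distances exceed the width by a factor [kappa^-5] and polynomial tails suffice. The limit
    theorems used carry no rate: they hold for [n >= N(kappa)] and [y] at most of order [n^(1/4)].
    With [kappa = sqrt eps], in all cases not covered the term [c_eps (1 + max(y, 0)) / n^eps] is at
    least 1, and a bound of order [(1 + max(y, 0)) / n] is enough. *)

Ltac pos := repeat first [ assumption | apply: ltW; assumption | done
  | apply: addr_gt0 | apply: addr_ge0 | apply: mulr_gt0 | apply: mulr_ge0
  | apply: exprn_gt0 | apply: exprn_ge0 | rewrite invr_gt0 | rewrite invr_ge0
  | apply: sqrtr_ge0 ].

(** * The free and the killed walk *)

Section Operators.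
Variables (R : realType) (T : finType) (P : T -> T -> R) (f : T -> R).
Hypothesis Pst : stochastic P.
Implicit Types (u v : T -> R -> R) (x : T) (w : R) (k : bool).

(** [w] stands for [y + S_n]. Only the point of arrival is tested, so the walk may start at
    [w <= 0], as in the definition of [tau_y]. The flag [k] lets free and killed walks share their
    lemmas. *)
Definition step k u : T -> R -> R := fun x w =>
  \sum_x' P x x' * (if k && (w + f x' <= 0) then 0 else u x' (w + f x')).

Definition walk k n u : T -> R -> R := iter n (step k) u.

Lemma walkS k n u x w : walk k n.+1 u x w = step k (walk k n u) x w.
Proof. by []. Qed.

Lemma walkSr k n u : walk k n.+1 u = walk k n (step k u).
Proof. exact: iterSr. Qed.

Lemma walkD k m n u : walk k (m + n) u = walk k m (walk k n u).
Proof. exact: iterD. Qed.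

Lemma step_lin k a b u v x w :
  step k (fun x w => a * u x w + b * v x w) x w = a * step k u x w + b * step k v x w.
Proof.
rewrite /step !mulr_sumr -big_split; apply: eq_bigr => x' _.
by case: ifP => _ /=; ring.
Qed.

Lemma step_ext k u v : (forall x w, u x w = v x w) -> forall x w, step k u x w = step k v x w.
Proof. by move=> uv x w; apply: eq_bigr => x' _; rewrite uv. Qed.

Lemma walk_ext k n u v : (forall x w, u x w = v x w) ->
  forall x w, walk k n u x w = walk k n v x w.
Proof. by move=> uv; elim: n => [//|n IH] x w; rewrite !walkS; apply: step_ext. Qed.

Lemma walk_lin k n a b u v x w :
  walk k n (fun x w => a * u x w + b * v x w) x w = a * walk k n u x w + b * walk k n v x w.
Proof.
elim: n x w => [//|n IH] x w; rewrite !walkS -step_lin.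
by apply: step_ext.
Qed.

Lemma walkZ k n a u x w : walk k n (fun x w => a * u x w) x w = a * walk k n u x w.
Proof.
rewrite -[RHS]addr0 -[X in _ + X](mul0r (walk k n u x w)) -walk_lin.
by apply: walk_ext => x' w'; rewrite mul0r addr0.
Qed.

Lemma walkDf k n u v x w :
  walk k n (fun x w => u x w + v x w) x w = walk k n u x w + walk k n v x w.
Proof.
rewrite -[X in _ = X + _]mul1r -[X in _ = _ + X]mul1r -walk_lin.
by apply: walk_ext => x' w'; rewrite !mul1r.
Qed.

Lemma walkBf k n u v x w :
  walk k n (fun x w => u x w - v x w) x w = walk k n u x w - walk k n v x w.
Proof.
rewrite -[X in _ = X + _]mul1r -mulN1r -walk_lin.
by apply: walk_ext => x' w'; rewrite mul1r mulN1r.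
Qed.

Lemma walk_sum k n (I : Type) (r : seq I) (F : I -> T -> R -> R) x w :
  walk k n (fun x w => \sum_(i <- r) F i x w) x w = \sum_(i <- r) walk k n (F i) x w.
Proof.
elim: r => [|i r IH].
  rewrite big_nil -[RHS](mul0r (walk k n (fun _ _ => 0) x w)) -walkZ.
  by apply: walk_ext => x' w'; rewrite big_nil mul0r.
rewrite big_cons -IH -walkDf; apply: walk_ext => x' w'.
by rewrite big_cons.
Qed.

(** A killed walk that survives a step is at a positive point, so an inequality known on any [D]
    containing the positive half-line propagates. [D] is later [- F <= w] or [0 < w]. *)
Lemma step_le_on (D : R -> Prop) k u v : (forall w, (k ==> (0 < w)) -> D w) ->
  (forall x w, D w -> u x w <= v x w) -> forall x w, step k u x w <= step k v x w.
Proof.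
move=> HD uv x w; apply: ler_sum => x' _; apply: ler_wpM2l; first by case: Pst.
case: ifP => // H; apply: uv; apply: HD; move: H; case: k => //=.
by rewrite leNgt => /negbFE.
Qed.

Lemma walk_le_on (D : R -> Prop) k n u v : (forall w, (k ==> (0 < w)) -> D w) ->
  (forall x w, D w -> u x w <= v x w) ->
  forall x w, D w -> walk k n u x w <= walk k n v x w.
Proof.
move=> HD uv; elim: n => [|n IH] x w Dw; first exact: uv.
by rewrite !walkS; apply: (step_le_on HD).
Qed.

Lemma walk_le k n u v : (forall x w, u x w <= v x w) ->
  forall x w, walk k n u x w <= walk k n v x w.
Proof. by move=> uv x w; apply: (@walk_le_on (fun _ => True)). Qed.

Lemma walk0 k n x w : walk k n (fun _ _ => 0) x w = 0.
Proof.
rewrite -[RHS](mul0r (walk k n (fun _ _ => 0) x w)) -walkZ.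
by apply: walk_ext => x' w'; rewrite mul0r.
Qed.

Lemma walk_ge0 k n u : (forall x w, 0 <= u x w) -> forall x w, 0 <= walk k n u x w.
Proof. by move=> u0 x w; rewrite -(walk0 k n x w); apply: walk_le. Qed.

Lemma step_cst (c : R) x w : step false (fun _ _ => c) x w = c.
Proof. by rewrite /step /= -mulr_suml; case: Pst => _ ->; rewrite mul1r. Qed.

Lemma walk_cst n (c : R) x w : walk false n (fun _ _ => c) x w = c.
Proof.
elim: n x w => [//|n IH] x w; rewrite walkS.
by rewrite (step_ext _ IH) step_cst.
Qed.

Lemma walk_shift n u d x w :
  walk false n (fun x w => u x (w + d)) x w = walk false n u x (w + d).
Proof.
elim: n x w => [//|n IH] x w; rewrite !walkS /step /=.
by apply: eq_bigr => x' _; rewrite IH addrAC.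
Qed.

Lemma step_kill_le u : (forall x w, 0 <= u x w) ->
  forall x w, step true u x w <= step false u x w.
Proof.
move=> u0 x w; apply: ler_sum => x' _; apply: ler_wpM2l; first by case: Pst.
by rewrite /=; case: ifP.
Qed.

Lemma walk_kill_le n u : (forall x w, 0 <= u x w) ->
  forall x w, walk true n u x w <= walk false n u x w.
Proof.
move=> u0; elim: n => [//|n IH] x w; rewrite !walkS.
apply: (le_trans (step_kill_le (walk_ge0 true n u0) x w)).
exact: (@walk_le false 1).
Qed.

Lemma walk_norm_le k n u v : (forall x w, `|u x w| <= v x w) ->
  forall x w, `|walk k n u x w| <= walk k n v x w.
Proof.
move=> uv x w; rewrite ler_norml -mulN1r -walkZ; apply/andP; split.
  by apply: walk_le => x' w'; have := uv x' w'; rewrite mulN1r ler_norml => /andP[].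
by apply: walk_le => x' w'; have := uv x' w'; rewrite ler_norml => /andP[].
Qed.

Lemma walk_norm_le_on (D : R -> Prop) k n u v : (forall w, (k ==> (0 < w)) -> D w) ->
  (forall x w, D w -> `|u x w| <= v x w) ->
  forall x w, D w -> `|walk k n u x w| <= walk k n v x w.
Proof.
move=> HD uv x w Dw; rewrite ler_norml -mulN1r -walkZ; apply/andP; split.
  by apply: (@walk_le_on D) => // x' w' Dw'; have := uv x' w' Dw'; rewrite mulN1r ler_norml => /andP[].
by apply: (@walk_le_on D) => // x' w' Dw'; have := uv x' w' Dw'; rewrite ler_norml => /andP[].
Qed.

Lemma walk_bound n u (B : R) : (forall x w, `|u x w| <= B) ->
  forall x w, `|walk false n u x w| <= B.
Proof. by move=> uB x w; rewrite -[leRHS](walk_cst n B x w); apply: walk_norm_le. Qed.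

Lemma walk_le_cst n u (B : R) : (forall x w, u x w <= B) ->
  forall x w, walk false n u x w <= B.
Proof. by move=> uB x w; rewrite -[leRHS](walk_cst n B x w); apply: walk_le. Qed.

Definition survp n : T -> R -> R := walk true n (fun _ _ => 1).

Lemma survp_ge0 n x w : 0 <= survp n x w.
Proof. exact: walk_ge0. Qed.

Lemma survp_le1 n x w : survp n x w <= 1.
Proof. by rewrite -[leRHS](walk_cst n 1 x w); apply: walk_kill_le. Qed.

Lemma survpD m n x w : survp (m + n) x w = walk true m (survp n) x w.
Proof. by rewrite /survp walkD. Qed.

Lemma pathE_ext n x (F G : seq T -> R) : F =1 G -> pathE P n x F = pathE P n x G.
Proof.
by elim: n x F G => [|n IH] x F G FG /=; [|apply: eq_bigr => x' _; congr (_ * _); apply: IH => s].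
Qed.

Lemma pathE0 n x : pathE P n x (fun=> 0) = 0.
Proof. by elim: n x => [//|n IH] x /=; apply: big1 => x' _; rewrite IH mulr0. Qed.

Lemma prob_survE n x y : prob_surv P f n x y = survp n x y.
Proof.
rewrite /prob_surv /survp; elim: n x y => [//|n IH] x y.
rewrite walkS /step /=; apply: eq_bigr => x' _; congr (_ * _).
case: ltP => h /=; last exact: pathE0.
by rewrite -IH; apply: pathE_ext.
Qed.

Definition win (psi : T -> R) z a : T -> R -> R :=
  fun x w => if z <= w <= z + a then psi x else 0.

Lemma ElocE psi n x y z a : Eloc P f psi n x y z a = walk true n (win psi z a) x y.
Proof.
rewrite /Eloc; elim: n x y => [|n IH] x y.
  by rewrite /= /win /Ssum big_nil addr0.
rewrite walkS /step /=; apply: eq_bigr => x' _; congr (_ * _).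
case: ltP => h /=; last by under pathE_ext do rewrite /=; exact: pathE0.
rewrite -IH; apply: pathE_ext => s.
by rewrite /Ssum big_cons addrA.
Qed.

End Operators.

(** * Ergodicity and Poisson equations *)

Lemma fin_pos_lb (R : realType) (I : finType) (h : I -> R) : (forall i, 0 < h i) ->
  exists2 d : R, 0 < d & forall i, d <= h i.
Proof.
move=> h0.
suff [d d0 Hd] : exists2 d : R, 0 < d & forall i, i \in enum I -> d <= h i.
  by exists d => // i; apply: Hd; rewrite mem_enum.
elim: (enum I) => [|i s [d d0 Hd]]; first by exists 1.
exists (Num.min d (h i)); first by rewrite lt_min d0 h0.
move=> j; rewrite inE => /orP[/eqP->|js]; first by rewrite ge_min lexx orbT.
by rewrite ge_min Hd.
Qed.

Lemma fin_ub (R : realType) (I : finType) (h : I -> R) :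
  exists2 B : R, 0 < B & forall i, `|h i| <= B.
Proof.
exists (1 + \sum_i `|h i|); first by rewrite ltr_pwDl // sumr_ge0.
by move=> i; rewrite (bigD1 i) //= addrCA lerDl addr_ge0 ?sumr_ge0.
Qed.

Section Chain.
Variables (R : realType) (T : finType) (P : T -> T -> R) (f : T -> R).
Hypothesis Pst : stochastic P.
Local Notation walk := (walk P f).

Lemma PopE (g : T -> R) x : Pop P g x = \sum_x' P x x' * g x'.
Proof. by apply: eq_bigr => x' _; rewrite mulrC. Qed.

Lemma PpowE n (g : T -> R) x w : Ppow P n g x = walk false n (fun x _ => g x) x w.
Proof.
elim: n x w => [//|n IH] x w; rewrite /Ppow iterS PopE walkS /step /=.
by apply: eq_bigr => x' _; rewrite -IH.
Qed.

(** Paths of positive probability. The displacement [s] collects [f] at every vertex but the first,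
    as [S_n] does, so that displacements add under concatenation. *)
Inductive reach : nat -> T -> T -> R -> Prop :=
| reach0 x : reach 0 x x 0
| reachS n x x1 x' s : 0 < P x x1 -> reach n x1 x' s -> reach n.+1 x x' (f x1 + s).

Lemma reach_cat n m x x' x'' s s' :
  reach n x x' s -> reach m x' x'' s' -> reach (n + m) x x'' (s + s').
Proof.
move=> H; elim: H s' => {n x x' s} [x|n x x1 x' s P0 _ IH] s' H'; first by rewrite add0r.
by rewrite addSn -addrA; apply: reachS => //; apply: IH.
Qed.

Lemma reach_walk n x x' s : reach n x x' s -> exists2 q : R, 0 < q &
  forall F, (forall x w, 0 <= F x w) -> forall w, q * F x' (w + s) <= walk false n F x w.
Proof.
move=> H; elim: H => {n x x' s} [x|n x x1 x' s P0 _ [q q0 Hq]].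
  by exists 1 => // F _ w; rewrite addr0 mul1r.
exists (P x x1 * q); first exact: mulr_gt0.
move=> F F0 w; rewrite walkS /step /= (bigD1 x1) //= -[leLHS]addr0 lerD //.
  by rewrite -mulrA ler_wpM2l ?(ltW P0) // addrA Hq.
apply: sumr_ge0 => y _; apply: mulr_ge0; first by case: Pst.
exact: walk_ge0.
Qed.

Lemma Ppow_gt0_reach n x x' : 0 < Ppow P n (fun t => (t == x')%:R) x ->
  exists s, reach n x x' s.
Proof.
elim: n x => [|n IH] x /=.
  by case: eqP => [-> _|_]; [exists 0; apply: reach0 | rewrite /= ltxx].
rewrite PopE => H.
suff [x1 H1] : exists x1, 0 < P x x1 * Ppow P n (fun t => (t == x')%:R) x1.
  have P0 : 0 <= P x x1 by case: Pst.
  have P1 : 0 < P x x1 by rewrite lt_neqAle P0 andbT; apply: contraTneq H1 => <-; rewrite mul0r ltxx.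
  have [s Hs] := IH x1 ltac:(by move: H1; rewrite pmulr_rgt0).
  by exists (f x1 + s); apply: reachS.
apply/not_existsP => N.
suff : \sum_x1 P x x1 * Ppow P n (fun t => (t == x')%:R) x1 <= 0 by rewrite leNgt H.
by apply: sumr_le0 => x1 _; rewrite leNgt; apply/negP; apply: N.
Qed.

(** [H3] counts [f x0] at the start of the cycle, whereas the walk collects it on the closing step;
    hence the order of the sum. *)
Lemma cycle_reach x0 prev xs : 0 < cycle_w P x0 prev xs ->
  reach (size xs).+1 prev x0 (\sum_(x <- xs) f x + f x0).
Proof.
elim: xs prev => [|x xs IH] prev /= H.
  rewrite big_nil add0r -[f x0]addr0; apply: reachS => //; exact: reach0.
have P0 : 0 <= P prev x by case: Pst.
have P1 : 0 < P prev x by rewrite lt_neqAle P0 andbT; apply: contraTneq H => <-; rewrite mul0r ltxx.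
rewrite big_cons -addrA; apply: reachS => //; apply: IH.
by move: H; rewrite pmulr_rgt0.
Qed.

Variable nu : T -> R.
Hypothesis nuP : invariant_prob P nu.

Lemma nu_Ppow n g : nuE nu (Ppow P n g) = nuE nu g.
Proof.
elim: n => [//|n <-]; rewrite {1}/nuE /Ppow iterS -/(Ppow P n g).
under eq_bigr do rewrite PopE mulr_suml.
rewrite exchange_big /=; apply: eq_bigr => x' _.
under eq_bigr do rewrite mulrAC mulrC (mulrC _ (nu _)).
by rewrite -mulr_sumr; case: nuP => _ [_ ->].
Qed.

Lemma nu_bound g (B : R) : (forall x, g x <= B) -> nuE nu g <= B.
Proof.
move=> gB; case: nuP => nu0 [nu1 _].
rewrite -[leRHS]mulr1 -nu1 mulr_sumr; apply: ler_sum => x _.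
exact: ler_wpM2r.
Qed.

Lemma nuEN g : nuE nu (fun x => - g x) = - nuE nu g.
Proof. by rewrite /nuE -sumrN; apply: eq_bigr => x _; rewrite mulNr. Qed.

Lemma nuE_normB (c : R) g (B : R) : (forall x, `|c - g x| <= B) -> `|c - nuE nu g| <= B.
Proof.
move=> H; have E : c - nuE nu g = nuE nu (fun x => c - g x).
  case: nuP => nu0 [nu1 _]; rewrite /nuE -[X in X - _]mulr1 -nu1 mulr_sumr -sumrB.
  by apply: eq_bigr => x _; rewrite mulrBl.
rewrite E ler_norml lerNl -nuEN !nu_bound // => x; have := H x; rewrite ler_norml => /andP[] //.
by move=> h1 h2; rewrite lerNl.
Qed.

Hypothesis HH1 : H1 P.

Lemma H1_reach : exists2 k0 : nat, (0 < k0)%N & forall x x', exists s, reach k0 x x' s.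
Proof.
case: HH1 => k0 [k0p Hk]; exists k0 => // x x'.
apply: Ppow_gt0_reach; apply: Hk; first by move=> t; exact: ler0n.
by exists x'; rewrite eqxx oner_neq0.
Qed.

(** Doeblin's minorisation: [H1] applied to indicators of points makes all entries of [P^k0]
    positive, and there are finitely many. The cap 1/2 keeps the rate in [ergodic] positive. *)
Lemma doeblin : exists k0 (d : R), [/\ (0 < k0)%N, 0 < d <= 1/2 &
  forall g : T -> R, (forall x, 0 <= g x) -> forall x z, d * g z <= Ppow P k0 g x].
Proof.
case: HH1 => k0 [k0p Hk]; exists k0.
have pos (p : T * T) : 0 < Ppow P k0 (fun t => (t == p.2)%:R) p.1.
  by apply: Hk; [move=> t; exact: ler0n | exists p.2; rewrite eqxx oner_neq0].
have [d d0 Hd] := fin_pos_lb pos.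
exists (Num.min d (1/2)); split => //.
  by rewrite lt_min d0 ge_min lexx orbT andbT; lra.
move=> g g0 x z.
apply: (@le_trans _ _ (d * g z)); first by rewrite ler_wpM2r // ge_min lexx.
apply: (@le_trans _ _ (g z * Ppow P k0 (fun t => (t == z)%:R) x)).
  by rewrite mulrC ler_wpM2l // (Hd (x, z)).
rewrite !(PpowE _ _ _ 0) -(walkZ P f false k0 (g z) (fun x _ => (x == z)%:R)).
apply: walk_le => // x' w'.
by case: eqP => [->|_]; rewrite ?mulr1 ?mulr0.
Qed.

Lemma argmin_ex (g : T -> R) (x0 : T) : exists z, forall x, g z <= g x.
Proof. by case: (arg_minP g (i0 := x0) (P := xpredT)) => // i _ H; exists i => x; apply: H. Qed.

Lemma argmax_ex (g : T -> R) (x0 : T) : exists z, forall x, g x <= g z.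
Proof. by case: (arg_maxP g (i0 := x0) (P := xpredT)) => // i _ H; exists i => x; apply: H. Qed.

Lemma Ppow_cst n (c : R) x : Ppow P n (fun=> c) x = c.
Proof. by rewrite (PpowE _ _ _ 0) walk_cst. Qed.

Lemma Ppow_osc_le n (B : R) (g : T -> R) : (forall x y, g x - g y <= B) ->
  forall x y, Ppow P n g x - Ppow P n g y <= B.
Proof.
move=> H x y; have [m Hm] := argmin_ex g x; have [M HM] := argmax_ex g x.
have h1 : Ppow P n g x <= g M.
  by rewrite -[leRHS](Ppow_cst n (g M) x) !(PpowE _ _ _ 0); apply: walk_le.
have h2 : g m <= Ppow P n g y.
  by rewrite -[leLHS](Ppow_cst n (g m) y) !(PpowE _ _ _ 0); apply: walk_le.
by have := H M m; lra.
Qed.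

Lemma PpowB n (g1 g2 : T -> R) x :
  Ppow P n (fun t => g1 t - g2 t) x = Ppow P n g1 x - Ppow P n g2 x.
Proof. by rewrite !(PpowE _ _ _ 0) -walkBf. Qed.

Lemma ergodic : exists C rho : R, [/\ 0 < C, 0 < rho < 1 &
  forall g (B : R), (forall x, `|g x| <= B) -> forall n x,
    `|Ppow P n g x - nuE nu g| <= C * rho ^+ n * B].
Proof.
have [k0 [d [k0p /andP[d0 d1] Hd]]] := doeblin.
have contr (g : T -> R) (B : R) : (forall x y, g x - g y <= B) ->
    forall x y, Ppow P k0 g x - Ppow P k0 g y <= (1 - d) * B.
  move=> H x y; have [m Hm] := argmin_ex g x; have [M HM] := argmax_ex g x.
  have h2 : g m <= Ppow P k0 g y.
    by rewrite -[leLHS](Ppow_cst k0 (g m) y) !(PpowE _ _ _ 0); apply: walk_le.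
  (* The nonnegative function [g M - g] is largest at the minimiser [m], which every row of [P^k0]
     charges with at least [d]: the oscillation shrinks by the factor [1 - d]. *)
  have h1 := Hd (fun t => g M - g t) (fun t => ltac:(by rewrite subr_ge0)) x m.
  rewrite PpowB Ppow_cst in h1.
  have h3 := H M m.
  have h4 : (1 - d) * (g M - g m) <= (1 - d) * B by rewrite ler_wpM2l //; lra.
  lra.
have contrn (g : T -> R) (B : R) q : (forall x y, g x - g y <= B) ->
    forall x y, Ppow P (q * k0) g x - Ppow P (q * k0) g y <= (1 - d) ^+ q * B.
  move=> H; elim: q => [|q IH]; first by rewrite mul0n expr0 mul1r.
  by rewrite mulSn /Ppow iterD exprS -mulrA; apply: contr.
have k0R : (1 : R) <= k0%:R by rewrite ler1n.
(* A substitute for the [k0]-th root of [1 - d]: Bernoulli's inequality gives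
   [1 - d <= rho ^+ k0]. *)
pose rho : R := 1 - d / k0%:R.
have dk : 0 < d / k0%:R <= d.
  have k0R0 : 0 < k0%:R :> R by rewrite ltr0n.
  by rewrite divr_gt0 //= ler_pdivrMr // ler_peMr // ltW.
have rho01 : 0 < rho < 1 by rewrite /rho; case/andP: dk => *; apply/andP; split; lra.
have bern : 1 - d <= rho ^+ k0.
  have Hn n : 1 - n%:R * (d / k0%:R) <= rho ^+ n.
    elim: n => [|n IH]; first by rewrite mul0r expr0 subr0.
    rewrite exprS; case/andP: rho01 => r0 r1; case/andP: dk => dk0 dk1.
    apply: (@le_trans _ _ (rho * (1 - n%:R * (d / k0%:R)))); last by rewrite ler_wpM2l // ltW.
    rewrite /rho -natr1; set e := d / k0%:R; have : 0 <= n%:R * e ^+ 2 by rewrite mulr_ge0 // sqr_ge0.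
    by nra.
  by have := Hn k0; rewrite mulrCA divff ?mulr1 // gt_eqF // (lt_le_trans ltr01).
(* The 2 bounds an oscillation by a supremum norm; the division by [rho ^+ k0] pays for the
   [n %% k0] steps that do not fill a block. *)
exists (2 / rho ^+ k0), rho; case/andP: (rho01) => r0 r1; split=> //.
  by rewrite divr_gt0 // exprn_gt0.
move=> g B gB n x.
have B0 : 0 <= B by apply: le_trans (gB x).
have osc a b : g a - g b <= 2 * B.
  by have := gB a; have := gB b; rewrite !ler_norml => /andP[? ?] /andP[? ?]; lra.
have oscn a b : Ppow P n g a - Ppow P n g b <= 2 / rho ^+ k0 * rho ^+ n * B.
  rewrite (divn_eq n k0) addnC /Ppow iterD.
  apply: (@le_trans _ _ ((1 - d) ^+ (n %/ k0) * (2 * B))).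
    by apply: Ppow_osc_le; apply: contrn.
  apply: (@le_trans _ _ ((rho ^+ k0) ^+ (n %/ k0) * (2 * B))).
    by rewrite ler_wpM2r ?mulr_ge0 // lerXn2r // nnegrE; [lra|rewrite exprn_ge0 // ltW].
  rewrite -exprM exprD (mulnC k0) mulrA.
  have h : 1 <= rho ^+ (n %% k0) / rho ^+ k0.
    rewrite ler_pdivlMr ?exprn_gt0 // mul1r ler_wiXn2l ?(ltW r0) ?(ltW r1) //.
    by rewrite ltnW // ltn_pmod.
  set A := rho ^+ (n %/ k0 * k0).
  have A0 : 0 <= A * 2 * B by rewrite !mulr_ge0 // exprn_ge0 // ltW.
  have -> : 2 / rho ^+ k0 * (rho ^+ (n %% k0) * A) * B = (rho ^+ (n %% k0) / rho ^+ k0) * (A * 2 * B).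
    by ring.
  by rewrite -[leLHS]mul1r ler_wpM2r.
rewrite -(nu_Ppow n); apply: nuE_normB => y.
by rewrite ler_norml lerNl opprB !oscn.
Qed.

End Chain.

Lemma cvg_sumr (R : realType) (I : Type) (s : seq I) (F : I -> nat -> R) (l : I -> R) :
  (forall i, F i n @[n --> \oo] --> l i)%classic ->
  ((\sum_(i <- s) F i n) @[n --> \oo] --> \sum_(i <- s) l i)%classic.
Proof.
move=> H; elim: s => [|i s IH].
  by rewrite big_nil; under eq_fun do rewrite big_nil; exact: cvg_cst.
by rewrite big_cons; under eq_fun do rewrite big_cons; apply: cvgD.
Qed.

Section Corrector.
Variables (R : realType) (T : finType) (P : T -> T -> R) (f nu : T -> R).
Hypothesis Pst : stochastic P.
Hypothesis nuP : invariant_prob P nu.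
Hypothesis HH1 : H1 P.

Lemma potential_cvg (g : T -> R) x : nuE nu g = 0 ->
  cvgn (series (fun k => Ppow P k g x)).
Proof.
move=> g0; have [C [rho [C0 /andP[r0 r1] H]]] := ergodic f Pst nuP HH1.
have [B B0 gB] := fin_ub g.
apply: normed_cvg; apply: (series_le_cvg (v_ := geometric (C * B) rho)).
- by move=> n; exact: normr_ge0.
- by move=> n; rewrite /= mulr_ge0 ?exprn_ge0 ?mulr_ge0 ?ltW.
- by move=> n; have := H g B gB n x; rewrite g0 subr0 /= mulrAC.
- by apply: is_cvg_geometric_series; rewrite ger0_norm // ltW.
Qed.

(** [th] is the potential of [g], the Neumann series of [(1 - P)^-1 g], which converges
    geometrically for centred [g]. *)
Lemma poisson (g : T -> R) : nuE nu g = 0 ->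
  let th := fun x => limn (series (fun k => Ppow P k g x)) in
  forall x, th x - \sum_x' P x x' * th x' = g x.
Proof.
move=> g0 th x; apply/eqP; rewrite subr_eq; apply/eqP.
have cv y : (series (fun k => Ppow P k g y) n @[n --> \oo] --> th y)%classic.
  exact: potential_cvg.
have c1 : (series (fun k => Ppow P k g x) n.+1 @[n --> \oo] --> th x)%classic.
  by rewrite (cvg_shiftS (series (fun k => Ppow P k g x))).
have c2 : ((g x + \sum_x' P x x' * series (fun k => Ppow P k g x') n) @[n --> \oo] -->
    g x + \sum_x' P x x' * th x')%classic.
  apply: cvgD; first exact: cvg_cst.
  apply: cvg_sumr => x'.
  by apply: cvgM; [exact: cvg_cst|exact: cv].
have E : (fun n => series (fun k => Ppow P k g x) n.+1) =
    (fun n => g x + \sum_x' P x x' * series (fun k => Ppow P k g x') n).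
  apply/funext => n; rewrite /series /= big_nat_recl //=; congr (_ + _).
  under [RHS]eq_bigr do rewrite mulr_sumr.
  by rewrite [RHS]exchange_big /=; apply: eq_bigr => k _; rewrite PopE.
rewrite E in c1.
by rewrite -[LHS](cvg_lim (@Rhausdorff R) c1); apply/cvg_lim.
Qed.

Hypothesis f0 : H2 nu f.
Hypothesis HH3 : H3 P f.

Lemma nu_gt0 x : 0 < nu x.
Proof.
have [k0 [d [_ /andP[d0 _] Hd]]] := doeblin f Pst HH1.
have E : nuE nu (fun t => (t == x)%:R) = nu x.
  rewrite /nuE (bigD1 x) //= eqxx mul1r big1 ?addr0 // => y /negbTE ->.
  by rewrite mul0r.
rewrite -E -(nu_Ppow nuP k0); apply: (lt_le_trans d0).
rewrite -lerN2 -nuEN; apply: (nu_bound nuP) => y; rewrite lerN2.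
by have := Hd (fun t => (t == x)%:R) (fun t => ler0n _ _) y x; rewrite eqxx mulr1.
Qed.

Lemma nuED (g1 g2 : T -> R) : nuE nu (fun x => g1 x + g2 x) = nuE nu g1 + nuE nu g2.
Proof. by rewrite /nuE -big_split; apply: eq_bigr => x _; rewrite mulrDl. Qed.

Lemma nuE_step (g : T -> R) : nuE nu (fun x => \sum_x' P x x' * g x') = nuE nu g.
Proof. by rewrite -(nu_Ppow nuP 1 g); apply: eq_bigr => x _; rewrite /= PopE. Qed.

(** The series of covariances starts at index 1 and the potential at 0, hence the subtracted
    [f x]. *)
Lemma sigma2E (th : T -> R) :
  (forall x, th x = limn (series (fun k => Ppow P k f x))) ->
  sigma2 P nu f = nuE nu (fun x => f x ^+ 2) + 2 * nuE nu (fun x => f x * (th x - f x)).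
Proof.
move=> thE; rewrite /sigma2; congr (_ + 2 * _).
apply/cvg_lim => //.
rewrite -(cvg_shiftS (fun N => \sum_(1 <= k < N) nuE nu (fun x => f x * Ppow P k f x))).
have c2 : (\sum_x f x * (series (fun k => Ppow P k f x) n.+1 - f x) * nu x @[n --> \oo] -->
    nuE nu (fun x => f x * (th x - f x)))%classic.
  apply: cvg_sumr => x.
  apply: cvgM; last exact: cvg_cst.
  apply: cvgM; first exact: cvg_cst.
  apply: cvgB; last exact: cvg_cst.
  rewrite (cvg_shiftS (series (fun k => Ppow P k f x))) thE.
  exact: potential_cvg.
apply: cvg_trans c2; apply: near_eq_cvg; near=> n => /=.
rewrite /nuE exchange_big /=; apply: eq_bigr => x _.
rewrite /series /= big_nat_recl //= addrC addKr mulr_sumr mulr_suml.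
by rewrite big_add1.
Unshelve. all: by end_near.
Qed.

(* [r] makes [w + r x] harmonic for the walk and [rho] compensates the
   fluctuation of its conditional variance around [sigma2]. *)
Lemma correctors : exists r rho : T -> R,
  [/\ forall x, \sum_x' P x x' * (f x' + r x') = r x,
      forall x, \sum_x' P x x' * (f x' + r x' - r x) ^+ 2 + \sum_x' P x x' * rho x'
                = sigma2 P nu f + rho x &
      0 < sigma2 P nu f].
Proof.
pose th x := limn (series (fun k => Ppow P k f x)).
have thE := poisson f0; rewrite -/th in thE.
(* With [r = P th] the function [f + r] is the potential of [f] itself, and [f x' + r x' - r x] is
   Gordin's martingale increment. *)
pose r x := \sum_x' P x x' * th x'.
have frE x : f x + r x = th x by rewrite -thE /r subrK.
have h1 x : \sum_x' P x x' * (f x' + r x') = r x by apply: eq_bigr => x' _; rewrite frE.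
pose v x := \sum_x' P x x' * (f x' + r x' - r x) ^+ 2.
have vE x : v x = \sum_x' P x x' * th x' ^+ 2 - r x ^+ 2.
  have -> : v x = \sum_x' (P x x' * th x' ^+ 2 + (- (2 * r x)) * (P x x' * th x') + r x ^+ 2 * P x x').
    by apply: eq_bigr => x' _; rewrite frE; ring.
  rewrite !big_split /= -!mulr_sumr -/(r x).
  by case: Pst => _ ->; ring.
have sE : nuE nu v = sigma2 P nu f.
  have -> : nuE nu v = nuE nu (fun x => th x ^+ 2 + (- r x ^+ 2)).
    rewrite nuED -(nuE_step (fun x => th x ^+ 2)) -nuED.
    by apply: eq_bigr => x _; rewrite vE.
  (* Substituting [r = th - f] in the stationary variance [nu(th^2 - r^2)] gives the Green-Kubo
     series. *)
  rewrite (sigma2E (fun x => erefl (th x))).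
  have <- : nuE nu (fun x => f x ^+ 2 + (f x * (th x - f x) + f x * (th x - f x))) =
     nuE nu (fun x => f x ^+ 2) + 2 * nuE nu (fun x => f x * (th x - f x)).
    by rewrite !nuED; ring.
  by apply: eq_bigr => x _; congr (_ * _); rewrite -frE; ring.
have v0 x : 0 <= v x.
  by apply: sumr_ge0 => x' _; rewrite mulr_ge0 ?sqr_ge0 //; case: Pst.
have s0 : 0 < sigma2 P nu f.
  rewrite lt_neqAle -sE; apply/andP; split; last first.
    by apply: sumr_ge0 => x _; rewrite mulr_ge0 // ltW // nu_gt0.
  (* Zero variance makes every increment vanish, so [f x' = r x - r x'] along edges and [f] sums to
     0 over each cycle, against [H3] with both parameters 0. *)
  apply/eqP => sz.
  have vz x : v x = 0.
    have /eqP := esym sz; rewrite psumr_eq0; last by move=> y _; rewrite mulr_ge0 // ltW // nu_gt0.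
    move=> /allP /(_ x); rewrite mem_index_enum => /(_ isT) /implyP /(_ isT).
    by rewrite mulf_eq0 (gt_eqF (nu_gt0 x)) orbF => /eqP.
  have xiz x x' : 0 < P x x' -> f x' = r x - r x'.
    move=> P0; have /eqP := vz x; rewrite psumr_eq0; last first.
      by move=> y _; rewrite mulr_ge0 ?sqr_ge0 //; case: Pst.
    move=> /allP /(_ x'); rewrite mem_index_enum => /(_ isT) /implyP /(_ isT).
    rewrite mulf_eq0 (gt_eqF P0) sqrf_eq0 subr_eq0 => /eqP <-.
    by rewrite addrK.
  have rz n x x' s : reach P f n x x' s -> s = r x - r x'.
    elim=> {n x x' s} [x|n x x1 x' s P0 _ ->]; first by rewrite subrr.
    by rewrite (xiz _ _ P0) addrA subrK.
  have [x0 [xs [Hc Hn]]] := HH3 0 0.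
  apply: Hn; exists 0%Z; rewrite mulr0 mul0r subr0 big_cons addrC.
  by rewrite (rz _ _ _ _ (cycle_reach f Pst Hc)) subrr.
pose g x := v x - sigma2 P nu f.
have gz : nuE nu g = 0.
  rewrite nuED sE [X in _ + X](_ : _ = - sigma2 P nu f) ?subrr //.
  by rewrite /nuE -mulr_sumr; case: nuP => _ [-> _]; rewrite mulr1.
have rhoE := poisson gz.
exists r, (fun x => limn (series (fun k => Ppow P k g x))); split => // x.
rewrite -/(v x); have := rhoE x; rewrite /g => /eqP.
by rewrite subr_eq => /eqP ->; ring.
Qed.

End Corrector.

(** * Shift regularity of the free walk *)

Definition ind {R : realType} (b : bool) : R := b%:R.

Lemma indT (R : realType) : ind true = 1 :> R. Proof. by []. Qed.

Lemma indF (R : realType) : ind false = 0 :> R. Proof. by []. Qed.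

Lemma ind_ge0 (R : realType) b : 0 <= ind b :> R. Proof. exact: ler0n. Qed.

Lemma bin_incr_half n i : (i.*2 < n)%N -> ('C(n, i) <= 'C(n, i.+1))%N.
Proof.
move=> h; have := mul_bin_left n i => E.
have : (i.+1 * 'C(n, i) <= i.+1 * 'C(n, i.+1))%N by rewrite E leq_mul2r; apply/orP; right; lia.
by rewrite leq_pmul2l.
Qed.

Lemma bin_unimodal n i k : (i <= k)%N -> (k <= n - i)%N -> ('C(n, i) <= 'C(n, k))%N.
Proof.
have half m : (i <= m)%N -> (m.*2 <= n)%N -> ('C(n, i) <= 'C(n, m))%N.
  elim: m => [|m IH]; first by rewrite leqn0 => /eqP ->.
  rewrite leq_eqVlt => /orP[/eqP -> //|im] mn.
  apply: leq_trans (IH _ _) (bin_incr_half _); lia.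
move=> ik kn; case: (leqP k.*2 n) => h; first exact: half.
by rewrite -(bin_sub (m := k)); [apply: half|]; lia.
Qed.

(** The [n - 2i + 1] coefficients from [i] to [n - i] are all at least ['C(n, i)], and the whole row
    sums to [2 ^ n]. *)
Lemma bin_mul_le n i : (i.*2 <= n)%N -> ('C(n, i) * (n - i.*2).+1 <= 2 ^ n)%N.
Proof.
move=> h; rewrite -[2%N]/(1 + 1)%N expnDn.
under eq_bigr do rewrite !exp1n !muln1.
rewrite -(big_mkord xpredT (fun k => 'C(n, k))).
rewrite (@big_cat_nat _ _ _ i) /=; [|lia|lia].
rewrite [X in (_ + X)%N](@big_cat_nat _ _ _ (n - i).+1) /=; [|lia|lia].
apply: leq_trans (leq_addl _ _); apply: leq_trans (leq_addr _ _).
have -> : ('C(n, i) * (n - i.*2).+1 = \sum_(i <= k < (n - i).+1) 'C(n, i))%N.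
  by rewrite sum_nat_const_nat mulnC; congr (_ * _)%N; lia.
rewrite big_nat_cond [leqRHS]big_nat_cond; apply: leq_sum => k; rewrite andbT => /andP[h1 h2].
by apply: bin_unimodal => //; lia.
Qed.

Section Smoothing.
Variables (R : realType) (T : finType) (P : T -> T -> R) (f : T -> R).
Hypothesis Pst : stochastic P.
Local Notation Q := (walk P f false).
Implicit Types (u F : T -> R -> R) (d : R).

(** The coefficients of [(1 - X) (1 + X)^j]: a difference over one shift, averaged [j] times over
    that shift. *)
Definition dcoef (j i : nat) : R := 'C(j, i)%:R - (if i is i'.+1 then 'C(j, i')%:R else 0).

Lemma dcoefS j i : dcoef j.+1 i.+1 = dcoef j i.+1 + dcoef j i.
Proof.
rewrite /dcoef; case: i => [|i]; first by rewrite !bin0 binS bin0 natrD; ring.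
by rewrite !binS !natrD; ring.
Qed.

(** Multiplied by [j + 1] the coefficient is ['C(j.+1, i)] times [j + 1 - 2i], which [bin_mul_le]
    controls on either side of the middle: neighbouring binomial probabilities differ by
    [O(1/j)]. *)
Lemma dcoef_bound j i : `|dcoef j i| <= 2 ^+ j * (2 / j.+1%:R).
Proof.
have j0 : 0 < j.+1%:R :> R by rewrite ltr0n.
have key : j.+1%:R * dcoef j i = 'C(j.+1, i)%:R * (j.+1%:R - i.*2%:R).
  rewrite /dcoef; case: i => [|i].
    by rewrite !bin0 double0; ring.
  case: (leqP i.+1 j.+1) => h; last by rewrite !bin_small; [ring|lia|lia|lia].
  have e1 : (j.+1 * 'C(j, i) = i.+1 * 'C(j.+1, i.+1))%N by rewrite mul_bin_diag.
  have e2 : (j.+1 * 'C(j, i.+1) = (j.+1 - i.+1) * 'C(j.+1, i.+1))%N.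
    have := binS j i => E; rewrite mulnBl -e1 E; lia.
  have -> : j.+1%:R * ('C(j, i.+1)%:R - 'C(j, i)%:R) = (j.+1 * 'C(j, i.+1))%:R - (j.+1 * 'C(j, i))%:R :> R.
    by rewrite !natrM; ring.
  by rewrite e1 e2 !natrM natrB // -mul2n natrM; ring.
have : `|j.+1%:R * dcoef j i| <= 2 ^+ j.+1.
  rewrite key normrM normr_nat; case: (leqP i.*2 j.+1) => h.
    rewrite -natrB // normr_nat -natrM -natrX ler_nat.
    by apply: leq_trans (bin_mul_le h); rewrite leq_mul2l leqnSn orbT.
  rewrite -normrN opprB -natrB; last by lia.
  rewrite normr_nat -natrM -natrX ler_nat.
  case: (leqP i j.+1) => h2; last by rewrite bin_small.
  rewrite -(bin_sub h2); apply: leq_trans (bin_mul_le (n := j.+1) (i := j.+1 - i) _); last by lia.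
  by rewrite leq_mul2l; apply/orP; right; lia.
rewrite normrM normr_nat => h; rewrite mulrA ler_pdivlMr // mulrC; apply: le_trans h _.
by rewrite exprSr.
Qed.

Lemma count_grid_le (n : nat) d (w z L : R) : 0 < d -> 0 <= L ->
  \sum_(i < n) ind (z <= w + i%:R * d <= z + L) <= L / d + 1 :> R.
Proof.
move=> d0 L0.
have Ld : 0 <= L / d by rewrite divr_ge0 // ltW.
have rec m v : \sum_(i < m.+1) ind (z <= v + i%:R * d <= z + L) =
    ind (z <= v <= z + L) + \sum_(i < m) ind (z <= v + d + i%:R * d <= z + L) :> R.
  rewrite big_ord_recl /= mul0r addr0; congr (_ + _); apply: eq_bigr => i _.
  by rewrite /bump /= natrD mulrDl mul1r addrA.
have above m v : z <= v -> \sum_(i < m) ind (z <= v + i%:R * d <= z + L) <= Num.max 0 ((z + L - v) / d + 1) :> R.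
  elim: m v => [|m IH] v zv; first by rewrite big_ord0 le_max lexx.
  rewrite rec; have := IH (v + d) ltac:(lra).
  have -> : (z + L - (v + d)) / d + 1 = (z + L - v) / d by field; rewrite gt_eqF.
  rewrite zv /=; case: (lerP v (z + L)) => h /=.
    have : 0 <= (z + L - v) / d by rewrite divr_ge0 ?(ltW d0) //; lra.
    move=> h1; rewrite (max_idPr h1) => h2; rewrite le_max indT; apply/orP; right; lra.
  have : (z + L - v) / d <= 0 by rewrite pmulr_lle0 ?invr_gt0 //; lra.
  move=> h1; rewrite (max_idPl h1) => h2; rewrite le_max indF; apply/orP; left; lra.
elim: n w => [|n IH] w; first by rewrite big_ord0; lra.
case: (lerP z w) => h.
  apply: le_trans (above _ _ h) _; rewrite ge_max; apply/andP; split; first lra.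
  by rewrite lerD2r ler_pM2r ?invr_gt0 //; lra.
by rewrite rec [z <= w]leNgt h /= indF add0r; exact: IH.
Qed.

Definition avg d u : T -> R -> R := fun x w => (u x w + u x (w + d)) / 2.

Lemma iter_avg_diff j d u x w :
  iter j (avg d) (fun x w => u x w - u x (w + d)) x w =
  2 ^- j * \sum_(i < j.+2) dcoef j i * u x (w + i%:R * d).
Proof.
elim: j w => [|j IH] w.
  rewrite /= expr0 invr1 mul1r !big_ord_recl big_ord0 /= /dcoef /= !bin0 /=.
  by rewrite /bump /= addn0 bin_small // mul0r mul1r addr0; ring.
rewrite iterS /avg !IH -mulrDr exprS invfM mulrC mulrA; congr (_ * _).
rewrite [RHS]big_ord_recl [X in _ = _ + X]big_ord_recr /=.
have -> : \sum_(i < j.+2) dcoef j i * u x (w + d + i%:R * d) =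
  \sum_(i < j.+2) dcoef j i * u x (w + (lift ord0 i)%:R * d).
  by apply: eq_bigr => i _; rewrite /= /bump /= natrD; congr (_ * u x _); ring.
rewrite big_ord_recl /= [X in _ + X = _]big_ord_recr /=.
rewrite -!addrA; congr (_ + _).
  by rewrite /dcoef /= !bin0.
rewrite addrA -big_split /= /bump /=; congr (_ + _).
  by apply: eq_bigr => i _; rewrite !add1n dcoefS; ring.
rewrite !add1n; congr (_ * _); rewrite dcoefS.
by rewrite [X in X + _]/dcoef !bin_small // subrr add0r.
Qed.

Lemma avg_walk n d u x w : avg d (Q n u) x w = Q n (avg d u) x w.
Proof.
rewrite /avg -(walk_shift P f n u d) -walkDf mulrC -walkZ.
by apply: walk_ext => x' w'; rewrite mulrC.
Qed.

(** The weights move [A] to [A + 2q] on average. Convexity of the inverse costs part of this gain,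
    and since [A >= 1] half of it survives. *)
Lemma recip_step (A q : R) : 1 <= A -> 0 < q ->
  (1 - q *+ 2) / A + q *+ 2 / (A + 1) <= (A + q)^-1.
Proof.
move=> A1 q0.
have A0 : 0 < A by lra.
have A10 : 0 < A + 1 by lra.
have Aq0 : 0 < A + q by lra.
rewrite -subr_ge0.
have -> : (A + q)^-1 - ((1 - q *+ 2) / A + q *+ 2 / (A + 1)) =
  q * (A - 1 + q *+ 2) / (A * (A + 1) * (A + q)).
  by field; rewrite !gt_eqF.
by rewrite divr_ge0 ?mulr_ge0 //; lra.
Qed.

(** From any state a block of [p] steps contains, with total weight [2q], a fair choice between two
    points at distance [d], which amounts to one more [avg]. Stating the bound for all numbers [j]
    of averages at once lets the induction on [N] trade each block for [q] averages. *)
Lemma block_smoothing (p : nat) (q d C : R) u : 0 < q <= 1 / 2 -> 0 <= C ->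
  (forall x, exists x' s, forall F, (forall x w, 0 <= F x w) -> forall w,
     q * (F x' (w + s) + F x' (w + s + d)) <= Q p F x w) ->
  (forall j x w, `|iter j (avg d) u x w| <= C / j.+1%:R) ->
  forall N j x w, `|Q (N * p) (iter j (avg d) u) x w| <= C / (j.+1%:R + q * N%:R).
Proof.
move=> /andP[q0 q1] C0 Hp Hu; elim=> [|N IH] j x w; first by rewrite mulr0 addr0; exact: Hu.
rewrite mulSn walkD.
set H := Q (N * p) (iter j (avg d) u).
set A := j.+1%:R + q * N%:R.
have A1 : 1 <= A.
  by rewrite -[1]addr0 lerD ?mulr_ge0 ?ler0n ?(ltW q0) // ler1n.
have HB x' w' : `|H x' w'| <= C / A by exact: IH.
have HM x' w' : `|avg d H x' w'| <= C / (A + 1).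
  rewrite avg_walk; have := IH j.+1 x' w'; rewrite iterS -natr1.
  by rewrite /A addrAC.
have [x' [s Hs]] := Hp x.
have E1 : C / (j.+1%:R + q * N.+1%:R) = C * (A + q)^-1.
  by congr (C * _^-1); rewrite /A -[N.+1%:R]natr1; ring.
have up : C * ((1 - q *+ 2) / A + q *+ 2 / (A + 1)) <= C * (A + q)^-1.
  by rewrite ler_wpM2l // recip_step.
have E2 : C * ((1 - q *+ 2) / A + q *+ 2 / (A + 1)) = (1 - q *+ 2) * (C / A) + (q *+ 2) * (C / (A + 1)).
  by ring.
rewrite E1; apply: le_trans up; rewrite E2.
have := HM x' (w + s); rewrite /avg ler_norml => /andP[m1 m2].
(* The minorisation is available for nonnegative functions, so it is applied to [C / A - H] and to
   [C / A + H]. *)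
have h1 := Hs (fun x w => C / A - H x w) (fun x w => ltac:(by have := HB x w; rewrite subr_ge0 ler_norml => /andP[])) w.
have h2 := Hs (fun x w => C / A + H x w) (fun x w => ltac:(by have := HB x w; rewrite ler_norml => /andP[? _]; lra)) w.
rewrite walkBf (walk_cst f Pst) in h1; rewrite walkDf (walk_cst f Pst) in h2.
move: h1 h2 m1 m2; set a := H x' _; set b := H x' _; set c := Q p H x w.
set B1 := C / A; set B2 := C / (A + 1) => h1 h2 m1 m2.
have m1' : q * (- B2) <= q * ((a + b) / 2) by rewrite ler_wpM2l // ltW.
have m2' : q * ((a + b) / 2) <= q * B2 by rewrite ler_wpM2l // ltW.
rewrite ler_norml; apply/andP; split; lra.
Qed.

Definition inwin (z L : R) u := forall x w, `|u x w| <= ind (z <= w <= z + L).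

Lemma avg_diff_bound d z L u j x w : 0 < d -> 0 <= L -> inwin z L u ->
  `|iter j (avg d) (fun x w => u x w - u x (w + d)) x w| <= 2 * (L / d + 1) / j.+1%:R.
Proof.
move=> d0 L0 uz; rewrite iter_avg_diff normrM ger0_norm; last by rewrite invr_ge0 exprn_ge0.
have h : `|\sum_(i < j.+2) dcoef j i * u x (w + i%:R * d)| <=
    2 ^+ j * (2 / j.+1%:R) * (L / d + 1).
  apply: le_trans (ler_norm_sum _ _ _) _.
  apply: (@le_trans _ _ (2 ^+ j * (2 / j.+1%:R) * \sum_(i < j.+2) ind (z <= w + i%:R * d <= z + L))).
    rewrite mulr_sumr; apply: ler_sum => i _; rewrite normrM.
    by apply: ler_pM => //; exact: dcoef_bound.
  by apply: ler_wpM2l; rewrite ?count_grid_le // mulr_ge0 ?exprn_ge0 ?divr_ge0.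
have -> : 2 * (L / d + 1) / j.+1%:R = 2 ^- j * (2 ^+ j * (2 / j.+1%:R) * (L / d + 1)).
  by rewrite -!mulrA mulKf ?expf_neq0 //; ring.
by rewrite ler_wpM2l // invr_ge0 exprn_ge0.
Qed.

(** The order [1/n] is that of the derivative of a density of height and inverse width [1 / sqrt n].
    The admissible [d] form a subgroup of the reals, which [H3] prevents from lying in a lattice. *)
Definition shiftreg d := forall L : R, 0 <= L -> exists2 C : R, 0 <= C &
  forall n, (0 < n)%N -> forall z u, inwin z L u -> forall x w,
    `|Q n u x (w + d) - Q n u x w| <= C / n%:R.

Lemma shiftreg0 : shiftreg 0.
Proof. by move=> L L0; exists 0 => // n _ z u _ x w; rewrite addr0 subrr normr0 mul0r. Qed.

Lemma shiftregN d : shiftreg d -> shiftreg (- d).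
Proof.
move=> H L L0; have [C C0 HC] := H L L0; exists C => // n n0 z u uz x w.
by have := HC n n0 z u uz x (w - d); rewrite subrK distrC.
Qed.

Lemma shiftregD d d' : shiftreg d -> shiftreg d' -> shiftreg (d + d').
Proof.
move=> H H' L L0; have [C C0 HC] := H L L0; have [C' C'0 HC'] := H' L L0.
exists (C + C'); first exact: addr_ge0.
move=> n n0 z u uz x w; rewrite mulrDl.
have h := HC n n0 z u uz x w; have h' := HC' n n0 z u uz x (w + d).
rewrite addrA; set a := Q n u x _ in h h' *; set b := Q n u x _ in h' *; set c := Q n u x w in h *.
have -> : b - c = (a - c) + (b - a) by ring.
by apply: le_trans (ler_normD _ _) _; apply: lerD.
Qed.

Lemma shiftreg_block (p : nat) (q d : R) : (0 < p)%N -> 0 < q <= 1 / 2 -> 0 < d ->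
  (forall x, exists x' s, forall F, (forall x w, 0 <= F x w) -> forall w,
     q * (F x' (w + s) + F x' (w + s + d)) <= Q p F x w) -> shiftreg d.
Proof.
move=> p0 q01 d0 Hp L L0; have /andP[q0 q1] := q01.
have Ld : 0 <= L / d by rewrite divr_ge0 // ltW.
have C0 : 0 <= 2 * (L / d + 1) by lra.
have p0' : 0 < p%:R :> R by rewrite ltr0n.
exists (2 * (L / d + 1) * p%:R / q); first by rewrite divr_ge0 ?mulr_ge0 ?ler0n ?(ltW q0) //; lra.
move=> n n0 z u uz x w.
have B := block_smoothing q01 C0 Hp (fun j x w => avg_diff_bound j x w d0 L0 uz) (n %/ p) 0.
rewrite distrC -(walk_shift P f n u d) -walkBf.
rewrite {1}(divn_eq n p) addnC walkD.
apply: (@le_trans _ _ (2 * (L / d + 1) / (1 + q * (n %/ p)%:R))).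
  by apply: (walk_bound f Pst) => x' w'; exact: B.
have n0' : 0 < n%:R :> R by rewrite ltr0n.
have D0 : 0 < 1 + q * (n %/ p)%:R by rewrite ltr_pwDl // mulr_ge0 // ltW.
rewrite -!mulrA ler_wpM2l // ler_wpM2l //; first by lra.
rewrite -(invrK p%:R) -!invfM lef_pV2 ?posrE ?mulr_gt0 ?invr_gt0 //.
rewrite [leLHS]mulrC ler_pdivrMr //.
have : n%:R <= ((n %/ p).+1 * p)%:R :> R by rewrite ler_nat ltnW // ltn_ceil.
rewrite natrM -natr1 => h.
apply: (@le_trans _ _ (q * ((n %/ p)%:R + 1) * p%:R)).
  by rewrite -mulrA ler_wpM2l // ltW.
rewrite ler_wpM2r // ?(ltW p0') //; lra.
Qed.

End Smoothing.

(** * Small regular shifts, concentration and equicontinuity at the scale of the square root of n *)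

Section Regularity.
Variables (R : realType) (T : finType) (P : T -> T -> R) (f : T -> R).
Hypothesis Pst : stochastic P.
Hypothesis HH1 : H1 P.
Hypothesis HH3 : H3 P f.
Local Notation Q := (walk P f false).
Local Notation reach := (reach P f).
Local Notation shiftreg := (shiftreg P f).

(** Going to [x0] in [k0] steps and then round one loop or the other yields, from any state, the two
    endpoints that [shiftreg_block] asks for. *)
Lemma shiftreg_loop n x0 s1 s2 : (0 < n)%N ->
  reach n x0 x0 s1 -> reach n x0 x0 s2 -> shiftreg (s2 - s1).
Proof.
move=> n0; wlog : s1 s2 / s1 < s2 => [H r1 r2|s12 r1 r2].
  case: (ltgtP s1 s2) => h; first exact: H.
    by rewrite -opprB; apply: shiftregN; apply: H.
  by rewrite h subrr; exact: shiftreg0.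
have [k0 k0p Hk] := H1_reach f Pst HH1.
have Hx x : exists q : R, 0 < q /\ exists s, forall F, (forall x w, 0 <= F x w) -> forall w,
    q * (F x0 (w + s) + F x0 (w + s + (s2 - s1))) <= Q (k0 + n) F x w.
  have [t Ht] := Hk x x0.
  have [q1 q10 Hq1] := reach_walk Pst (reach_cat Ht r1).
  have [q2 q20 Hq2] := reach_walk Pst (reach_cat Ht r2).
  exists (Num.min q1 q2 / 2); split; first by rewrite divr_gt0 // lt_min q10.
  exists (t + s1) => F F0 w.
  have h1 := Hq1 F F0 w; have h2 := Hq2 F F0 w.
  have -> : w + (t + s1) + (s2 - s1) = w + (t + s2) by ring.
  have F1 := F0 x0 (w + (t + s1)); have F2 := F0 x0 (w + (t + s2)).
  have m1 : Num.min q1 q2 * F x0 (w + (t + s1)) <= q1 * F x0 (w + (t + s1)).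
    by rewrite ler_wpM2r // ge_min lexx.
  have m2 : Num.min q1 q2 * F x0 (w + (t + s2)) <= q2 * F x0 (w + (t + s2)).
    by rewrite ler_wpM2r // ge_min lexx orbT.
  lra.
have [q Hq] := choice Hx.
have [d d0 Hd] := fin_pos_lb (fun x => (Hq x).1).
apply: (@shiftreg_block _ _ _ _ Pst (k0 + n) (Num.min d (1 / 2))).
- by rewrite addn_gt0 k0p.
- by rewrite lt_min d0 ge_min lexx orbT andbT; lra.
- by rewrite subr_gt0.
move=> x; have [qx [s Hs]] := Hq x; exists x0, s => F F0 w.
apply: le_trans (Hs F F0 w); rewrite ler_wpM2r ?addr_ge0 //.
by rewrite ge_min Hd.
Qed.

Lemma reach_iter n x s m : reach n x x s -> reach (m * n) x x (m%:R * s).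
Proof.
move=> H; elim: m => [|m IH]; first by rewrite mul0n mul0r; exact: reach0.
have -> : m.+1%:R * s = s + m%:R * s by rewrite -natr1; ring.
by rewrite mulSn; exact: (reach_cat H IH).
Qed.

(* A cycle of length m is compared, at equal total length, with m detours
   around loops of lengths k0 and k0 + 1, whose difference defines theta. *)
Lemma shiftreg_not_lattice (c : R) : ~ (forall d, shiftreg d -> exists k : int, d = c * k%:~R).
Proof.
move=> Hc.
have [x0 _] := HH3 0 0.
have [k0 k0p Hk] := H1_reach f Pst HH1.
have [s0 r0] := Hk x0 x0.
have [x1 Px1] : exists x1, 0 < P x0 x1.
  apply/not_existsP => N.
  have : \sum_x1 P x0 x1 <= 0 by apply: sumr_le0 => x1 _; rewrite leNgt; apply/negP; apply: N.
  by case: Pst => _ ->; rewrite ler10.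
have [t1 rt1] := Hk x1 x0.
have r1 := reachS Px1 rt1; set s1 := _ + _ in r1.
have [y [xs [Hcy Hn]]] := HH3 (s1 - s0) c; apply: Hn.
have ry := cycle_reach f Pst Hcy; set m := (size xs).+1 in ry *.
set t := _ + _ in ry.
have [a ra] := Hk x0 y; have [b rb] := Hk y x0.
have l1 := reach_cat (reach_cat ra (reach_cat ry rb)) (reach_iter m r0).
have l2 := reach_cat (reach_cat ra rb) (reach_iter m r1).
have E : (k0 + (m + k0) + m * k0 = k0 + k0 + m * k0.+1)%N by lia.
rewrite E in l1.
have len : (0 < k0 + k0 + m * k0.+1)%N by rewrite !addn_gt0 k0p.
have [k Hkk] := Hc _ (shiftreg_loop len l2 l1).
have -> : \sum_(x <- y :: xs) f x = t by rewrite big_cons addrC.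
by exists k; rewrite -Hkk; ring.
Qed.

Lemma shiftregMn d n : shiftreg d -> shiftreg (n%:R * d).
Proof.
move=> Hd; elim: n => [|n IH]; first by rewrite mul0r; exact: shiftreg0.
by rewrite -natr1 mulrDl mul1r; exact: shiftregD.
Qed.

Lemma shiftregMz d (k : int) : shiftreg d -> shiftreg (k%:~R * d).
Proof.
move=> Hd; case: k => n; first exact: shiftregMn.
by rewrite NegzE mulrNz mulNr; apply: shiftregN; apply: shiftregMn.
Qed.

(** A subgroup of the reals without small positive elements is trivial or generated by its least
    positive element; [shiftreg_not_lattice] excludes both. *)
Lemma shiftreg_small (e : R) : 0 < e -> exists d, 0 < d < e /\ shiftreg d.
Proof.
move=> e0; apply: contrapT => N.
have sep d : shiftreg d -> 0 < d -> e <= d.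
  by move=> Hd d0; rewrite leNgt; apply/negP => de; apply: N; exists d; rewrite d0 de.
case: (pselect (exists d, shiftreg d /\ 0 < d)) => [[d0 [Hd0 d0p]]|N2]; last first.
  apply: (@shiftreg_not_lattice 0) => d Hd; exists 0; rewrite mulr0.
  case: (ltgtP d 0) => // h; exfalso; apply: N2.
    by exists (- d); split; [exact: shiftregN|rewrite oppr_gt0].
  by exists d.
pose S := [set d | shiftreg d /\ 0 < d]%classic.
have hS : has_inf S.
  by split; [exists d0|exists 0 => d [_ /ltW]].
pose c := inf S.
have c_le d : S d -> c <= d by move=> Sd; apply: inf_lbound => //; case: hS.
have cS : S c.
  (* The infimum is attained: otherwise two distinct elements between [c] and [c + e] would differ
     by a positive element smaller than [e]. *)
  have [d1 Sd1 d1c] := inf_adherent e0 hS.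
  have [<-//|ne] := eqVneq d1 c.
  have lt1 : c < d1 by rewrite lt_neqAle eq_sym ne c_le.
  have [d2 Sd2 d2c] := inf_adherent (ltac:(by rewrite subr_gt0) : 0 < d1 - c) hS.
  have d21 : d2 < d1 by move: d2c; rewrite -/c; lra.
  have := sep _ (shiftregD Sd1.1 (shiftregN Sd2.1)) ltac:(by rewrite subr_gt0).
  by have := c_le _ Sd2; move: d1c; rewrite -/c; lra.
have [Hcr c0] := cS.
apply: (@shiftreg_not_lattice c) => d Hd.
pose k := Num.floor (d / c); exists k.
have /andP[k1 k2] := Num.Theory.floor_itv (d / c).
have h1 : 0 <= d - k%:~R * c by rewrite subr_ge0 -ler_pdivlMr.
have h2 : d - k%:~R * c < c.
  by rewrite ltrBlDl -{2}(mul1r c) -mulrDl -ltr_pdivrMr //; move: k2; rewrite intrD.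
have [z|nz] := eqVneq (d - k%:~R * c) 0.
  by move/eqP: z; rewrite subr_eq0 => /eqP; rewrite mulrC.
have : S (d - k%:~R * c).
  split; last by rewrite lt_neqAle eq_sym nz.
  by apply: shiftregD => //; apply: shiftregN; apply: shiftregMz.
by move/c_le; rewrite leNgt h2.
Qed.

Lemma shift_mult d L C : (forall n, (0 < n)%N -> forall z u, inwin z L u -> forall x w,
    `|Q n u x (w + d) - Q n u x w| <= C / n%:R) ->
  forall k n, (0 < n)%N -> forall z u, inwin z L u -> forall x w,
    `|Q n u x (w + k%:R * d) - Q n u x w| <= k%:R * (C / n%:R).
Proof.
move=> H k n n0 z u uz x w; elim: k => [|k IH]; first by rewrite mul0r addr0 subrr normr0 mul0r.
have h := H n n0 z u uz x (w + k%:R * d).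
rewrite -natr1 !mulrDl !mul1r addrA.
set A := Q n u x _ in IH h *; set B := Q n u x _ in h *; set D := Q n u x w in IH *.
have -> : B - D = (A - D) + (B - A) by ring.
by apply: le_trans (ler_normD _ _) _; apply: lerD.
Qed.

Definition box (z L : R) : T -> R -> R := fun _ w => ind (z <= w <= z + L).

Lemma box_inwin z L : inwin z L (box z L).
Proof. by move=> x w; rewrite ger0_norm // ind_ge0. Qed.

Lemma box_ge0 z L x w : 0 <= box z L x w.
Proof. by rewrite /box /ind ler0n. Qed.

Lemma sqrt_nat_gt0 n : (0 < n)%N -> 0 < Num.sqrt (n%:R : R).
Proof. by move=> n0; rewrite sqrtr_gt0 ltr0n. Qed.

Lemma sqr_sqrt_nat n : Num.sqrt (n%:R : R) * Num.sqrt n%:R = n%:R.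
Proof. by rewrite -expr2 sqr_sqrtr // ler0n. Qed.

Lemma nat_between (s : R) : 1 <= s -> exists k : nat, [/\ (0 < k)%N, s <= k%:R & k%:R <= 2 * s].
Proof.
move=> s1; exists (Num.truncn s).+1.
have /andP[h1 h2] := Num.Theory.truncn_itv (ltac:(lra) : 0 <= s).
by split=> //; [exact: ltW|rewrite -natr1; lra].
Qed.

(** Average over about [sqrt n] translates by [d]: their indicators sum to at most a constant, and
    moving from one to another changes the probability by at most [sqrt n] times a multiple of
    [1/n]. *)
Lemma concentration1 : exists2 C : R, 0 < C & forall n, (0 < n)%N -> forall z x w,
  Q n (box z 1) x w <= C / Num.sqrt n%:R.
Proof.
have [d [/andP[d0 d1] Hd]] := shiftreg_small ltr01.
have [C C0 HC] := Hd 1 ler01.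
have id0 : 0 < d^-1 by rewrite invr_gt0.
exists (d^-1 + 1 + 2 * C); first by lra.
move=> n n0 z x w.
have s0 := sqrt_nat_gt0 n0; set s := Num.sqrt _ in s0 *.
have s1 : 1 <= s by rewrite -sqrtr1 ler_sqrt ?ler1n.
have [K [K0 K1 K2]] := nat_between s1.
have K0' : 0 < K%:R :> R by rewrite ltr0n.
have hs k : Q n (box z 1) x w <= Q n (box z 1) x (w + k%:R * d) + k%:R * (C / n%:R).
  have := shift_mult HC k n0 (@box_inwin z 1) x w.
  by rewrite ler_norml => /andP[h _]; lra.
have tot : \sum_(k < K) Q n (box z 1) x (w + k%:R * d) <= d^-1 + 1.
  under eq_bigr do rewrite -walk_shift.
  rewrite -walk_sum; apply: (walk_le_cst f Pst) => x' w'.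
  by have := @count_grid_le R K d w' z 1 d0 ler01; rewrite div1r.
have : K%:R * Q n (box z 1) x w <= d^-1 + 1 + K%:R * (K%:R * (C / n%:R)).
  apply: (@le_trans _ _ (\sum_(k < K) (Q n (box z 1) x (w + k%:R * d) + K%:R * (C / n%:R)))); last first.
    by rewrite big_split /= sumr_const card_ord -[X in _ + X]mulr_natl lerD2r.
  rewrite mulr_natl -[K in _ *+ K]card_ord -sumr_const; apply: ler_sum => k _.
  apply: le_trans (hs k) _; rewrite lerD2l ler_wpM2r ?divr_ge0 // ler_nat ltnW //.
rewrite -ler_pdivlMl // => h; apply: le_trans h _.
have nE : n%:R = s * s by rewrite /s sqr_sqrt_nat.
rewrite mulrDr mulKf ?gt_eqF // [leRHS]mulrDl; apply: lerD.
  by rewrite mulrC ler_wpM2l ?lef_pV2 ?posrE //; lra.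
rewrite nE invfM !mulrA ler_wpM2r ?invr_ge0 ?(ltW s0) //.
rewrite ler_pdivrMr // mulrAC [leRHS]mulrC mulrA.
by rewrite [leLHS]mulrC -mulrA ler_wpM2l.
Qed.

Lemma concentration : exists2 C : R, 0 < C & forall n, (0 < n)%N -> forall z L x w, 0 <= L ->
  Q n (box z L) x w <= C * (1 + L) / Num.sqrt n%:R.
Proof.
have [C C0 HC] := concentration1; exists C => // n n0 z L x w L0.
have /andP[h1 h2] := Num.Theory.truncn_itv L0.
set K := Num.truncn L in h1 h2.
apply: (@le_trans _ _ (\sum_(k < K.+1) Q n (box (z + k%:R) 1) x w)).
  rewrite -walk_sum; apply: walk_le => // x' w'.
  rewrite {1}/box {1}/ind; case: (boolP (z <= w' <= z + L)) => [/andP[a b]|_] /=; last first.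
    by apply: sumr_ge0 => k _; exact: box_ge0.
  have /andP[c1 c2] := Num.Theory.truncn_itv (ltac:(lra) : 0 <= w' - z).
  have lt : (Num.truncn (w' - z) < K.+1)%N.
    rewrite ltnS -(ler_nat R); have : (Num.truncn (w' - z))%:R < K.+1%:R :> R by lra.
    by rewrite ltr_nat ltnS ler_nat.
  rewrite (bigD1 (Ordinal lt)) //= -[leLHS]addr0; apply: lerD; last first.
    by apply: sumr_ge0 => k _; exact: box_ge0.
  rewrite /box /ind; rewrite -natr1 in c2.
  by have -> : z + (Num.truncn (w' - z))%:R <= w' <= z + (Num.truncn (w' - z))%:R + 1 by apply/andP; split; lra.
apply: (@le_trans _ _ (\sum_(k < K.+1) C / Num.sqrt n%:R)); first by apply: ler_sum => k _; exact: HC.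
rewrite sumr_const card_ord -[leLHS]mulr_natl mulrCA -mulrA ler_wpM2l // ?(ltW C0) //.
by rewrite ler_wpM2r ?invr_ge0 ?sqrtr_ge0 // -natr1; lra.
Qed.

(** [M] translates, at spacing [d < 1 / M], of a box of length [d / 2] overlap boundedly and stay
    inside one window of length 2. They share a mass [O(1 / sqrt n)], so each receives about a
    fraction [1 / M] of it. *)
Lemma small_box (eta : R) : 0 < eta -> exists2 rho : R, 0 < rho & exists N, forall n, (N <= n)%N ->
  forall z x w, Q n (box z rho) x w <= eta / Num.sqrt n%:R.
Proof.
move=> eta0; have [C C0 HC] := concentration.
pose M := (Num.truncn (12 * C / eta)).+1.
have M0 : 0 < M%:R :> R by rewrite ltr0n.
have HM : 6 * C / M%:R <= eta / 2.
  have := Num.Theory.truncnS_gt (12 * C / eta); rewrite -/M ltr_pdivrMr // => h.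
  by rewrite ler_pdivrMr //; lra.
have iM : 0 < M%:R^-1 :> R by rewrite invr_gt0.
have [d [/andP[d0 d1] Hd]] := shiftreg_small iM.
have Md : M%:R * d <= 1 by rewrite mulrC -ler_pdivlMr // mul1r ltW.
have [D D0 HD] := Hd (d / 2) ltac:(lra).
exists (d / 2); first by lra.
pose N := (Num.truncn ((2 * M%:R * D / eta) ^+ 2)).+1.
exists N => n nN z x w.
have n0 : (0 < n)%N by exact: leq_trans nN.
have s0 := sqrt_nat_gt0 n0; set s := Num.sqrt _ in s0 *.
have sN : 2 * M%:R * D / eta <= s.
  rewrite /s -[leLHS]ger0_norm ?divr_ge0 ?mulr_ge0 ?(ltW eta0) ?(ltW M0) // -sqrtr_sqr ler_sqrt ?ler0n //.
  apply: ltW; apply: lt_le_trans (Num.Theory.truncnS_gt _) _.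
  by rewrite ler_nat.
have hs k : Q n (box z (d / 2)) x w <= Q n (box z (d / 2)) x (w + k%:R * d) + k%:R * (D / n%:R).
  have := shift_mult HD k n0 (@box_inwin z (d / 2)) x w.
  by rewrite ler_norml => /andP[h _]; lra.
have tot : \sum_(k < M) Q n (box z (d / 2)) x (w + k%:R * d) <= 6 * C / s.
  under eq_bigr do rewrite -walk_shift.
  rewrite -walk_sum.
  have -> : 6 * C / s = 2 * (C * (1 + 2) / s) by ring.
  apply: (@le_trans _ _ (2 * Q n (box (z - 1) 2) x w)); last by rewrite ler_wpM2l // HC.
  rewrite -walkZ; apply: walk_le => // x' w'.
  case: (boolP (z - 1 <= w' <= z - 1 + 2)) => [h|/negP h].
    rewrite {2}/box h /ind mulr1.
    have := @count_grid_le R M d w' z (d / 2) d0 ltac:(lra).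
    rewrite mulrAC divff ?gt_eqF // mul1r => h'; apply: le_trans h' _; lra.
  rewrite big1 ?mulr_ge0 ?box_ge0 // => k _; rewrite /box.
  case: (boolP (_ <= _ <= _)) => // /andP[h1 h2]; exfalso; apply: h.
  have h3 : k%:R * d <= 1.
    by apply: le_trans Md; rewrite ler_wpM2r ?(ltW d0) // ler_nat ltnW.
  have h4 : 0 <= k%:R * d by rewrite mulr_ge0 // ltW.
  have h5 : d <= 1.
    apply: le_trans Md; rewrite -[leLHS]mul1r ler_wpM2r ?(ltW d0) // ler1n //.
  by apply/andP; split; lra.
have : M%:R * Q n (box z (d / 2)) x w <= 6 * C / s + M%:R * (M%:R * (D / n%:R)).
  apply: (@le_trans _ _ (\sum_(k < M) (Q n (box z (d / 2)) x (w + k%:R * d) + M%:R * (D / n%:R)))); last first.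
    by rewrite big_split /= sumr_const card_ord -[X in _ + X]mulr_natl lerD2r.
  rewrite mulr_natl -[M in _ *+ M]card_ord -sumr_const; apply: ler_sum => k _.
  apply: le_trans (hs k) _; rewrite lerD2l ler_wpM2r ?divr_ge0 // ler_nat ltnW //.
rewrite -ler_pdivlMl // => h; apply: le_trans h _.
have nE : n%:R = s * s by rewrite /s sqr_sqrt_nat.
rewrite mulrDr mulKf ?gt_eqF // nE.
have -> : M%:R^-1 * (6 * C / s) = (6 * C / M%:R) / s by ring.
have -> : M%:R * (D / (s * s)) = (M%:R * D / s) / s by rewrite invfM; ring.
rewrite -mulrDl ler_wpM2r ?invr_ge0 ?(ltW s0) //.
have : M%:R * D / s <= eta / 2.
  rewrite ler_pdivrMr //; move: sN; rewrite ler_pdivrMr //; lra.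
lra.
Qed.

(** Half open, so that translates by multiples of [a] tile the line exactly. *)
Definition hwin (psi : T -> R) z a : T -> R -> R :=
  fun x w => if z <= w < z + a then psi x else 0.

(** Write the shift as [k d + e] with [0 <= e < d]. The multiple of [d] costs [k C / n], small when
    [k] is a small multiple of [sqrt n]; the rest [e] only matters near the two ends of the window,
    where [small_box] applies. *)
Lemma shift_regular (a eta : R) : 0 < a -> 0 < eta ->
  exists2 kap : R, 0 < kap & exists N, forall n, (N <= n)%N ->
  forall psi z x w s, (forall x, `|psi x| <= 1) -> `|s| <= kap * Num.sqrt n%:R ->
  `|Q n (hwin psi z a) x (w + s) - Q n (hwin psi z a) x w| <= eta / Num.sqrt n%:R.
Proof.
move=> a0 eta0.
have [rho rho0 [N0 HN0]] := small_box (ltac:(lra) : 0 < eta / 4).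
have [d [/andP[d0 d1] Hd]] := shiftreg_small rho0.
have [C C0 HC] := Hd a (ltW a0).
exists (eta * d / (4 * (C + 1))); first by rewrite divr_gt0 ?mulr_gt0 //; lra.
pose N1 := (Num.truncn ((4 * C / eta) ^+ 2)).+1.
exists (maxn N0 N1) => n; rewrite geq_max => /andP[nN0 nN1] psi z.
have n0 : (0 < n)%N by exact: leq_trans nN1.
have s0 := sqrt_nat_gt0 n0; set sn := Num.sqrt _ in s0 *.
suff main x w s : (forall x, `|psi x| <= 1) -> 0 <= s <= eta * d / (4 * (C + 1)) * sn ->
    `|Q n (hwin psi z a) x (w + s) - Q n (hwin psi z a) x w| <= eta / sn.
  move=> x w s Hpsi hs; case: (lerP 0 s) => hs0.
    by apply: main => //; rewrite hs0 /= (le_trans _ hs) // ler_norm.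
  have := main x (w + s) (- s) Hpsi; rewrite addrK distrC; apply.
  by rewrite oppr_ge0 (ltW hs0) /= (le_trans _ hs) // -normrN ler_norm.
move=> Hpsi /andP[hs0 hs].
have uz : inwin z a (hwin psi z a).
  move=> x' w'; rewrite /hwin /ind; case: (boolP (z <= w' < z + a)) => [/andP[h1 h2]|_].
    by rewrite h1 (ltW h2) /=.
  by rewrite normr0 ler0n.
have /andP[k1 k2] := Num.Theory.truncn_itv (ltac:(by rewrite divr_ge0 // ltW) : 0 <= s / d).
set k := Num.truncn _ in k1 k2.
pose e := s - k%:R * d.
have e0 : 0 <= e by rewrite subr_ge0 -ler_pdivlMr.
have e1 : e < d by move: k2; rewrite ltr_pdivrMr // -natr1 /e; lra.
have step1 := shift_mult HC k n0 uz x (w + e).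
have step2 : `|Q n (hwin psi z a) x (w + e) - Q n (hwin psi z a) x w| <= eta / 2 / sn.
  rewrite -walk_shift -walkBf.
  have -> : eta / 2 / sn = eta / 4 / sn + eta / 4 / sn by field; rewrite gt_eqF.
  apply: (@le_trans _ _ (Q n (fun x w => box (z - rho) rho x w + box (z + a - rho) rho x w) x w)); last first.
    by rewrite walkDf; apply: lerD; apply: HN0.
  apply: (walk_norm_le f Pst) => x' w'; rewrite /hwin /box /ind subrK.
  have p1 := Hpsi x'; have p0 := normr_ge0 (psi x').
  case: (boolP (z <= w' + e < z + a)) => [/andP[h1 h2]|/nandP H1'];
  case: (boolP (z <= w' < z + a)) => [/andP[h3 h4]|/nandP H2'].
  - by rewrite subrr normr0 addr_ge0 // ler0n.
  - rewrite subr0 (le_trans p1) //.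
    case: H2' => h; rewrite -ltNge in h || rewrite -leNgt in h.
      have -> : z - rho <= w' <= z by apply/andP; split; lra.
      by rewrite lerDl ler0n.
    by exfalso; move: h h2; lra.
  - rewrite sub0r normrN (le_trans p1) //.
    case: H1' => h; rewrite -ltNge in h || rewrite -leNgt in h.
      by exfalso; move: h h3; lra.
    have -> : z + a - rho <= w' <= z + a - rho + rho by apply/andP; split; lra.
    by rewrite lerDr ler0n.
  - by rewrite subrr normr0 addr_ge0 // ler0n.
have ws : w + e + k%:R * d = w + s by rewrite /e; ring.
rewrite ws in step1.
have nE : n%:R = sn * sn by rewrite /sn sqr_sqrt_nat.
have b1 : k%:R * (C / n%:R) <= eta / 2 / sn.
  rewrite nE invfM !mulrA ler_wpM2r ?invr_ge0 ?(ltW s0) // ler_pdivrMr //.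
  have kC : k%:R * C <= s / d * (C + 1).
    by apply: ler_pM; rewrite ?ler0n //; lra.
  apply: le_trans kC _.
  have : s / d * (C + 1) <= eta / 4 * sn; last first.
    have : 0 <= eta * sn by rewrite mulr_ge0 // ltW.
    lra.
  rewrite mulrAC ler_pdivrMr //.
  have C1 : 0 < C + 1 by lra.
  have E : eta * d / (4 * (C + 1)) * sn * (C + 1) = eta / 4 * sn * d by field; rewrite gt_eqF.
  by rewrite -E ler_wpM2r // ltW.
set A := Q n _ x (w + s) in step1 *; set B := Q n _ x (w + e) in step1 step2; set D := Q n _ x w in step2 *.
have -> : A - D = (A - B) + (B - D) by ring.
apply: le_trans (ler_normD _ _) _.
have -> : eta / sn = eta / 2 / sn + eta / 2 / sn by field; rewrite gt_eqF.
by apply: lerD => //; apply: le_trans step1 b1.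
Qed.

End Regularity.

(** * Heat functions and the Lindeberg step *)

Section Calculus.
Variable R : realType.
Implicit Types (g : R -> R) (x a b : R).

(* Opaque to type-class inference, which would otherwise pick the derivative. *)
Definition drv g x a : Prop := is_derive x 1 g a.

Lemma drv_eq g x a b : drv g x a -> a = b -> drv g x b.
Proof. by move=> h <-. Qed.

Lemma drv_cst x (c : R) : drv (fun=> c) x 0.
Proof. exact: is_derive_cst. Qed.

Lemma drv_id x : drv (fun y : R => y) x 1.
Proof. exact: is_derive_id. Qed.

Lemma drv_add x g1 g2 a b : drv g1 x a -> drv g2 x b -> drv (fun y => g1 y + g2 y) x (a + b).
Proof. exact: is_deriveD. Qed.

Lemma drv_opp x g a : drv g x a -> drv (fun y => - g y) x (- a).
Proof. exact: is_deriveN. Qed.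

Lemma drv_mul x g1 g2 a b : drv g1 x a -> drv g2 x b ->
  drv (fun y => g1 y * g2 y) x (a * g2 x + g1 x * b).
Proof.
move=> h1 h2; apply: (drv_eq (is_deriveM h1 h2)).
by rewrite /GRing.scale /=; ring.
Qed.

Lemma drv_comp x g1 g2 a b : drv g1 (g2 x) a -> drv g2 x b -> drv (fun y => g1 (g2 y)) x (a * b).
Proof. exact: is_derive1_comp. Qed.

Lemma drv_exp x g b : drv g x b -> drv (fun y => expR (g y)) x (expR (g x) * b).
Proof. by apply: drv_comp; exact: is_derive_expR. Qed.

Lemma drv_inv x g b : g x != 0 -> drv g x b -> drv (fun y => (g y)^-1) x (- (g x)^-1 ^+ 2 * b).
Proof. by move=> h1 h2; apply: (drv_eq (is_deriveV h1 h2)); rewrite exprVn. Qed.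

Lemma drv_sqrt x : 0 < x -> drv Num.sqrt x (2 * Num.sqrt x)^-1.
Proof. exact: is_derive1_sqrt. Qed.

Lemma drv_pow x g (n : nat) b : drv g x b -> drv (fun y => g y ^+ n) x (n%:R * g x ^+ n.-1 * b).
Proof.
move=> h; elim: n => [|n IH].
  by rewrite !mul0r; exact: drv_cst.
under eq_fun do rewrite exprS.
apply: (drv_eq (drv_mul h IH)); case: n {IH} => [|n] /=; first by rewrite !expr0; ring.
by rewrite -[n.+2%:R]natr1 exprS; ring.
Qed.

Lemma mean_value_le g g' a b (M : R) : a <= b ->
  (forall c, a <= c <= b -> drv g c (g' c)) ->
  (forall c, a <= c <= b -> `|g' c| <= M) -> `|g b - g a| <= M * (b - a).
Proof.
move=> ab Hd HM.
have [c cab ->] : exists2 c, c \in `[a, b]%R & g b - g a = g' c * (b - a).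
  apply: MVT_segment => //.
    by move=> x; rewrite in_itv /= => /andP[h1 h2]; apply: Hd; rewrite !ltW.
  apply: derivable_within_continuous => x; rewrite in_itv /= => h.
  by have [] := Hd x h.
rewrite normrM (ger0_norm (ltac:(by rewrite subr_ge0) : 0 <= b - a)).
by rewrite ler_wpM2r ?subr_ge0 //; apply: HM; move: cab; rewrite in_itv.
Qed.

Lemma mean_value_dist g g' (h xi M : R) :
  (forall c : R, drv g c (g' c)) ->
  (forall c, `|c - h| <= `|xi| -> `|g' c| <= M) -> `|g (h + xi) - g h| <= M * `|xi|.
Proof.
move=> Hd HM; case: (lerP 0 xi) => h0.
  rewrite ger0_norm // in HM *.
  have := @mean_value_le g g' h (h + xi) M; rewrite addrAC subrr add0r; apply => //; first lra.
  by move=> c /andP[h1 h2]; apply: HM; rewrite ler_norml; lra.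
rewrite ltr0_norm // in HM *.
have := @mean_value_le g g' (h + xi) h M; rewrite distrC (_ : h - (h + xi) = - xi); last by ring.
apply => //; first lra.
by move=> c /andP[h1 h2]; apply: HM; rewrite ler_norml; lra.
Qed.

Lemma taylor2 g0 g1 g2 (h xi M : R) :
  (forall c : R, drv g0 c (g1 c)) -> (forall c : R, drv g1 c (g2 c)) ->
  (forall c, `|g2 c| <= M) -> `|g0 (h + xi) - g0 h - xi * g1 h| <= M * xi ^+ 2.
Proof.
move=> d0 d1 HM.
have := @mean_value_dist (fun s => g0 s + - (s * g1 h)) (fun s => g1 s - g1 h) h xi (M * `|xi|).
have -> : g0 (h + xi) + - ((h + xi) * g1 h) - (g0 h + - (h * g1 h)) = g0 (h + xi) - g0 h - xi * g1 h by ring.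
rewrite -mulrA -expr2 real_normK ?num_real //; apply.
  move=> c; apply: drv_add => //; apply: drv_opp.
  by apply: (drv_eq (drv_mul (drv_id c) (drv_cst c _))); ring.
move=> c hc; have := @mean_value_dist g1 g2 h (c - h) M d1 (fun c _ => HM c).
rewrite (addrC h) subrK => H; apply: le_trans H _.
by rewrite ler_wpM2l // (le_trans _ (HM c)).
Qed.

Lemma taylor3 g0 g1 g2 g3 (h xi M : R) :
  (forall c : R, drv g0 c (g1 c)) -> (forall c : R, drv g1 c (g2 c)) ->
  (forall c : R, drv g2 c (g3 c)) -> (forall c, `|g3 c| <= M) ->
  `|g0 (h + xi) - g0 h - xi * g1 h - xi ^+ 2 / 2 * g2 h| <= M * `|xi| ^+ 3.
Proof.
move=> d0 d1 d2 HM.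
have := @mean_value_dist (fun s => g0 s + - (s * g1 h + (s + - h) ^+ 2 * (g2 h / 2)))
  (fun s => g1 s - g1 h - (s - h) * g2 h) h xi (M * xi ^+ 2).
have -> : g0 (h + xi) + - ((h + xi) * g1 h + (h + xi + - h) ^+ 2 * (g2 h / 2)) -
   (g0 h + - (h * g1 h + (h + - h) ^+ 2 * (g2 h / 2))) =
   g0 (h + xi) - g0 h - xi * g1 h - xi ^+ 2 / 2 * g2 h by ring.
have -> : M * xi ^+ 2 * `|xi| = M * `|xi| ^+ 3.
  by rewrite -mulrA -(real_normK (num_real xi)); congr (_ * _); ring.
apply.
  move=> c; apply: drv_eq.
    apply: drv_add; first exact: d0.
    apply: drv_opp; apply: drv_add.
      by apply: drv_mul; [exact: drv_id|exact: drv_cst].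
    apply: drv_mul; last exact: drv_cst.
    by apply: drv_pow; apply: drv_add; [exact: drv_id|apply: drv_opp; exact: drv_cst].
  by rewrite /=; field.
move=> c hc; have := taylor2 h (c - h) d1 d2 HM.
rewrite (addrC h) subrK => H; apply: le_trans H _.
rewrite ler_wpM2l //; first by rewrite (le_trans _ (HM c)).
by rewrite -[leLHS](real_normK (num_real _)) -[leRHS](real_normK (num_real _)) lerXn2r // nnegrE.
Qed.

Lemma taylor2_time g0 g1 g2 (t del M : R) : 0 <= del ->
  (forall c : R, t <= c <= t + del -> drv g0 c (g1 c)) ->
  (forall c : R, t <= c <= t + del -> drv g1 c (g2 c)) ->
  (forall c : R, t <= c <= t + del -> `|g2 c| <= M) ->
  `|g0 (t + del) - g0 t - del * g1 t| <= M * del ^+ 2.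
Proof.
move=> del0 d0 d1 HM.
have := @mean_value_le (fun s => g0 s + - (s * g1 t)) (fun s => g1 s - g1 t) t (t + del) (M * del).
have -> : g0 (t + del) + - ((t + del) * g1 t) - (g0 t + - (t * g1 t)) = g0 (t + del) - g0 t - del * g1 t by ring.
have -> : M * del * (t + del - t) = M * del ^+ 2 by ring.
apply; first lra.
  move=> c hc; apply: drv_add; first exact: d0; apply: drv_opp.
  by apply: (drv_eq (drv_mul (drv_id c) (drv_cst c _))); ring.
move=> c /andP[hc1 hc2]; have := @mean_value_le g1 g2 t c M hc1.
move=> H; apply: le_trans (H _ _) _.
- by move=> s /andP[? ?]; apply: d1; lra.
- by move=> s /andP[? ?]; apply: HM; lra.
rewrite ler_wpM2l //; last by lra.
by rewrite (le_trans _ (HM t _)) //; lra.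
Qed.

Local Notation sqrt := Num.sqrt.

(** The normal density of variance [t] times [sqrt (2 * pi)]; the missing factor comes back as
    [c0]. *)
Definition gauss (t w : R) : R := (sqrt t)^-1 * expR (- (w ^+ 2 / (2 * t))).

(** [i] stands for [1 / t]. These are the factors that [k] differentiations in [w] put in front of
    [gauss]; the last branch is meant for [k = 4]. *)
Definition hermite (k : nat) (i w : R) : R :=
  match k with
  | 0 => 1
  | 1 => - (w * i)
  | 2 => w ^+ 2 * i ^+ 2 - i
  | 3 => 3 * w * i ^+ 2 - w ^+ 3 * i ^+ 3
  | _ => w ^+ 4 * i ^+ 4 - 6 * w ^+ 2 * i ^+ 3 + 3 * i ^+ 2
  end.

Definition gaussd (k : nat) (t w : R) : R := hermite k t^-1 w * gauss t w.

Lemma gauss_dw (t w : R) : 0 < t -> drv (gauss t) w (- (w * t^-1) * gauss t w).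
Proof.
move=> t0; apply: drv_eq.
  apply: drv_mul; first exact: drv_cst.
  apply: drv_exp; apply: drv_opp; apply: drv_mul; last exact: drv_cst.
  by apply: drv_pow; exact: drv_id.
by rewrite /gauss /= expr1; field; rewrite !gt_eqF // sqrtr_gt0.
Qed.

Lemma gauss_dt (t w : R) : 0 < t ->
  drv (fun t => gauss t w) t ((w ^+ 2 * t^-1 ^+ 2 - t^-1) / 2 * gauss t w).
Proof.
move=> t0; have s0 : 0 < sqrt t by rewrite sqrtr_gt0.
apply: drv_eq.
  apply: drv_mul.
    by apply: drv_inv; [rewrite gt_eqF|exact: drv_sqrt].
  apply: drv_exp; apply: drv_opp; apply: drv_mul; first exact: drv_cst.
  apply: drv_inv; first by rewrite mulf_neq0 // gt_eqF.
  by apply: drv_mul; [exact: drv_cst|exact: drv_id].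
rewrite /gauss /=; set E := expR _.
have tE : t = sqrt t ^+ 2 by rewrite sqr_sqrtr // ltW.
move: s0 tE; set s := sqrt t => s0 ->; field; rewrite gt_eqF //.
Qed.

Lemma hermite_dw (k : nat) (i w : R) : (k < 4)%N ->
  exists2 p' : R, drv (hermite k i) w p' & p' - w * i * hermite k i w = hermite k.+1 i w.
Proof.
case: k => [|[|[|[|//]]]] _ /=; eexists.
- exact: drv_cst.
- by rewrite /=; ring.
- by apply: drv_opp; apply: drv_mul; [exact: drv_id|exact: drv_cst].
- by rewrite /=; ring.
- by apply: drv_add; [apply: drv_mul; [apply: drv_pow; exact: drv_id|exact: drv_cst]|exact: drv_cst].
- by rewrite /= expr1; ring.
- apply: drv_add.
    by apply: drv_mul; [apply: drv_mul; [exact: drv_cst|exact: drv_id]|exact: drv_cst].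
  by apply: drv_opp; apply: drv_mul; [apply: drv_pow; exact: drv_id|exact: drv_cst].
- by rewrite /=; ring.
Qed.

Lemma hermite_dt (k : nat) (t w : R) : 0 < t -> (k < 3)%N ->
  exists2 p' : R, drv (fun t => hermite k t^-1 w) t p' &
   p' + (w ^+ 2 * t^-1 ^+ 2 - t^-1) / 2 * hermite k t^-1 w = hermite k.+2 t^-1 w / 2.
Proof.
move=> t0 k3; have dinv : drv (fun t => t^-1) t (- t^-1 ^+ 2).
  apply: drv_eq; first by apply: (@drv_inv t id 1); rewrite ?gt_eqF //; exact: drv_id.
  by rewrite mulr1.
case: k k3 => [|[|[|//]]] _ /=; eexists.
- exact: drv_cst.
- by rewrite /=; ring.
- by apply: drv_opp; apply: drv_mul; [exact: drv_cst|exact: dinv].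
- by rewrite /=; field; rewrite gt_eqF.
- apply: drv_add; first by apply: drv_mul; [exact: drv_cst|apply: drv_pow; exact: dinv].
  by apply: drv_opp; exact: dinv.
- by rewrite /= expr1; field; rewrite gt_eqF.
Qed.

Lemma gaussd_dw (k : nat) (t w : R) : (k < 4)%N -> 0 < t -> drv (gaussd k t) w (gaussd k.+1 t w).
Proof.
move=> k4 t0; have [p' Hp E] := hermite_dw t^-1 w k4.
apply: drv_eq; first by apply: drv_mul; [exact: Hp|exact: gauss_dw].
by rewrite /gaussd -E; ring.
Qed.

Lemma gaussd_dt (k : nat) (t w : R) : (k < 3)%N -> 0 < t ->
  drv (fun t => gaussd k t w) t (gaussd k.+2 t w / 2).
Proof.
move=> k3 t0; have [p' Hp E] := hermite_dt w t0 k3.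
apply: drv_eq; first by apply: drv_mul; [exact: Hp|exact: gauss_dt].
rewrite /gaussd; transitivity ((hermite k.+2 t^-1 w / 2) * gauss t w); last by ring.
by rewrite -E; ring.
Qed.

Lemma expR_quad_bound (y : R) : 0 <= y -> (1 + y + y ^+ 2) * expR (- y) <= 8.
Proof.
move=> y0; rewrite expRN ler_pdivrMr ?expR_gt0 //.
have h : 1 + y / 2 <= expR (y / 2) by exact: expR_ge1Dx.
have -> : expR y = expR (y / 2) ^+ 2 by rewrite -expRM_natl; congr expR; field.
have : (1 + y / 2) ^+ 2 <= expR (y / 2) ^+ 2 by rewrite lerXn2r // nnegrE; lra.
nra.
Qed.

(** In the variable [v = w / sqrt t] the bound no longer involves [t]. The constant is 40, from
    comparing the Hermite polynomials with [1 + v^2/2 + (v^2/2)^2], times the 8 of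
    [expR_quad_bound]. *)
Lemma gaussd_bound : exists2 B : R, 0 < B & forall k (t w : R), (k <= 4)%N -> 0 < t ->
  `|gaussd k t w| <= B / sqrt t ^+ k.+1.
Proof.
exists 320 => [//|k t w k4 t0].
have s0 : 0 < sqrt t by rewrite sqrtr_gt0.
have tE : t = sqrt t ^+ 2 by rewrite sqr_sqrtr // ltW.
set s := sqrt t in s0 tE *.
pose v := w / s.
have wE : w = v * s by rewrite /v divfK // gt_eqF.
have E : gaussd k t w = hermite k 1 v * expR (- (v ^+ 2 / 2)) / s ^+ k.+1.
  rewrite /gaussd /gauss -/s.
  have -> : w ^+ 2 / (2 * t) = v ^+ 2 / 2 by rewrite wE tE; field; rewrite gt_eqF.
  rewrite wE tE; case: k k4 => [|[|[|[|[|//]]]]] _ /=; field; rewrite gt_eqF //.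
rewrite E normrM (ger0_norm (ltac:(by rewrite invr_ge0 exprn_ge0 // ltW) : 0 <= (s ^+ k.+1)^-1)).
rewrite ler_wpM2r ?invr_ge0 ?exprn_ge0 ?(ltW s0) //.
rewrite normrM (ger0_norm (expR_ge0 _)).
have H := expR_quad_bound (ltac:(by rewrite divr_ge0 // sqr_ge0) : 0 <= v ^+ 2 / 2).
have : `|hermite k 1 v| <= 40 * (1 + v ^+ 2 / 2 + (v ^+ 2 / 2) ^+ 2).
  have v2 := sqr_ge0 v.
  have v1 : `|v| <= 1 + v ^+ 2.
    have := sqr_ge0 (`|v| - 1); rewrite -(real_normK (num_real v)); have := normr_ge0 v; nra.
  have v4 : `|v| * v ^+ 2 <= v ^+ 2 + v ^+ 2 * v ^+ 2 by have := ler_wpM2l v2 v1; lra.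
  case: k k4 {E} => [|[|[|[|[|//]]]]] _ /=.
  - by rewrite normr1; nra.
  - by rewrite normrN normrM normr1; nra.
  - by rewrite ler_norml; apply/andP; split; nra.
  - have -> : 3 * v * 1 ^+ 2 - v ^+ 3 * 1 ^+ 3 = v * (3 - v ^+ 2) by ring.
    rewrite normrM; have : `|3 - v ^+ 2| <= 3 + v ^+ 2 by rewrite ler_norml; lra.
    have := normr_ge0 v; nra.
  - by rewrite ler_norml; apply/andP; split; nra.
set A := 1 + v ^+ 2 / 2 + _ in H *; move=> hA.
have e0 := expR_ge0 (- (v ^+ 2 / 2)).
apply: (@le_trans _ _ (40 * A * expR (- (v ^+ 2 / 2)))); first by rewrite ler_wpM2r.
by rewrite -mulrA; lra.
Qed.

Lemma gauss_le (t w : R) : 0 < t -> gauss t w <= (sqrt t)^-1.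
Proof.
move=> t0; rewrite /gauss -[leRHS]mulr1 ler_wpM2l ?invr_ge0 ?sqrtr_ge0 //.
by rewrite -expR0 ler_expR oppr_le0 divr_ge0 ?sqr_ge0 // mulr_ge0 // ltW.
Qed.

Lemma gauss_ge0 (t w : R) : 0 <= gauss t w.
Proof. by rewrite /gauss mulr_ge0 ?invr_ge0 ?sqrtr_ge0 ?expR_ge0. Qed.

End Calculus.

Section Heat.
Variable R : realType.
Local Notation sqrt := Num.sqrt.

Lemma erf_exists : exists e : R -> R, [/\ forall u, drv e u (expR (- (u ^+ 2 / 2))),
  e 0 = 0 &
  forall eta : R, 0 < eta -> exists K : R, forall u, K <= u -> `|e u - sqrt (2 * pi) / 2| <= eta].
Proof.
pose I (x : R) := \int[lebesgue_measure]_(t in `]-oo, x]) gauss_fun t.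
have intT (i : interval R) : lebesgue_measure.-integrable [set` i]%classic (EFin \o @gauss_fun R).
  by apply: (integrableS _ _ _ (@integrableT_gauss R)).
have dI x : drv I x (gauss_fun x).
  have [h1 h2] : derivable I x 1 /\ (I^`())%classic x = gauss_fun x.
    apply: (@continuous_FTC1 R gauss_fun -oo%O x (x + 1)) => //; [by rewrite ltrDl|by rewrite ltNyr|exact: continuous_gauss_fun].
  by apply: (DeriveDef h1); rewrite -derive1E h2.
have IJ x : 0 <= x -> I x - I 0 = gauss_integral_proof.integral0_gauss x.
  by move=> x0; rewrite /I Rintegral_itvB // Rintegral_itv_obnd_cbnd.
have s2 : 0 < sqrt 2 :> R by rewrite sqrtr_gt0.
have s22 : sqrt 2 * sqrt 2 = 2 :> R by rewrite -expr2 sqr_sqrtr.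
(* [gauss_fun] is [exp(- x^2)]; rescaling by [sqrt 2] gives the weight [exp(- u^2/2)]. *)
exists (fun u => sqrt 2 * (I (u / sqrt 2) - I 0)); split.
- move=> u; apply: drv_eq.
    apply: drv_mul; first exact: drv_cst.
    apply: drv_add; last exact: drv_cst.
    apply: drv_comp; first exact: dI.
    by apply: drv_mul; [exact: drv_id|exact: drv_cst].
  rewrite /= mul0r add0r addr0 mulr0 addr0 mul1r mulrCA divff ?gt_eqF // mulr1 /gauss_fun.
  by congr expR; rewrite exprMn exprVn (expr2 (sqrt 2)) s22.
- by rewrite mul0r subrr mulr0.
move=> eta eta0.
have pi0 : 0 < pi :> R by exact: pi_gt0.
have sp : 0 < sqrt pi :> R by rewrite sqrtr_gt0.
pose eta' := eta * (sqrt pi / 2) / sqrt 2.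
have eta'0 : 0 < eta' by rewrite divr_gt0 // mulr_gt0 // divr_gt0.
have /cvgrPdist_le /(_ _ eta'0) [M [_ HM]] := @gauss_integral_proof.cvg_integral0_gauss_sqr R.
exists (Num.max 0 (M + 1) * sqrt 2) => u hu.
have uM : Num.max 0 (M + 1) <= u / sqrt 2 by rewrite ler_pdivlMr.
have u0 : 0 <= u / sqrt 2 by apply: le_trans uM; rewrite le_max lexx.
have uM' : M < u / sqrt 2 by apply: lt_le_trans uM; rewrite lt_max ltrDl ltr01 orbT.
have := HM _ uM' => /=; rewrite IJ //.
have := @gauss_integral_proof.integral0_gauss_ge0 R (u / sqrt 2).
set J := gauss_integral_proof.integral0_gauss _ => J0.
have -> : sqrt (2 * pi) = sqrt 2 * sqrt pi :> R by rewrite sqrtrM.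
have -> : pi / 4 = (sqrt pi / 2) ^+ 2 :> R.
  by rewrite exprMn sqr_sqrtr ?(ltW pi0) // exprVn; congr (_ / _); ring.
set b := sqrt pi / 2.
have b0 : 0 < b by rewrite divr_gt0.
have -> : sqrt 2 * J - sqrt 2 * sqrt pi / 2 = sqrt 2 * (J - b) by rewrite /b; ring.
rewrite normrM gtr0_norm // mulrC -ler_pdivlMr // => h.
(* The known limit is that of [J ^+ 2]. As [J >= 0], the difference of the squares is at least [b]
   times the difference of [J] and [b]. *)
rewrite -(ler_pM2r b0); apply: (@le_trans _ _ (`|b ^+ 2 - J ^+ 2|)); last first.
  by apply: le_trans h _; rewrite /eta' -/b mulrAC.
have -> : b ^+ 2 - J ^+ 2 = - ((J - b) * (J + b)) by ring.
rewrite normrN normrM ler_wpM2l // ger0_norm; lra.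
Qed.

(** [G k] is the [k]-th space derivative of a solution of the heat equation with generator half the
    Laplacian. Only derivatives are bounded, since only they enter the errors; the decay exponent
    [s] is 1 for kernels and 0 for the error function. *)
Record heat (G : nat -> R -> R -> R) (s : nat) (B : R) : Prop := Heat {
  heat_dw : forall k (t w : R), (k < 4)%N -> 0 < t -> drv (G k t) w (G k.+1 t w);
  heat_dt : forall k (t w : R), (k < 3)%N -> 0 < t -> drv (fun t => G k t w) t (G k.+2 t w / 2);
  heat_bd : forall k (t w : R), (0 < k <= 4)%N -> 0 < t -> `|G k t w| <= B / sqrt t ^+ (k + s)
}.

Definition gaussz (z : R) (k : nat) (t w : R) : R := gaussd k t (w - z).

(** Reflection principle: up to the factor [sqrt (2 * pi)], the heat kernel on the half-line killed
    at 0, with pole [z], extended to an odd function of [w]. *)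
Definition gausso (z : R) (k : nat) (t w : R) : R := gaussd k t (w - z) - gaussd k t (w + z).

Definition erfh (e : R -> R) (k : nat) (t w : R) : R :=
  if k is k'.+1 then gaussd k' t w else e (w / sqrt t).

Lemma drv_shift (g : R -> R) (w c a : R) : drv g (w + c) a -> drv (fun w => g (w + c)) w a.
Proof.
move=> h; apply: drv_eq.
  apply: (drv_comp (g2 := fun w => w + c) h).
  by apply: drv_add; [exact: drv_id|exact: drv_cst].
by rewrite addr0 mulr1.
Qed.

Lemma heat_gaussz : exists2 B : R, 0 < B & forall z, heat (gaussz z) 1 B.
Proof.
have [B B0 HB] := gaussd_bound R; exists B => // z; split.
- by move=> k t w k4 t0; apply: drv_shift; exact: gaussd_dw.
- by move=> k t w k3 t0; exact: gaussd_dt.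
- by move=> k t w /andP[_ k4] t0; rewrite addn1; exact: HB.
Qed.

Lemma heat_gausso : exists2 B : R, 0 < B & forall z, heat (gausso z) 1 B.
Proof.
have [B B0 HB] := gaussd_bound R; exists (B + B); first by rewrite addr_gt0.
move=> z; split.
- move=> k t w k4 t0; apply: drv_add; first by apply: drv_shift; exact: gaussd_dw.
  by apply: drv_opp; apply: drv_shift; exact: gaussd_dw.
- move=> k t w k3 t0; apply: drv_eq.
    by apply: drv_add; [|apply: drv_opp]; exact: gaussd_dt.
  by rewrite /gausso; ring.
- move=> k t w /andP[_ k4] t0; rewrite addn1 mulrDl.
  by apply: le_trans (ler_normB _ _) _; apply: lerD; exact: HB.
Qed.

Lemma gaussd0 (t w : R) : gaussd 0 t w = gauss t w.
Proof. by rewrite /gaussd mul1r. Qed.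

Lemma heat_erf e : (forall u, drv e u (expR (- (u ^+ 2 / 2)))) ->
  exists2 B : R, 0 < B & heat (erfh e) 0 B.
Proof.
move=> He; have [B B0 HB] := gaussd_bound R; exists B => //; split.
- move=> [|k] t w k4 t0; last by apply: gaussd_dw => //; exact: ltnW.
  have s0 : 0 < sqrt t by rewrite sqrtr_gt0.
  apply: drv_eq.
    apply: drv_comp; first exact: He.
    by apply: drv_mul; [exact: drv_id|exact: drv_cst].
  rewrite /= mulr0 addr0 mul1r gaussd0 /gauss mulrC; congr (_ * expR (- _)).
  have tE : t = sqrt t ^+ 2 by rewrite sqr_sqrtr // ltW.
  by rewrite {2}tE; field; rewrite gt_eqF.
- move=> [|k] t w k3 t0; last by apply: gaussd_dt => //; exact: ltnW.
  have s0 : 0 < sqrt t by rewrite sqrtr_gt0.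
  apply: drv_eq.
    apply: drv_comp; first exact: He.
    apply: drv_mul; first exact: drv_cst.
    by apply: drv_inv; [rewrite gt_eqF|exact: drv_sqrt].
  have tE : t = sqrt t ^+ 2 by rewrite sqr_sqrtr // ltW.
  rewrite /= /gaussd /= /gauss.
  have -> : w ^+ 2 / (2 * t) = (w / sqrt t) ^+ 2 / 2 by rewrite {1}tE; field; rewrite gt_eqF.
  set E := expR _; have -> : w / t = w / sqrt t ^+ 2 by rewrite -tE.
  by field; rewrite gt_eqF.
- move=> [//|k] t w /andP[_ k4] t0; rewrite addn0; apply: HB => //; exact: ltnW.
Qed.

Section Lindeberg.
Variables (T : finType) (P : T -> T -> R) (f r rho : T -> R) (v2 : R).
Hypothesis Pst : stochastic P.
Hypothesis Hr : forall x, \sum_x' P x x' * (f x' + r x') = r x.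
Hypothesis Hrho : forall x, \sum_x' P x x' * (f x' + r x' - r x) ^+ 2 + \sum_x' P x x' * rho x'
                = v2 + rho x.
Hypothesis v20 : 0 < v2.

(** Evaluation at the harmonic coordinate [w + r x] removes the first-order Taylor term on average;
    the [rho] term replaces the conditional variance by the constant [v2]. *)
Definition corr (G : nat -> R -> R -> R) (t : R) : T -> R -> R :=
  fun x w => G 0%N t (w + r x) + rho x / 2 * G 2%N t (w + r x).

Lemma sqrt_pow_le (B t t' : R) k : 0 <= B -> 0 < t -> t <= t' ->
  B / sqrt t' ^+ k <= B / sqrt t ^+ k.
Proof.
move=> B0 t0 tt'; rewrite ler_wpM2l // lef_pV2 ?posrE ?exprn_gt0 ?sqrtr_gt0 //; last lra.
by rewrite lerXn2r // ?nnegrE ?sqrtr_ge0 // ler_sqrt //; lra.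
Qed.

Lemma sqrt_powS_le (B t : R) k : 0 <= B -> 1 <= t -> B / sqrt t ^+ k.+1 <= B / sqrt t ^+ k.
Proof.
move=> B0 t1; have s1 : 1 <= sqrt t by rewrite -sqrtr1 ler_sqrt //; lra.
rewrite ler_wpM2l // lef_pV2 ?posrE ?exprn_gt0 //; try lra.
by rewrite exprS ler_peMl // exprn_ge0 //; lra.
Qed.

(** In the averaged Taylor expansion in the increment [xi], the first order vanishes by [Hr] and the
    second becomes [(v2 + rho x) / 2] by [Hrho]. Advancing time by [v2] produces the same terms
    through the heat equation, so only remainders of third order or smaller are left. *)
Lemma lindeberg_step : exists2 C : R, 0 < C & forall G s B, heat G s B -> 0 <= B ->
  forall t x w, 1 <= t ->
  `|step P f false (corr G t) x w - corr G (t + v2) x w| <= C * (B / sqrt t ^+ (3 + s)).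
Proof.
have [X X0 HX] := fin_ub (fun p : T * T => f p.2 + r p.2 - r p.1).
have [Y Y0 HY] := fin_ub rho.
exists (X ^+ 3 + Y * X + v2 ^+ 2 + Y * v2).
  by rewrite !addr_gt0 ?mulr_gt0 ?exprn_gt0.
move=> G s B HG B0 t x w t1.
have t0 : 0 < t by lra.
set M := B / sqrt t ^+ (3 + s).
have M0 : 0 <= M by rewrite divr_ge0 // exprn_ge0 // sqrtr_ge0.
have M3 c : `|G 3%N t c| <= M by exact: (heat_bd HG).
have M4 t' c : t <= t' -> `|G 4%N t' c| <= M.
  move=> tt'; apply: le_trans (heat_bd HG c _ _) _ => //; first lra.
  by apply: le_trans (sqrt_pow_le _ B0 t0 tt') _; exact: sqrt_powS_le.
pose h := w + r x.
pose xi x' := f x' + r x' - r x.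
have xiX x' : `|xi x'| <= X by exact: (HX (x, x')).
pose main x' := G 0%N t h + xi x' * G 1%N t h + xi x' ^+ 2 / 2 * G 2%N t h + rho x' / 2 * G 2%N t h.
have err x' : `|corr G t x' (w + f x') - main x'| <= (X ^+ 3 + Y * X) * M.
  have -> : corr G t x' (w + f x') - main x' =
     (G 0%N t (h + xi x') - G 0%N t h - xi x' * G 1%N t h - xi x' ^+ 2 / 2 * G 2%N t h)
     + rho x' / 2 * (G 2%N t (h + xi x') - G 2%N t h).
    rewrite /corr /main (_ : w + f x' + r x' = h + xi x'); last by rewrite /h /xi; ring.
    by ring.
  apply: le_trans (ler_normD _ _) _; rewrite [leRHS]mulrDl; apply: lerD.
    apply: le_trans (taylor3 (g1 := G 1%N t) (g2 := G 2%N t) (g3 := G 3%N t) h (xi x') _ _ _ M3) _;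
      try by move=> c; apply: (heat_dw HG).
    by rewrite mulrC ler_wpM2r // lerXn2r // nnegrE // ltW.
  rewrite normrM -mulrA.
  apply: ler_pM => //.
    rewrite normrM (ger0_norm (ltac:(by rewrite invr_ge0) : 0 <= (2 : R)^-1)).
    have := HY x'; have := normr_ge0 (rho x'); lra.
  apply: le_trans (mean_value_dist (g' := G 3%N t) (M := M) _ _) _.
  - by move=> c; apply: (heat_dw HG).
  - by move=> c _; exact: M3.
  by rewrite mulrC ler_wpM2r.
have mainE : \sum_x' P x x' * main x' = G 0%N t h + (v2 + rho x) / 2 * G 2%N t h.
  rewrite -Hrho.
  have -> : \sum_x' P x x' * main x' = \sum_x' (G 0%N t h * P x x' + G 1%N t h * (P x x' * xi x')
     + G 2%N t h / 2 * (P x x' * xi x' ^+ 2) + G 2%N t h / 2 * (P x x' * rho x')).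
    by apply: eq_bigr => x' _; rewrite /main; field.
  rewrite !big_split /= -!mulr_sumr.
  have -> : \sum_x' P x x' = 1 by case: Pst.
  have -> : \sum_x' P x x' * xi x' = 0.
    have -> : \sum_x' P x x' * xi x' = \sum_x' (P x x' * (f x' + r x') + (- r x) * P x x').
      by apply: eq_bigr => x' _; rewrite /xi; ring.
    rewrite big_split /= -mulr_sumr Hr; case: Pst => _ ->; ring.
  by ring.
have A1 : `|step P f false (corr G t) x w - (G 0%N t h + (v2 + rho x) / 2 * G 2%N t h)| <= (X ^+ 3 + Y * X) * M.
  rewrite -mainE /step /= -sumrB; apply: le_trans (ler_norm_sum _ _ _) _.
  apply: (@le_trans _ _ (\sum_x' P x x' * ((X ^+ 3 + Y * X) * M))).
    apply: ler_sum => x' _; rewrite -mulrBr normrM ger0_norm; last by case: Pst.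
    by rewrite ler_wpM2l //; case: Pst.
  by rewrite -mulr_suml; case: Pst => _ ->; rewrite mul1r.
have A2 : `|corr G (t + v2) x w - (G 0%N t h + (v2 + rho x) / 2 * G 2%N t h)| <= (v2 ^+ 2 + Y * v2) * M.
  have -> : corr G (t + v2) x w - (G 0%N t h + (v2 + rho x) / 2 * G 2%N t h) =
    (G 0%N (t + v2) h - G 0%N t h - v2 * (G 2%N t h / 2)) + rho x / 2 * (G 2%N (t + v2) h - G 2%N t h).
    by rewrite /corr -/h; field.
  apply: le_trans (ler_normD _ _) _; rewrite [leRHS]mulrDl; apply: lerD.
    rewrite [leRHS]mulrC.
    apply: (taylor2_time (g0 := fun t => G 0%N t h) (g1 := fun t => G 2%N t h / 2) (g2 := fun t => G 4%N t h / 4)).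
    - exact: ltW.
    - by move=> c /andP[hc _]; apply: (heat_dt HG) => //; lra.
    - move=> c /andP[hc _]; apply: drv_eq.
        by apply: drv_mul; [apply: (heat_dt HG) => //; lra|exact: drv_cst].
      by rewrite /=; field.
    - move=> c /andP[hc _]; have := M4 c h hc; rewrite normrM (ger0_norm (ltac:(by rewrite invr_ge0) : 0 <= (4 : R)^-1)).
      have := normr_ge0 (G 4%N c h); lra.
  rewrite normrM -mulrA.
  apply: ler_pM => //.
    rewrite normrM (ger0_norm (ltac:(by rewrite invr_ge0) : 0 <= (2 : R)^-1)).
    have := HY x; have := normr_ge0 (rho x); lra.
  have := @mean_value_le R (fun t => G 2%N t h) (fun t => G 4%N t h / 2) t (t + v2) M.
  rewrite (_ : t + v2 - t = v2); last by ring.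
  rewrite [M * v2]mulrC; apply; first by rewrite lerDl ltW.
    by move=> c /andP[hc _]; apply: (heat_dt HG) => //; lra.
  move=> c /andP[hc _]; have := M4 c h hc; rewrite normrM (ger0_norm (ltac:(by rewrite invr_ge0) : 0 <= (2 : R)^-1)).
  have := normr_ge0 (G 4%N c h); lra.
pose c := G 0%N t h + (v2 + rho x) / 2 * G 2%N t h; rewrite -/c in A1 A2.
set a := step _ _ _ _ _ _ in A1 *; set b := corr _ _ _ _ in A2 *.
have -> : a - b = (a - c) - (b - c) by ring.
apply: le_trans (ler_normB _ _) _.
by have := lerD A1 A2; rewrite -mulrDl !addrA.
Qed.

End Lindeberg.
End Heat.

(** * Local limit theorem for the free walk *)

Lemma sqrt_large (R : realType) (A : R) : exists N, forall n, (N <= n)%N ->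
  (0 < n)%N /\ A <= Num.sqrt n%:R.
Proof.
exists (Num.truncn (A ^+ 2)).+1 => n hn; split; first exact: leq_trans hn.
apply: le_trans (ler_norm _) _; rewrite -sqrtr_sqr ler_sqrt ?ler0n //.
by apply: ltW; apply: lt_le_trans (Num.Theory.truncnS_gt _) _; rewrite ler_nat.
Qed.

Lemma erf_odd (R : realType) (e : R -> R) : (forall u, drv e u (expR (- (u ^+ 2 / 2)))) ->
  e 0 = 0 -> forall u, e (- u) = - e u.
Proof.
move=> He e0 u.
have := @mean_value_dist R (fun u => e u + e (- u)) (fun u => 0) 0 u 0.
rewrite mul0r add0r oppr0 e0 addr0 subr0 => H.
apply/eqP; rewrite -addr_eq0 addrC -normr_le0; apply: H; last by move=> c _; rewrite normr0.
move=> c; apply: drv_eq.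
  apply: drv_add; first exact: He.
  apply: drv_comp; first exact: He.
  by apply: drv_opp; exact: drv_id.
by rewrite sqrrN; ring.
Qed.

Section LocalLimit.
Variables (R : realType) (T : finType) (P : T -> T -> R) (f nu r rho : T -> R) (v2 : R).
Hypothesis Pst : stochastic P.
Hypothesis nuP : invariant_prob P nu.
Hypothesis HH1 : H1 P.
Hypothesis HH3 : H3 P f.
Hypothesis Hr : forall x, \sum_x' P x x' * (f x' + r x') = r x.
Hypothesis Hrho : forall x, \sum_x' P x x' * (f x' + r x' - r x) ^+ 2 + \sum_x' P x x' * rho x'
                = v2 + rho x.
Hypothesis v20 : 0 < v2.
Local Notation Q := (walk P f false).
Local Notation sqrt := Num.sqrt.
Local Notation corr := (corr r rho).

Lemma corr_close : exists2 C : R, 0 < C & forall G s B, heat G s B -> 0 <= B ->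
  forall (t : R) x w, 1 <= t -> `|corr G t x w - G 0%N t w| <= C * (B / sqrt t ^+ (1 + s)).
Proof.
have [X X0 HX] := fin_ub r; have [Y Y0 HY] := fin_ub rho.
exists (X + Y); first by rewrite addr_gt0.
move=> G s B HG B0 t x w t1; have t0 : 0 < t by lra.
set M := B / _.
have M0 : 0 <= M by rewrite divr_ge0 // exprn_ge0 // sqrtr_ge0.
have -> : corr G t x w - G 0%N t w = (G 0%N t (w + r x) - G 0%N t w) + rho x / 2 * G 2%N t (w + r x).
  by rewrite /corr; ring.
apply: le_trans (ler_normD _ _) _; rewrite [leRHS]mulrDl; apply: lerD.
  apply: le_trans (mean_value_dist (g' := G 1%N t) (M := M) _ _) _.
  - by move=> c; apply: (heat_dw HG).
  - by move=> c _; exact: (heat_bd HG).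
  by rewrite mulrC ler_wpM2r.
rewrite normrM; apply: ler_pM => //.
  rewrite normrM (ger0_norm (ltac:(by rewrite invr_ge0) : 0 <= (2 : R)^-1)).
  have := HY x; have := normr_ge0 (rho x); lra.
by apply: le_trans (heat_bd HG _ _ t0) _ => //; exact: sqrt_powS_le.
Qed.

Lemma free_corr : exists2 C : R, 0 < C & forall G s B, heat G s B -> 0 <= B ->
  forall (t : R) n x w, 1 <= t ->
  `|Q n (corr G t) x w - corr G (t + n%:R * v2) x w| <= n%:R * (C * (B / sqrt t ^+ (3 + s))).
Proof.
have [C C0 HC] := lindeberg_step Pst Hr Hrho v20; exists C => // G s B HG B0 t n x w t1.
have t0 : 0 < t by lra.
elim: n x w => [|n IH] x w; first by rewrite !mul0r addr0 subrr normr0.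
rewrite walkS.
have tn : t <= t + n%:R * v2 by rewrite lerDl mulr_ge0 // ltW.
have h1 := HC G s B HG B0 (t + n%:R * v2) x w (le_trans t1 tn).
have h2 : `|step P f false (Q n (corr G t)) x w - step P f false (corr G (t + n%:R * v2)) x w|
    <= n%:R * (C * (B / sqrt t ^+ (3 + s))).
  by rewrite -(walkBf P f false 1 (Q n (corr G t))); exact: (walk_bound f Pst 1).
have -> : t + n.+1%:R * v2 = t + n%:R * v2 + v2 by rewrite -natr1; ring.
set a := step _ _ _ _ _ _ in h2 *; set b := step _ _ _ _ _ _ in h1 h2; set c := corr _ _ _ _ in h1 *.
have -> : a - c = (a - b) + (b - c) by ring.
apply: le_trans (ler_normD _ _) _; rewrite -natr1 [leRHS]mulrDl mul1r; apply: lerD => //.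
apply: le_trans h1 _; rewrite ler_wpM2l ?(ltW C0) //; exact: sqrt_pow_le.
Qed.

Lemma free_heat : exists2 C : R, 0 < C & forall G s B, heat G s B -> 0 <= B ->
  forall (t : R) n x w, 1 <= t ->
  `|Q n (fun _ w => G 0%N t w) x w - G 0%N (t + n%:R * v2) w| <=
    C * B * (n%:R / sqrt t ^+ (3 + s) + 1 / sqrt t ^+ (1 + s)).
Proof.
have [C1 C10 HC1] := corr_close; have [C2 C20 HC2] := free_corr.
exists (C1 + C1 + C2); first by rewrite !addr_gt0.
move=> G s B HG B0 t n x w t1; have t0 : 0 < t by lra.
have tn : t <= t + n%:R * v2 by rewrite lerDl mulr_ge0 // ltW.
have h1 : `|Q n (fun _ w => G 0%N t w) x w - Q n (corr G t) x w| <= C1 * (B / sqrt t ^+ (1 + s)).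
  rewrite -walkBf; apply: (walk_bound f Pst) => x' w'; rewrite distrC; exact: HC1.
have h2 := HC2 G s B HG B0 t n x w t1.
have h3 : `|corr G (t + n%:R * v2) x w - G 0%N (t + n%:R * v2) w| <= C1 * (B / sqrt t ^+ (1 + s)).
  apply: le_trans (HC1 _ _ _ HG B0 _ _ _ (le_trans t1 tn)) _.
  by rewrite ler_wpM2l ?(ltW C10) //; exact: sqrt_pow_le.
set a := Q n _ x w in h1 *; set b := Q n _ x w in h1 h2; set c := corr _ _ _ _ in h2 h3.
have -> : a - G 0%N (t + n%:R * v2) w = (a - b) + (b - c) + (c - G 0%N (t + n%:R * v2) w) by ring.
apply: le_trans (ler_normD _ _) _; apply: le_trans (lerD (ler_normD _ _) (lexx _)) _.
set A := sqrt t ^+ (3 + s) in h2 *; set A' := sqrt t ^+ (1 + s) in h1 h3 *.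
have p1 : 0 <= B * (n%:R / A) by rewrite mulr_ge0 ?divr_ge0 // exprn_ge0 // sqrtr_ge0.
have p2 : 0 <= B / A' by rewrite divr_ge0 // exprn_ge0 // sqrtr_ge0.
have p3 : 0 <= C1 * (B * (n%:R / A)) by rewrite mulr_ge0 // ltW.
have p4 : 0 <= C2 * (B / A') by rewrite mulr_ge0 // ltW.
lra.
Qed.

Lemma decouple1 (F La : R) (g : R -> R) (psi : T -> R) : (forall x, `|f x| <= F) ->
  (forall w d, `|g (w + d) - g w| <= La * `|d|) -> 0 <= La -> (forall x, `|psi x| <= 1) ->
  forall j x w, `|Q j (fun x w => psi x * g w) x w - Ppow P j psi x * g w| <= j%:R * (F * La).
Proof.
move=> HF Hg La0 Hpsi; elim=> [|j IH] x w; first by rewrite subrr normr0 mul0r.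
have F0 : 0 <= F by apply: le_trans (HF x).
have P1 y : `|Ppow P j psi y| <= 1 by rewrite (PpowE P f _ _ _ 0); apply: walk_bound.
rewrite walkS /Ppow iterS PopE -/(Ppow P j psi) mulr_suml /step /= -sumrB.
apply: le_trans (ler_norm_sum _ _ _) _.
apply: (@le_trans _ _ (\sum_x' P x x' * (j.+1%:R * (F * La)))); last first.
  by rewrite -mulr_suml; case: Pst => _ ->; rewrite mul1r.
apply: ler_sum => x' _; rewrite -mulrA -mulrBr normrM ger0_norm; last by case: Pst.
rewrite ler_wpM2l //; first by case: Pst.
have h := IH x' (w + f x').
set a := Q j _ _ _ in h *; set b := Ppow P j psi x' in h *.
have -> : a - b * g w = (a - b * g (w + f x')) + b * (g (w + f x') - g w) by ring.
apply: le_trans (ler_normD _ _) _; rewrite -natr1 [leRHS]mulrDl mul1r; apply: lerD => //.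
rewrite normrM -[leRHS]mul1r; apply: ler_pM => //; first exact: P1.
by apply: le_trans (Hg _ _) _; rewrite mulrC ler_wpM2r.
Qed.

(** During the last [j] steps the Lipschitz function [g] hardly changes, while [psi] is averaged to
    [nu psi] at a geometric rate. [j] is left free, to be fixed before [n] grows. *)
Lemma decouple : exists2 F : R, 0 < F & exists C q : R, [/\ 0 < C, 0 < q < 1 &
  forall (La A : R) (g : R -> R) (psi : T -> R),
  (forall w d, `|g (w + d) - g w| <= La * `|d|) -> 0 <= La -> (forall w, `|g w| <= A) ->
  (forall x, `|psi x| <= 1) ->
  forall j n x w, (j <= n)%N ->
  `|Q n (fun x w => psi x * g w) x w - nuE nu psi * Q n (fun _ w => g w) x w|
     <= 2 * (j%:R * (F * La)) + C * q ^+ j * A].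
Proof.
have [F F0 HF] := fin_ub f; exists F => //.
have [C [q [C0 q01 HC]]] := ergodic f Pst nuP HH1; exists C, q; split => //.
move=> La A g psi Hg La0 HA Hpsi j n x w jn.
have A0 : 0 <= A by apply: le_trans (HA 0).
have q0 : 0 <= q by case/andP: q01 => /ltW.
have nu1 : `|nuE nu psi| <= 1.
  have := @nuE_normB R T P nu nuP 0 psi 1; rewrite sub0r normrN; apply => y.
  by rewrite sub0r normrN.
rewrite -(subnK jn) !walkD -walkZ -walkBf.
apply: (walk_bound f Pst) => x' w'.
have h1 := decouple1 HF Hg La0 Hpsi j x' w'.
have h2 := decouple1 HF Hg La0 (fun=> (ltac:(by rewrite normr1) : `|(1 : R)| <= 1)) j x' w'.
rewrite (Ppow_cst f Pst) mul1r in h2.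
have h2' : `|Q j (fun _ w => g w) x' w' - g w'| <= j%:R * (F * La).
  by apply: le_trans h2; rewrite le_eqVlt; apply/orP; left; apply/eqP; congr (`|_ - _|);
     apply: walk_ext => *; rewrite mul1r.
have h3 := HC psi 1 Hpsi j x'; rewrite mulr1 in h3.
set a := Q j _ x' w' in h1 *; set b := Q j _ x' w' in h2' *; set c := Ppow P j psi x' in h1 h3.
set m := nuE nu psi in h3 nu1 *.
have -> : a - m * b = (a - c * g w') + (c - m) * g w' - m * (b - g w') by ring.
apply: le_trans (ler_normB _ _) _; apply: le_trans (lerD (ler_normD _ _) (lexx _)) _.
have e1 : `|(c - m) * g w'| <= C * q ^+ j * A.
  by rewrite normrM; apply: ler_pM.
have e2 : `|m * (b - g w')| <= j%:R * (F * La).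
  by rewrite normrM -[leRHS]mul1r; apply: ler_pM.
lra.
Qed.

Lemma gauss_lip : exists2 B : R, 0 < B & forall t z w d : R, 0 < t ->
  `|gauss t (w + d - z) - gauss t (w - z)| <= B / t * `|d|.
Proof.
have [B B0 HB] := gaussd_bound R; exists B => // t' z w d t0.
have -> : w + d - z = w - z + d by ring.
apply: (mean_value_dist (g' := gaussd 1 t')).
  move=> c; apply: drv_eq; first exact: gauss_dw.
  by rewrite /gaussd /=.
move=> c _; have := HB 1%N t' c isT t0.
by rewrite sqr_sqrtr // ltW.
Qed.

Lemma gauss_time (B t s w : R) : 0 < B ->
  (forall k (t w : R), (k <= 4)%N -> 0 < t -> `|gaussd k t w| <= B / sqrt t ^+ k.+1) ->
  0 < t -> 0 <= s -> `|gauss (t + s) w - gauss t w| <= B / sqrt t ^+ 3 * s.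
Proof.
move=> B0 HB t0 s0.
have := @mean_value_le R (fun t => gauss t w) (fun t => gaussd 2 t w / 2) t (t + s) (B / sqrt t ^+ 3).
rewrite (_ : t + s - t = s); last by ring.
apply; first by rewrite lerDl.
  move=> c /andP[hc _]; apply: drv_eq; first by apply: gauss_dt; lra.
  by rewrite /gaussd /=; ring.
move=> c /andP[hc _]; rewrite normrM (ger0_norm (ltac:(by rewrite invr_ge0) : 0 <= (2 : R)^-1)).
have h := HB 2%N c w isT (lt_le_trans t0 hc).
have h' := sqrt_pow_le 3 (ltW B0) t0 hc.
have := normr_ge0 (gaussd 2 c w); lra.
Qed.

(** A Gaussian of variance [th n] already varies on the scale [sqrt n], so the heat comparison
    starts at time [th n] and costs only [O(1/n)]; the variances [th n] and [n v2] add. *)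
Lemma smooth_llt (th eta : R) : 0 < th -> 0 < eta -> exists N, forall n, (N <= n)%N ->
  forall psi z x w, (forall x, `|psi x| <= 1) ->
  `|Q n (fun x w => psi x * gauss (th * n%:R) (w - z)) x w
     - nuE nu psi * gauss (n%:R * (th + v2)) (w - z)| <= eta / sqrt n%:R.
Proof.
move=> th0 eta0.
have [F F0 [C [q [C0 /andP[q0 q1] HD]]]] := decouple.
have [B B0 HB] := gauss_lip.
have [B1 B10 HB1] := heat_gaussz R.
have [C1 C10 HC1] := free_heat.
have sth : 0 < sqrt th by rewrite sqrtr_gt0.
(* [j] settles the ergodic error for all [n]; the other errors are then [O(1/n)], to be compared
   with [eta / sqrt n]. *)
have [j Hj] : exists j, C * q ^+ j / sqrt th <= eta / 3.
  have /cvgrPdist_le : (geometric (C / sqrt th) q n @[n --> \oo] --> (0 : R))%classic.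
    by apply: cvg_geometric; rewrite ger0_norm // ltW.
  move=> /(_ (eta / 3) ltac:(by rewrite divr_gt0)) [N _ /(_ N (leqnn N))] /=.
  rewrite sub0r normrN ger0_norm; last by rewrite mulr_ge0 ?exprn_ge0 ?divr_ge0 ?ltW.
  by move=> h; exists N; rewrite mulrAC.
pose D1 := 2 * (j%:R * (F * (B / th))).
pose D2 := C1 * B1 * (1 / th ^+ 2 + 1 / th).
have D10 : 0 <= D1 by rewrite /D1 !mulr_ge0 ?invr_ge0 ?ler0n // ltW.
have D20 : 0 <= D2 by rewrite /D2 mulr_ge0 ?addr_ge0 ?divr_ge0 ?exprn_ge0 ?mulr_ge0 // ltW.
have [N1 HN1] := sqrt_large (3 * D1 / eta + 3 * D2 / eta + sqrt th^-1).
exists (maxn N1 j) => n; rewrite geq_max => /andP[/HN1[n0 hs] jn] psi z x w Hpsi.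
have n0' : 0 < n%:R :> R by rewrite ltr0n.
have s0 : 0 < sqrt n%:R :> R by rewrite sqrtr_gt0.
set s := sqrt n%:R in hs s0 *.
have nE : n%:R = s * s by rewrite /s -expr2 sqr_sqrtr // ltW.
have t0 : 0 < th * n%:R by rewrite mulr_gt0.
have st : sqrt (th * n%:R) = sqrt th * s by rewrite sqrtrM // ltW.
have d1e : 0 <= 3 * D1 / eta by rewrite divr_ge0 ?(ltW eta0) // mulr_ge0.
have d2e : 0 <= 3 * D2 / eta by rewrite divr_ge0 ?(ltW eta0) // mulr_ge0.
have ths : 0 <= sqrt th^-1 by rewrite sqrtr_ge0.
have t1 : 1 <= th * n%:R.
  have h : sqrt th^-1 <= s by lra.
  rewrite mulrC -ler_pdivrMr // div1r -[leLHS]sqr_sqrtr ?invr_ge0 ?(ltW th0) // nE -expr2.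
  by rewrite lerXn2r // nnegrE ?sqrtr_ge0 // ltW.
have h1 := HD (B / (th * n%:R)) (sqrt (th * n%:R))^-1 (fun w => gauss (th * n%:R) (w - z)) psi.
have h1' := h1 (fun w d => HB _ z w d t0) ltac:(by rewrite divr_ge0 // ltW)
  (fun w => ltac:(by rewrite ger0_norm ?gauss_ge0 // gauss_le)) Hpsi j n x w jn.
have h2 := HC1 _ _ _ (HB1 z) (ltW B10) (th * n%:R) n x w t1.
have e1 : 2 * (j%:R * (F * (B / (th * n%:R)))) <= eta / 3 / s.
  have -> : 2 * (j%:R * (F * (B / (th * n%:R)))) = D1 / s / s.
    by rewrite /D1 nE; field; rewrite !gt_eqF.
  rewrite ler_wpM2r ?invr_ge0 ?(ltW s0) // ler_pdivrMr //.
  have : 3 * D1 / eta <= s by lra.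
  rewrite ler_pdivrMr //; lra.
have e2 : C * q ^+ j * (sqrt (th * n%:R))^-1 <= eta / 3 / s.
  by rewrite st invfM mulrA ler_wpM2r ?invr_ge0 ?(ltW s0).
have e3 : C1 * B1 * (n%:R / sqrt (th * n%:R) ^+ (3 + 1) + 1 / sqrt (th * n%:R) ^+ (1 + 1)) <= eta / 3 / s.
  have -> : sqrt (th * n%:R) ^+ (3 + 1) = (th * n%:R) ^+ 2.
    by rewrite (exprM _ 2 2) sqr_sqrtr // ltW.
  have -> : sqrt (th * n%:R) ^+ (1 + 1) = th * n%:R by rewrite sqr_sqrtr // ltW.
  have -> : C1 * B1 * (n%:R / (th * n%:R) ^+ 2 + 1 / (th * n%:R)) = D2 / s / s.
    by rewrite /D2 nE; field; rewrite !gt_eqF.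
  rewrite ler_wpM2r ?invr_ge0 ?(ltW s0) // ler_pdivrMr //.
  have : 3 * D2 / eta <= s by lra.
  rewrite ler_pdivrMr //; lra.
have nu1 : `|nuE nu psi| <= 1.
  have := @nuE_normB R T P nu nuP 0 psi 1; rewrite sub0r normrN; apply => y.
  by rewrite sub0r normrN.
have E1 : Q n (fun _ w => gaussz z 0 (th * n%:R) w) x w = Q n (fun _ w => gauss (th * n%:R) (w - z)) x w.
  by apply: walk_ext => x' w'; rewrite /gaussz gaussd0.
rewrite E1 /gaussz gaussd0 in h2.
have -> : n%:R * (th + v2) = th * n%:R + n%:R * v2 by ring.
set a := Q n _ x w in h1' *; set b := Q n _ x w in h1' h2; set c := gauss _ _ in h2 *; set m := nuE nu psi in h1' nu1 *.
have -> : a - m * c = (a - m * b) + m * (b - c) by ring.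
apply: le_trans (ler_normD _ _) _.
have e4 : `|m * (b - c)| <= eta / 3 / s.
  rewrite normrM -[leRHS]mul1r; apply: ler_pM => //; exact: le_trans h2 e3.
have -> : eta / s = eta / 3 / s + eta / 3 / s + eta / 3 / s by field; rewrite gt_eqF.
by apply: lerD => //; apply: le_trans h1' _; apply: lerD.
Qed.

End LocalLimit.

Lemma drv_mono (R : realType) (g g' : R -> R) (a b : R) : a <= b ->
  (forall c, drv g c (g' c)) -> (forall c, 0 <= g' c) -> g a <= g b.
Proof.
move=> ab Hd H0.
have [c cab E] : exists2 c, c \in `[a, b]%R & g b - g a = g' c * (b - a).
  apply: MVT_segment => //; first by move=> x _; exact: Hd.
  by apply: derivable_within_continuous => x _; have [] := Hd x.
by rewrite -subr_ge0 E mulr_ge0 // subr_ge0.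
Qed.

Lemma gauss_tail (R : realType) (t y D : R) : 0 < t -> 0 < D -> D <= `|y| ->
  gauss t y <= 2 * Num.sqrt t / D ^+ 2.
Proof.
move=> t0 D0 Dy.
have s0 : 0 < Num.sqrt t by rewrite sqrtr_gt0.
have tE : t = Num.sqrt t ^+ 2 by rewrite sqr_sqrtr // ltW.
have y2 : D ^+ 2 <= y ^+ 2.
  by rewrite -[leRHS](real_normK (num_real y)) lerXn2r // nnegrE // ltW.
have D2 : 0 < D ^+ 2 by rewrite exprn_gt0.
have y20 : 0 < y ^+ 2 by exact: lt_le_trans y2.
have h : expR (- (y ^+ 2 / (2 * t))) <= 2 * t / y ^+ 2.
  have X0 : 0 < y ^+ 2 / (2 * t) by rewrite divr_gt0 // mulr_gt0.
  rewrite expRN -[leRHS]invf_div lef_pV2 ?posrE ?expR_gt0 //.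
  by apply: le_trans (expR_ge1Dx _); rewrite lerDr.
rewrite /gauss; apply: (@le_trans _ _ ((Num.sqrt t)^-1 * (2 * t / D ^+ 2))).
  rewrite ler_wpM2l ?invr_ge0 ?(ltW s0) //; apply: le_trans h _.
  by rewrite ler_wpM2l ?mulr_ge0 ?(ltW t0) // lef_pV2.
by rewrite {2}tE le_eqVlt; apply/orP; left; apply/eqP; field; rewrite !gt_eqF.
Qed.

(** * Gaussian mixtures of translated windows *)

Section Tiles.
Variables (R : realType) (T : finType) (e : R -> R).
Hypothesis He : forall u, drv e u (expR (- (u ^+ 2 / 2))).
Hypothesis e0 : e 0 = 0.
Local Notation sqrt := Num.sqrt.
Variables (a t : R) (M : nat).
Hypotheses (a0 : 0 < a) (t0 : 0 < t).

Definition tile_pt (k : nat) : R := (k%:R - M%:R) * a.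

(** The integral of [gauss t] over the [k]-th tile, written with the error function so that the
    total weight telescopes. *)
Definition tile_wt (k : nat) : R := e (tile_pt k.+1 / sqrt t) - e (tile_pt k / sqrt t).

Lemma tile_wt_ge0 k : 0 <= tile_wt k.
Proof.
rewrite subr_ge0; apply: (drv_mono (g' := fun u => expR (- (u ^+ 2 / 2)))) => //.
by rewrite ler_pM2r ?invr_gt0 ?sqrtr_gt0 // ler_pM2r // lerD2r ler_nat.
Qed.

Lemma tile_wt_sum : \sum_(k < M + M) tile_wt k = 2 * e (M%:R * a / sqrt t).
Proof.
rewrite -(big_mkord xpredT tile_wt) (telescope_sumr (fun k => e (tile_pt k / sqrt t))) //.
rewrite /tile_pt natrD addrK sub0r !mulNr (erf_odd He e0); ring.
Qed.

Lemma tile_wt_gauss B k s : (forall k (t w : R), (k <= 4)%N -> 0 < t -> `|gaussd k t w| <= B / sqrt t ^+ k.+1) ->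
  tile_pt k <= s <= tile_pt k.+1 -> `|tile_wt k - a * gauss t s| <= 2 * (a ^+ 2 * (B / t)).
Proof.
move=> HB /andP[s1 s2].
have s0 : 0 < sqrt t by rewrite sqrtr_gt0.
have dE c : drv (fun w => e (w / sqrt t)) c (gauss t c).
  apply: drv_eq.
    apply: drv_comp; first exact: He.
    by apply: drv_mul; [exact: drv_id|exact: drv_cst].
  rewrite /= mulr0 addr0 mul1r /gauss mulrC; congr (_ * expR (- _)).
  have tE : t = sqrt t ^+ 2 by rewrite sqr_sqrtr // ltW.
  by rewrite {2}tE; field; rewrite gt_eqF.
have dG c : drv (gauss t) c (gaussd 1 t c).
  by apply: drv_eq; first exact: gauss_dw.
have M1 c : `|gaussd 1 t c| <= B / t by have := HB 1%N t c isT t0; rewrite sqr_sqrtr // ltW.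
have B0 : 0 <= B / t by apply: le_trans (M1 0).
have pE : tile_pt k.+1 = tile_pt k + a by rewrite /tile_pt -natr1; ring.
have h1 := taylor2 (tile_pt k) a dE dG M1.
have h2 : `|gauss t (tile_pt k + (s - tile_pt k)) - gauss t (tile_pt k)| <= B / t * `|s - tile_pt k|.
  by apply: (mean_value_dist (g' := gaussd 1 t)).
rewrite (addrC (tile_pt k)) subrK in h2.
have h3 : `|s - tile_pt k| <= a by rewrite ler_norml; rewrite pE in s2; lra.
rewrite /tile_wt pE; set A := e _ - e _ in h1 *.
have -> : A - a * gauss t s = (A - a * gauss t (tile_pt k)) - a * (gauss t s - gauss t (tile_pt k)) by ring.
apply: le_trans (ler_normB _ _) _.
have -> : 2 * (a ^+ 2 * (B / t)) = B / t * a ^+ 2 + a * (B / t * a) by ring.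
apply: lerD => //; rewrite normrM gtr0_norm // ler_pM2l //.
by apply: le_trans h2 _; rewrite ler_wpM2l.
Qed.

Definition tiles (psi : T -> R) (z : R) : T -> R -> R :=
  fun x s => \sum_(k < M + M) tile_wt k * hwin psi (z + tile_pt k) a x s.

Lemma tiles_gauss B (psi : T -> R) z x s : (0 < M)%N -> (forall x, `|psi x| <= 1) ->
  (forall k (t w : R), (k <= 4)%N -> 0 < t -> `|gaussd k t w| <= B / sqrt t ^+ k.+1) ->
  `|tiles psi z x s - a * (psi x * gauss t (s - z))| <=
    2 * (a ^+ 2 * (B / t)) + a * (2 * sqrt t / (M%:R * a) ^+ 2).
Proof.
move=> M0 Hpsi HB.
have M0' : 0 < M%:R :> R by rewrite ltr0n.
have Bt0 : 0 <= B / t.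
  by apply: le_trans (normr_ge0 (gaussd 1 t 0)) _; have := HB 1%N t 0 isT t0; rewrite sqr_sqrtr // ltW.
have p1 : 0 <= 2 * (a ^+ 2 * (B / t)) by rewrite mulr_ge0 // mulr_ge0 // exprn_ge0 // ltW.
have p2 : 0 <= a * (2 * sqrt t / (M%:R * a) ^+ 2).
  apply: mulr_ge0; first exact: ltW.
  apply: divr_ge0; first by rewrite mulr_ge0 // sqrtr_ge0.
  exact: sqr_ge0.
(* The integer part of [y] is the index of the tile containing [s]. Outside [[0, 2M)] all terms
   vanish and the Gaussian is in its tail. *)
pose y := (s - z) / a + M%:R.
have cond (k : nat) : (z + tile_pt k <= s < z + tile_pt k + a) = (k%:R <= y < k.+1%:R).
  have -> : z + tile_pt k + a = z + tile_pt k.+1 by rewrite /tile_pt -natr1; ring.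
  congr (_ && _).
    by rewrite /y -lerBlDr ler_pdivlMr // lerBrDl.
  by rewrite /y -ltrBrDr ltr_pdivrMr // ltrBlDl.
case: (boolP (0 <= y < (M + M)%:R)) => [/andP[y0 yM]|out].
  have /andP[k1 k2] := Num.Theory.truncn_itv y0.
  set k := Num.truncn y in k1 k2.
  have kM : (k < M + M)%N by rewrite -(ltr_nat R); apply: le_lt_trans yM.
  have -> : tiles psi z x s = tile_wt k * psi x.
    rewrite /tiles (bigD1 (Ordinal kM)) //= big1 ?addr0.
      by rewrite /hwin cond k1 k2.
    move=> i /eqP ik; rewrite /hwin cond; case: ifP => [/andP[i1 i2]|_]; last by rewrite mulr0.
    exfalso; apply: ik; apply/val_inj => /=; apply/eqP; rewrite eqn_leq.
    have q1 : (i%:R : R) < k.+1%:R by lra.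
    have q2 : (k%:R : R) < i.+1%:R by lra.
    by move: q1 q2; rewrite !ltr_nat !ltnS => -> ->.
  have -> : tile_wt k * psi x - a * (psi x * gauss t (s - z)) = psi x * (tile_wt k - a * gauss t (s - z)) by ring.
  rewrite normrM -[leRHS]mul1r; apply: ler_pM => //.
  apply: (@le_trans _ _ (2 * (a ^+ 2 * (B / t)))); last by lra.
  apply: tile_wt_gauss => //.
  have := cond k; rewrite k1 k2 => /andP[c1 c2].
  have pE : tile_pt k.+1 = tile_pt k + a by rewrite /tile_pt -natr1; ring.
  by rewrite pE; lra.
have -> : tiles psi z x s = 0.
  rewrite /tiles big1 // => i _; rewrite /hwin cond; case: ifP => [/andP[i1 i2]|_]; last by rewrite mulr0.
  exfalso; move/negP: out; apply; apply/andP; split; first by apply: le_trans i1; rewrite ler0n.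
  by apply: lt_le_trans i2 _; rewrite ler_nat.
rewrite sub0r normrN normrM gtr0_norm //.
apply: (@le_trans _ _ (a * (2 * sqrt t / (M%:R * a) ^+ 2))); last by lra.
rewrite ler_wpM2l ?(ltW a0) // normrM -[leRHS]mul1r; apply: ler_pM => //.
rewrite ger0_norm ?gauss_ge0 //; apply: gauss_tail => //; first by rewrite mulr_gt0.
move/nandP: out => [h|h].
  rewrite -ltNge /y in h.
  have : (s - z) / a < - M%:R by lra.
  rewrite ltr_pdivrMr // mulNr => h'.
  by rewrite -normrN; apply: le_trans (ler_norm _); lra.
rewrite -leNgt /y natrD in h.
have : M%:R <= (s - z) / a by lra.
by rewrite ler_pdivlMr // => h'; apply: le_trans (ler_norm _).
Qed.

End Tiles.

Section LocalLimit2.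
Variables (R : realType) (T : finType) (P : T -> T -> R) (f nu r rho : T -> R) (v2 : R).
Hypothesis Pst : stochastic P.
Hypothesis nuP : invariant_prob P nu.
Hypothesis HH1 : H1 P.
Hypothesis HH3 : H3 P f.
Hypothesis Hr : forall x, \sum_x' P x x' * (f x' + r x') = r x.
Hypothesis Hrho : forall x, \sum_x' P x x' * (f x' + r x' - r x) ^+ 2 + \sum_x' P x x' * rho x'
                = v2 + rho x.
Hypothesis v20 : 0 < v2.
Local Notation Q := (walk P f false).
Local Notation sqrt := Num.sqrt.
Local Notation c0 := (sqrt (2 * pi) : R).

Lemma sqrt2pi_ge1 : 1 <= c0.
Proof.
rewrite -[leLHS]sqrtr1 ler_sqrt; last by rewrite mulr_ge0 // pi_ge0.
by have := pi_ge2 R; lra.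
Qed.

Lemma hwin_le_box (psi : T -> R) z a x w : (forall x, `|psi x| <= 1) ->
  `|hwin psi z a x w| <= box z a x w.
Proof.
move=> Hpsi; rewrite /hwin /box; case: ifP => [/andP[h1 h2]|_].
  by rewrite h1 (ltW h2) indT.
by rewrite normr0 ind_ge0.
Qed.

(** By [shift_regular] a window may be replaced by a mixture of its translates over distances up to
    [kap sqrt n]. Gaussian weights of width [q sqrt n], with [q] small against [kap], turn the
    mixture into a Gaussian test function. *)
Lemma smear (a eta th1 : R) : 0 < a -> 0 < eta -> 0 < th1 ->
  exists th, 0 < th <= th1 /\ exists N, forall n, (N <= n)%N ->
  forall (psi : T -> R) z x w, (forall x, `|psi x| <= 1) ->
  `|c0 * Q n (hwin psi z a) x w
    - a * Q n (fun x w => psi x * gauss (th * n%:R) (w - z)) x w| <= eta / sqrt n%:R.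
Proof.
move=> a0 eta0 th10.
have [e [He e0 Hlim]] := erf_exists R.
have [B B0 HB] := gaussd_bound R.
have [C C0 HC] := concentration Pst HH1 HH3.
have c01 := sqrt2pi_ge1.
pose eta' := eta / (8 * (C * (1 + a))).
have Ca0 : 0 < C * (1 + a) by rewrite mulr_gt0 //; lra.
have eta'0 : 0 < eta' by rewrite divr_gt0 // mulr_gt0.
have [K HK] := Hlim _ eta'0.
pose eta1 := eta / (4 * (c0 + 2 * eta')).
have W0 : 0 < c0 + 2 * eta' by lra.
have eta10 : 0 < eta1 by rewrite divr_gt0 // mulr_gt0.
have [kap kap0 [N0 HN0]] := shift_regular Pst HH1 HH3 a0 eta10.
(* The three bounds give, in turn, [th <= th1], a small Gaussian tail beyond the tiles, and a total
   weight close to [c0]. *)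
pose q := Num.min (sqrt th1) (Num.min (eta * kap ^+ 2 / (32 * a)) (kap / (2 * (`|K| + 1)))).
have K0 : 0 < `|K| + 1 by have := normr_ge0 K; lra.
have q0 : 0 < q.
  by rewrite !lt_min sqrtr_gt0 th10 /= !divr_gt0 ?mulr_gt0 ?exprn_gt0.
have q1 : q <= sqrt th1 by rewrite ge_min lexx.
have q2 : 8 * a * q / kap ^+ 2 <= eta / 4.
  have : q <= eta * kap ^+ 2 / (32 * a) by rewrite !ge_min lexx orbT.
  by rewrite ler_pdivlMr ?mulr_gt0 // ler_pdivrMr ?exprn_gt0 // => h; lra.
have q3 : K <= kap / (2 * q).
  have : q <= kap / (2 * (`|K| + 1)) by rewrite !ge_min lexx !orbT.
  rewrite ler_pdivlMr ?mulr_gt0 // => h; rewrite ler_pdivlMr ?mulr_gt0 //.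
  apply: (@le_trans _ _ (`|K| * (2 * q))); last by lra.
  by rewrite ler_wpM2r ?mulr_ge0 ?ler_norm // ltW.
have th0 : 0 < q ^+ 2 by rewrite exprn_gt0.
exists (q ^+ 2); split.
  rewrite th0 /= -[leRHS]sqr_sqrtr ?(ltW th10) // lerXn2r // nnegrE ?sqrtr_ge0 // ltW //.
have [N1 HN1] := sqrt_large (2 * a / kap + 8 * (a ^+ 2 * B) / (q ^+ 2 * eta)).
exists (maxn N0 N1) => n; rewrite geq_max => /andP[nN0 /HN1[n0 hs]] psi z x w Hpsi.
have n0' : 0 < n%:R :> R by rewrite ltr0n.
have s0 : 0 < sqrt n%:R :> R by rewrite sqrtr_gt0.
set s := sqrt n%:R in hs s0 *.
have nE : n%:R = s * s by rewrite /s -expr2 sqr_sqrtr // ltW.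
have b1 : 0 <= 2 * a / kap by rewrite divr_ge0 ?mulr_ge0 ?(ltW a0) ?(ltW kap0).
have b2 : 0 <= 8 * (a ^+ 2 * B) / (q ^+ 2 * eta).
  by rewrite divr_ge0 ?mulr_ge0 ?exprn_ge0 ?(ltW q0) ?(ltW a0) ?(ltW B0) ?(ltW eta0).
pose t := q ^+ 2 * n%:R.
have t0 : 0 < t by rewrite mulr_gt0.
have st : sqrt t = q * s.
  by rewrite /t sqrtrM ?(ltW th0) // sqrtr_sqr gtr0_norm.
have ks0 : 0 <= kap * s / a by rewrite divr_ge0 ?mulr_ge0 ?(ltW a0) ?(ltW kap0) ?(ltW s0).
have /andP[M1 M2] := Num.Theory.truncn_itv ks0.
(* The tiles extend as far as [shift_regular] permits, about [kap sqrt n] on each side. *)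
set M := Num.truncn _ in M1 M2.
have Mup : M%:R * a <= kap * s by rewrite -ler_pdivlMr.
have ks2 : 2 * a <= kap * s.
  have : 2 * a / kap <= s by lra.
  by rewrite ler_pdivrMr // [s * kap]mulrC.
have Mlo : kap * s / 2 <= M%:R * a.
  by move: M2; rewrite ltr_pdivrMr // -natr1 mulrDl mul1r; lra.
have Ma0 : 0 < M%:R * a by apply: lt_le_trans Mlo; lra.
have M0 : (0 < M)%N by move: Ma0; rewrite pmulr_lgt0 // ltr0n.
pose W := \sum_(k < M + M) tile_wt e a t M k.
have WE : `|W - c0| <= 2 * eta'.
  rewrite /W tile_wt_sum //.
  have h : K <= M%:R * a / sqrt t.
    apply: le_trans q3 _; rewrite st ler_pdivlMr ?mulr_gt0 //.
    have -> : kap / (2 * q) * (q * s) = kap * s / 2 by field; rewrite gt_eqF.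
    exact: Mlo.
  have := HK _ h; set E := e _ => h'.
  have -> : 2 * E - c0 = 2 * (E - c0 / 2) by field.
  by rewrite normrM ger0_norm // ler_pM2l.
have Wpos : 0 <= W by apply: sumr_ge0 => k _; exact: tile_wt_ge0.
have Wle : W <= c0 + 2 * eta' by move: WE; rewrite ler_norml => /andP[_ ?]; lra.
set h := Q n (hwin psi z a) x w.
have hC : `|h| <= C * (1 + a) / s.
  apply: le_trans (HC n n0 z a x w (ltW a0)); apply: (walk_norm_le f Pst) => x' w'.
  exact: hwin_le_box.
have E1 : `|c0 * h - W * h| <= eta / 4 / s.
  rewrite -mulrBl normrM distrC; apply: (@le_trans _ _ ((2 * eta') * (C * (1 + a) / s))).
    by apply: ler_pM.
  by rewrite le_eqVlt; apply/orP; left; apply/eqP; rewrite /eta'; field; rewrite !gt_eqF //; lra.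
have E2 : `|W * h - Q n (tiles e a t M psi z) x w| <= eta / 4 / s.
  rewrite /tiles walk_sum /W mulr_suml -sumrB.
  apply: le_trans (ler_norm_sum _ _ _) _.
  apply: (@le_trans _ _ (\sum_(k < M + M) tile_wt e a t M k * (eta1 / s))).
    apply: ler_sum => k _; rewrite walkZ -mulrBr normrM ger0_norm ?tile_wt_ge0 //.
    rewrite ler_wpM2l ?tile_wt_ge0 // distrC.
    have -> : Q n (hwin psi (z + tile_pt a M k) a) x w = Q n (hwin psi z a) x (w + - tile_pt a M k).
      rewrite -walk_shift; apply: walk_ext => x' w'; rewrite /hwin.
      by rewrite lerBrDr ltrBlDr addrAC.
    apply: HN0 => //; rewrite normrN; apply: le_trans Mup.
    rewrite /tile_pt normrM (gtr0_norm a0) ler_pM2r //.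
    have := ltn_ord k; rewrite -(ltr_nat R) natrD => kM.
    rewrite ler_norml; have : 0 <= k%:R :> R by rewrite ler0n.
    by move=> ?; apply/andP; split; lra.
  rewrite -mulr_suml -/W; apply: (@le_trans _ _ ((c0 + 2 * eta') * (eta1 / s))).
    by rewrite ler_wpM2r // divr_ge0 // ltW.
  by rewrite le_eqVlt; apply/orP; left; apply/eqP; rewrite /eta1; field; rewrite !gt_eqF.
have E3 : `|Q n (tiles e a t M psi z) x w - a * Q n (fun x w => psi x * gauss t (w - z)) x w|
    <= eta / 4 / s + eta / 4 / s.
  rewrite -walkZ -walkBf; apply: (walk_bound f Pst) => x' w'.
  apply: le_trans (tiles_gauss He a0 t0 z x' w' M0 Hpsi HB) _; apply: lerD.
    have -> : 2 * (a ^+ 2 * (B / t)) = (2 * (a ^+ 2 * B) / q ^+ 2 / s) / s.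
      by rewrite /t nE; field; rewrite !gt_eqF.
    rewrite ler_wpM2r ?invr_ge0 ?(ltW s0) // ler_pdivrMr //.
    have : 8 * (a ^+ 2 * B) / (q ^+ 2 * eta) <= s by lra.
    rewrite ler_pdivrMr ?mulr_gt0 // ler_pdivrMr //.
    lra.
  rewrite st; apply: (@le_trans _ _ (a * (2 * (q * s) / (kap * s / 2) ^+ 2))).
    rewrite ler_wpM2l ?(ltW a0) // ler_wpM2l //; first by rewrite !mulr_ge0 // ltW.
    rewrite lef_pV2 ?posrE ?exprn_gt0 //; last by rewrite divr_gt0 // mulr_gt0.
    by rewrite lerXn2r // nnegrE ?(ltW Ma0) // divr_ge0 // mulr_ge0 // ltW.
  have -> : a * (2 * (q * s) / (kap * s / 2) ^+ 2) = 8 * a * q / kap ^+ 2 / s.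
    by field; rewrite !gt_eqF.
  by rewrite ler_wpM2r // invr_ge0 ltW.
rewrite -/t; set A := Q n (tiles _ _ _ _ _ _) x w in E2 E3; set D := a * _ in E3 *.
have -> : c0 * h - D = (c0 * h - W * h) + (W * h - A) + (A - D) by ring.
apply: le_trans (ler_normD _ _) _; apply: le_trans (lerD (ler_normD _ _) (lexx _)) _.
have -> : eta / s = eta / 4 / s + eta / 4 / s + (eta / 4 / s + eta / 4 / s) by field; rewrite gt_eqF.
by apply: lerD => //; apply: lerD.
Qed.

Lemma win_hwin (psi : T -> R) z a x w : (forall x, `|psi x| <= 1) -> 0 < a ->
  `|win psi z a x w - hwin psi z a x w| <= box (z + a) 0 x w.
Proof.
move=> Hpsi a0; rewrite /win /hwin /box addr0.
case: (boolP (z <= w <= z + a)) => [/andP[h1 h2]|h].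
  rewrite h1 /=; case: ltP => h3; first by rewrite subrr normr0 ind_ge0.
  by rewrite subr0 h2 indT.
case: (boolP (z <= w < z + a)) => [/andP[h1 h2]|h']; last by rewrite subrr normr0 ind_ge0.
by move: h; rewrite h1 (ltW h2).
Qed.

(** [smear] passes to a Gaussian of variance [th n], [smooth_llt] treats that one, and a small [th]
    is then dropped from the variance. The closed window differs from the half-open one in a single
    point, covered by [small_box]. *)
Theorem llt (a eta : R) : 0 < a -> 0 < eta -> exists N, forall n, (N <= n)%N ->
  forall (psi : T -> R) z x w, (forall x, `|psi x| <= 1) ->
  `|Q n (win psi z a) x w - a * nuE nu psi * (gauss (n%:R * v2) (w - z) / c0)| <= eta / sqrt n%:R.
Proof.
move=> a0 eta0.
have [B B0 HB] := gaussd_bound R.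
have c01 := sqrt2pi_ge1.
have c00 : 0 < c0 by lra.
have sv : 0 < sqrt v2 by rewrite sqrtr_gt0.
(* Chosen so that changing the variance from [n (th + v2)] to [n v2] by [gauss_time] costs a quarter
   of the allowed error. *)
pose th1 := eta / 4 * sqrt v2 ^+ 3 / (a * B).
have th10 : 0 < th1 by rewrite divr_gt0 ?mulr_gt0 ?exprn_gt0 // divr_gt0.
have e4 : 0 < eta / 4 by rewrite divr_gt0.
have [th [/andP[th0 thle] [N1 HN1]]] := smear a0 e4 th10.
have ea : 0 < eta / 4 / a by rewrite divr_gt0.
have [N2 HN2] := smooth_llt Pst nuP HH1 Hr Hrho v20 th0 ea.
have [rh rh0 [N3 HN3]] := small_box Pst HH1 HH3 e4.
have [N4 HN4] := sqrt_large (0 : R).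
exists (maxn N1 (maxn N2 (maxn N3 N4))) => n; rewrite !geq_max => /and4P[n1 n2 n3 /HN4[n0 _]] psi z x w Hpsi.
have n0' : 0 < n%:R :> R by rewrite ltr0n.
have s0 : 0 < sqrt n%:R :> R by rewrite sqrtr_gt0.
have h1 := HN1 n n1 psi z x w Hpsi.
have h2 := HN2 n n2 psi z x w Hpsi.
have h3 := HN3 n n3 (z + a) x w.
set s := sqrt n%:R in s0 h1 h2 h3 *.
have nE : n%:R = s * s by rewrite /s -expr2 sqr_sqrtr // ltW.
have nu1 : `|nuE nu psi| <= 1.
  have := @nuE_normB R T P nu nuP 0 psi 1; rewrite sub0r normrN; apply => y.
  by rewrite sub0r normrN.
have h4 : `|gauss (n%:R * (th + v2)) (w - z) - gauss (n%:R * v2) (w - z)| <= eta / 4 / a / s.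
  have -> : n%:R * (th + v2) = n%:R * v2 + n%:R * th by ring.
  apply: le_trans (gauss_time (w - z) B0 HB _ _) _; rewrite ?mulr_gt0 ?mulr_ge0 ?(ltW n0') ?(ltW th0) //.
  have -> : sqrt (n%:R * v2) = s * sqrt v2 by rewrite sqrtrM // ltW.
  have -> : B / (s * sqrt v2) ^+ 3 * (n%:R * th) = B * th / sqrt v2 ^+ 3 / s.
    by rewrite nE; field; rewrite !gt_eqF.
  rewrite ler_wpM2r ?invr_ge0 ?(ltW s0) // ler_pdivrMr ?exprn_gt0 // [leRHS]mulrAC ler_pdivlMr //.
  by move: thle; rewrite /th1 ler_pdivlMr ?mulr_gt0 //; lra.
have h5 : `|Q n (win psi z a) x w - Q n (hwin psi z a) x w| <= eta / 4 / s.
  rewrite -walkBf; apply: le_trans h3; apply: (walk_norm_le f Pst) => x' w'.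
  apply: le_trans (win_hwin z x' w' Hpsi a0) _; rewrite /box.
  case: (boolP (z + a <= w' <= z + a + 0)) => [/andP[i1 i2]|_]; last by rewrite indF ind_ge0.
  have -> : z + a <= w' <= z + a + rh by apply/andP; split; lra.
  by [].
set A := Q n (win _ _ _) x w in h5 *; set H := Q n (hwin _ _ _) x w in h1 h5.
set D := Q n _ x w in h1 h2; set g1 := gauss _ _ in h2 h4; set g2 := gauss _ _ in h4 *.
set m := nuE nu psi in h2 nu1 *.
have -> : A - a * m * (g2 / c0) = (A - H) + (c0 * H - a * D + a * (D - m * g1) + a * m * (g1 - g2)) / c0.
  by field; rewrite gt_eqF.
apply: le_trans (ler_normD _ _) _.
have k1 : `|a * (D - m * g1)| <= eta / 4 / s.
  rewrite normrM gtr0_norm // mulrC -ler_pdivlMr //; apply: le_trans h2 _.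
  by rewrite mulrAC.
have k2 : `|a * m * (g1 - g2)| <= eta / 4 / s.
  rewrite -mulrA normrM gtr0_norm // mulrC -ler_pdivlMr // normrM -[leRHS]mul1r.
  by apply: ler_pM => //; apply: le_trans h4 _; rewrite mulrAC.
have k3 : `|(c0 * H - a * D + a * (D - m * g1) + a * m * (g1 - g2)) / c0| <= eta / 4 / s + eta / 4 / s + eta / 4 / s.
  rewrite normrM [X in _ * X]gtr0_norm ?invr_gt0 // ler_pdivrMr //.
  apply: le_trans (ler_normD _ _) _; apply: le_trans (lerD (ler_normD _ _) (lexx _)) _.
  apply: (@le_trans _ _ (eta / 4 / s + eta / 4 / s + eta / 4 / s)).
    by apply: lerD => //; apply: lerD.
  rewrite -[leLHS]mulr1 ler_wpM2l //.
  by rewrite !addr_ge0 // !divr_ge0 // ltW.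
have -> : eta / s = eta / 4 / s + (eta / 4 / s + eta / 4 / s + eta / 4 / s) by field; rewrite gt_eqF.
exact: lerD.
Qed.

End LocalLimit2.

(** * Survival probability and harmonic function *)

Section Killed.
Variables (R : realType) (T : finType) (P : T -> T -> R) (f r rho : T -> R) (v2 F : R).
Hypothesis Pst : stochastic P.
Hypothesis HH1 : H1 P.
Hypothesis HH3 : H3 P f.
Hypothesis Hr : forall x, \sum_x' P x x' * (f x' + r x') = r x.
Hypothesis Hrho : forall x, \sum_x' P x x' * (f x' + r x' - r x) ^+ 2 + \sum_x' P x x' * rho x'
                = v2 + rho x.
Hypothesis v20 : 0 < v2.
Hypothesis F0 : 0 < F.
Hypothesis HF : forall x, `|f x| <= F.
Local Notation Q := (walk P f false).
Local Notation K := (walk P f true).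
Local Notation survp := (survp P f).
Local Notation sqrt := Num.sqrt.
Local Notation corr := (corr r rho).
Local Notation c0 := (sqrt (2 * pi) : R).

Definition yp (y : R) : R := 1 + Num.max y 0.

Lemma yp_ge1 y : 1 <= yp y.
Proof. by rewrite /yp lerDl le_max lexx orbT. Qed.

Lemma yp_gt0 y : 0 < yp y.
Proof. exact: lt_le_trans (yp_ge1 y). Qed.

Lemma yp_abs (y : R) : - F <= y -> `|y| <= (1 + F) * yp y.
Proof.
have F0' := F0; move=> hy; have y1 := yp_ge1 y; have yy : y <= yp y.
  by rewrite /yp; have : y <= Num.max y 0 by [rewrite le_max lexx]; lra.
have Fy : F <= F * yp y by rewrite ler_peMr // ltW.
rewrite mulrDl mul1r ler_norml; apply/andP; split; lra.
Qed.

Lemma dom_pos (w : R) : (true ==> (0 < w)) -> - F <= w.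
Proof. by move=> /= h; apply: le_trans (ltW h); rewrite oppr_le0 ltW. Qed.

(** From [w >= - F] a step of size at most [F] dies inside [[- 2F, 0]], so only values of [u] there
    are lost, with the probability of dying. *)
Lemma kill_diff u (M : R) x (w : R) : - F <= w -> 0 <= M ->
  (forall x' (w' : R), - (2 * F) <= w' <= 0 -> `|u x' w'| <= M) ->
  `|step P f true u x w - step P f false u x w| <= M * (1 - survp 1 x w).
Proof.
move=> hw M0 Hu.
have -> : M * (1 - survp 1 x w) = \sum_x' P x x' * (if w + f x' <= 0 then M else 0).
  rewrite /survp /= /step /=.
  have {1}-> : 1 = \sum_x' P x x' by case: Pst.
  rewrite -sumrB mulr_sumr; apply: eq_bigr => x' _; case: ifP => _; ring.
rewrite /step -sumrB; apply: le_trans (ler_norm_sum _ _ _) _; apply: ler_sum => x' _.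
rewrite -mulrBr normrM ger0_norm; last by case: Pst.
rewrite ler_wpM2l //=; first by case: Pst.
case: ifP => h; last by rewrite subrr normr0.
rewrite sub0r normrN; apply: Hu; rewrite h andbT.
by have := HF x'; rewrite ler_norml => /andP[? _]; lra.
Qed.

(** The part [be] is charged only on death, and the probabilities of dying at successive times add
    up to [1 - survp n]: it is paid at most once, while [al] is paid at every step. *)
Lemma killed_error (A : nat -> T -> R -> R) (al be : R) : 0 <= al ->
  (forall j x (w : R), - F <= w -> `|step P f true (A j) x w - A j.+1 x w| <= al + be * (1 - survp 1 x w)) ->
  forall n x (w : R), - F <= w -> `|K n (A 0%N) x w - A n x w| <= n%:R * al + be * (1 - survp n x w).
Proof.
move=> al0 H; elim=> [|n IH] x w hw.
  by rewrite subrr normr0 mul0r add0r /survp /= subrr mulr0.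
have h1 := H n x w hw.
have h2 : `|K 1 (K n (A 0%N)) x w - K 1 (A n) x w| <= K 1 (fun x w => n%:R * al + be * (1 - survp n x w)) x w.
  rewrite -walkBf; apply: (@walk_norm_le_on _ _ _ _ Pst (fun w => - F <= w) true 1) => // w' hw'.
  exact: dom_pos.
have E : K 1 (fun x w => n%:R * al + be * (1 - survp n x w)) x w =
   (n%:R * al + be) * survp 1 x w - be * survp n.+1 x w.
  have -> : survp n.+1 x w = K 1 (survp n) x w by [].
  rewrite -mulNr {2}/survp -walk_lin; apply: walk_ext => x' w'; ring.
rewrite E in h2.
have s1 := survp_le1 f Pst 1 x w; have s0 := survp_ge0 f Pst 1 x w.
have na : 0 <= n%:R * al by rewrite mulr_ge0.
have nas : n%:R * al * survp 1 x w <= n%:R * al by rewrite ler_piMr.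
rewrite walkS; change (step P f true (K n (A 0%N)) x w) with (K 1 (K n (A 0%N)) x w).
change (step P f true (A n) x w) with (K 1 (A n) x w) in h1.
set a := K 1 (K n (A 0%N)) x w in h2 *; set b := K 1 (A n) x w in h1 h2.
have -> : a - A n.+1 x w = (a - b) + (b - A n.+1 x w) by ring.
apply: le_trans (ler_normD _ _) _; rewrite -natr1; lra.
Qed.

Lemma odd_bound : exists2 C : R, 0 < C & forall G s B, heat G s B -> 0 <= B ->
  (forall t : R, 0 < t -> G 0%N t 0 = 0) -> forall (t : R) x w, 1 <= t ->
  `|corr G t x w| <= (C + `|w|) * (B / sqrt t ^+ (1 + s)).
Proof.
have [X X0 HX] := fin_ub r; have [Y Y0 HY] := fin_ub rho.
exists (X + Y); first by rewrite addr_gt0.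
move=> G s B HG B0 Godd t x w t1; have t0 : 0 < t by lra.
set M := B / _.
have M0 : 0 <= M by rewrite divr_ge0 // exprn_ge0 // sqrtr_ge0.
apply: le_trans (ler_normD _ _) _.
have h1 : `|G 0%N t (w + r x)| <= (`|w| + X) * M.
  have := mean_value_dist (g := G 0%N t) (g' := G 1%N t) (h := 0) (xi := w + r x) (M := M).
  rewrite Godd // add0r subr0 => H; apply: le_trans (H _ _) _.
  - by move=> c; apply: (heat_dw HG).
  - by move=> c _; exact: (heat_bd HG).
  rewrite mulrC ler_wpM2r //; apply: le_trans (ler_normD _ _) _; exact: lerD.
have h2 : `|rho x / 2 * G 2%N t (w + r x)| <= Y * M.
  rewrite normrM; apply: ler_pM => //.
    rewrite normrM (ger0_norm (ltac:(by rewrite invr_ge0) : 0 <= (2 : R)^-1)).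
    have := HY x; have := normr_ge0 (rho x); lra.
  by apply: le_trans (heat_bd HG _ _ t0) _ => //; exact: sqrt_powS_le.
lra.
Qed.

(** A heat function vanishing at 0 is small where the walk dies ([odd_bound]), so killing
    contributes one boundary term against [n] Lindeberg errors. *)
Lemma killed_corr : exists2 C : R, 0 < C & forall G s B, heat G s B -> 0 <= B ->
  (forall t : R, 0 < t -> G 0%N t 0 = 0) -> forall (t : R) n x (w : R), 1 <= t -> - F <= w ->
  `|K n (corr G t) x w - corr G (t + n%:R * v2) x w| <=
    C * (B * (n%:R / sqrt t ^+ (3 + s) + 1 / sqrt t ^+ (1 + s))).
Proof.
have [C1 C10 HC1] := lindeberg_step Pst Hr Hrho v20.
have F0' := F0; have [C2 C20 HC2] := odd_bound.
exists (C1 + (C2 + 2 * F)); first by rewrite !addr_gt0 // mulr_gt0.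
move=> G s B HG B0 Godd t n x w t1 hw; have t0 : 0 < t by lra.
set M3 := B / sqrt t ^+ (3 + s); set M1 := B / sqrt t ^+ (1 + s).
have M30 : 0 <= M3 by rewrite divr_ge0 // exprn_ge0 // sqrtr_ge0.
have M10 : 0 <= M1 by rewrite divr_ge0 // exprn_ge0 // sqrtr_ge0.
have al0 : 0 <= C1 * M3 by rewrite mulr_ge0 // ltW.
have be0 : 0 <= (C2 + 2 * F) * M1 by rewrite mulr_ge0 //; lra.
have step j x' (w' : R) : - F <= w' -> `|step P f true (corr G (t + j%:R * v2)) x' w' - corr G (t + j.+1%:R * v2) x' w'|
    <= C1 * M3 + (C2 + 2 * F) * M1 * (1 - survp 1 x' w').
  move=> hw'.
  have tj : t <= t + j%:R * v2 by rewrite lerDl mulr_ge0 // ltW.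
  have tj1 := le_trans t1 tj.
  have h1 := HC1 G s B HG B0 (t + j%:R * v2) x' w' tj1.
  have h2 : `|step P f true (corr G (t + j%:R * v2)) x' w' - step P f false (corr G (t + j%:R * v2)) x' w'|
      <= (C2 + 2 * F) * M1 * (1 - survp 1 x' w').
    apply: kill_diff => // y v /andP[v1 v2'].
    apply: le_trans (HC2 _ _ _ HG B0 Godd _ _ _ tj1) _.
    apply: ler_pM; rewrite ?addr_ge0 ?(ltW C20) ?divr_ge0 ?exprn_ge0 ?sqrtr_ge0 //.
      by rewrite lerD2l ler_norml; lra.
    exact: sqrt_pow_le.
  have -> : t + j.+1%:R * v2 = t + j%:R * v2 + v2 by rewrite -natr1; ring.
  set a := step _ _ _ _ _ _ in h2 *; set b := step _ _ _ _ _ _ in h1 h2; set c := corr _ _ _ _ in h1 *.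
  have -> : a - c = (a - b) + (b - c) by ring.
  apply: le_trans (ler_normD _ _) _; rewrite addrC; apply: lerD => //.
  apply: le_trans h1 _; rewrite ler_wpM2l ?(ltW C10) //; exact: sqrt_pow_le.
have := killed_error al0 step n x hw.
rewrite mul0r addr0 => h; apply: le_trans h _.
have s0 := survp_ge0 f Pst n x w.
have : (C2 + 2 * F) * M1 * (1 - survp n x w) <= (C2 + 2 * F) * M1 by rewrite ler_piMr //; lra.
have -> : B * (n%:R / sqrt t ^+ (3 + s) + 1 / sqrt t ^+ (1 + s)) = n%:R * M3 + M1.
  by rewrite /M1 /M3; ring.
have p1 : 0 <= (C2 + 2 * F) * (n%:R * M3) by rewrite !mulr_ge0 //; lra.
have p2 : 0 <= C1 * M1 by rewrite mulr_ge0 // ltW.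
lra.
Qed.

(** Survival is used over the first half of the time, concentration of the free walk over the
    second. *)
Lemma survp_box : exists2 C : R, 0 < C & forall n x (w D z : R), (0 < n)%N -> 0 <= D -> - F <= w ->
  K n (box z D) x w <= C * (1 + D) / sqrt n%:R * survp n./2 x w.
Proof.
have [C C0 HC] := concentration Pst HH1 HH3.
exists (2 * C); first by rewrite mulr_gt0.
move=> n x w D z n0 D0 hw.
have n20 : (0 < n - n./2)%N by rewrite subn_gt0; lia.
have nE : n = (n./2 + (n - n./2))%N by lia.
rewrite {1}nE walkD.
rewrite /survp -walkZ; apply: (@walk_le_on _ _ _ _ Pst (fun w => - F <= w)) => //; first exact: dom_pos.
move=> x' w' _; rewrite mulr1.
apply: le_trans (walk_kill_le f Pst _ _ _ _) _; first by move=> *; exact: box_ge0.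
apply: le_trans (HC _ n20 _ _ _ _ D0) _.
have p : 0 <= C * (1 + D) by rewrite mulr_ge0 ?addr_ge0 // ltW.
have -> : 2 * C * (1 + D) / sqrt n%:R = C * (1 + D) * (2 / sqrt n%:R) by ring.
rewrite ler_wpM2l // -[leLHS]mul1r ler_pdivrMr ?sqrtr_gt0 ?ltr0n // mulrAC ler_pdivlMr ?sqrtr_gt0 ?ltr0n // mul1r.
have -> : 2 = sqrt 4 :> R by rewrite (_ : 4 = 2 ^+ 2); [rewrite sqrtr_sqr ger0_norm|ring].
rewrite -sqrtrM // ler_sqrt ?mulr_ge0 // -natrM ler_nat; lia.
Qed.

End Killed.

Lemma half_ltn n : (0 < n)%N -> (n./2 < n)%N. Proof. lia. Qed.

Lemma leq_double_half n : (n.+1 <= 2 * n./2.+1)%N. Proof. lia. Qed.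

Lemma leq_succ4 n : (0 < n)%N -> (n.+1 <= 4 * n)%N. Proof. lia. Qed.

Section Killed2.
Variables (R : realType) (T : finType) (P : T -> T -> R) (f r rho : T -> R) (v2 F : R).
Hypothesis Pst : stochastic P.
Hypothesis HH1 : H1 P.
Hypothesis HH3 : H3 P f.
Hypothesis Hr : forall x, \sum_x' P x x' * (f x' + r x') = r x.
Hypothesis Hrho : forall x, \sum_x' P x x' * (f x' + r x' - r x) ^+ 2 + \sum_x' P x x' * rho x'
                = v2 + rho x.
Hypothesis v20 : 0 < v2.
Hypothesis F0 : 0 < F.
Hypothesis HF : forall x, `|f x| <= F.
Local Notation Q := (walk P f false).
Local Notation K := (walk P f true).
Local Notation survp := (survp P f).
Local Notation sqrt := Num.sqrt.
Local Notation corr := (corr r rho).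
Local Notation c0 := (sqrt (2 * pi) : R).

Lemma walk_le_pos n u v : (0 < n)%N -> (forall x (w : R), 0 < w -> u x w <= v x w) ->
  forall x w, K n u x w <= K n v x w.
Proof.
case: n => // n _ uv x w; rewrite !walkS.
apply: (@step_le_on _ _ _ f Pst (fun w => 0 < w)) => // x' w' w'0.
exact: (@walk_le_on _ _ _ f Pst (fun w => 0 < w)).
Qed.

Lemma erf_lb (e : R -> R) : (forall u, drv e u (expR (- (u ^+ 2 / 2)))) ->
  forall u v, u <= v -> e u <= e v.
Proof. by move=> He u v uv; apply: (drv_mono uv He) => c; exact: expR_ge0. Qed.

(** Bootstrap from [n./2] to [n]. A survivor either lies below [K1 q sqrt n], with probability at
    most half of [survp n./2] by [survp_box], or sits where the odd error function is at least [e1];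
    the killed expectation of that function is [O(yp y / sqrt n)]. *)
Lemma survival : exists2 C : R, 0 < C & forall n x (y : R), - F <= y ->
  survp n x y <= C * yp y / sqrt n.+1%:R.
Proof.
have F0' := F0; have v20' := v20.
have [e [He e0 Hlim]] := erf_exists R.
have c01 := sqrt2pi_ge1 R.
have [B B0 HG] := heat_erf He.
have Godd (t : R) : 0 < t -> erfh e 0 t 0 = 0 by move=> _; rewrite /erfh mul0r.
have [K1' HK1'] := Hlim (c0 / 4) ltac:(lra).
pose K1 := Num.max K1' 1.
have K10 : 0 < K1 by rewrite lt_max ltr01 orbT.
pose e1 := e K1.
have e10 : 0 < e1.
  have := HK1' K1 ltac:(by rewrite le_max lexx); rewrite ler_norml => /andP[h _].
  by rewrite /e1; lra.
have [C1 C10 HC1] := survp_box Pst HH1 HH3 v20 F0.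
have [C2 C20 HC2] := killed_corr Pst Hr Hrho v20 F0 HF.
have [C3 C30 HC3] := odd_bound r rho.
have [C4 C40 HC4] := corr_close r rho.
(* Gives [C1 K1 q = 1/8], so that the strip takes at most half of [survp n./2] once
   [sqrt n >= 4 C1]. *)
pose q := 1 / (8 * C1 * K1).
have q0 : 0 < q by rewrite divr_gt0 // !mulr_gt0.
pose D := (C3 + 1 + F) * B / q + C2 * B * (1 / q ^+ 3 + 1 / q).
have D0 : 0 < D.
  by rewrite /D; pos.
pose A := (D + C4 * B / q) / e1.
have A0 : 0 < A by rewrite divr_gt0 // addr_gt0 // divr_gt0 // mulr_gt0.
have [N HN] := sqrt_large (4 * C1 + 1 / q).
have rec n x (y : R) : (N <= n)%N -> - F <= y ->
    survp n x y <= survp n./2 x y / 2 + A * yp y / sqrt n%:R.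
  move=> /HN[n0 hs] hy.
  have n0' : 0 < n%:R :> R by rewrite ltr0n.
  have s0 : 0 < sqrt n%:R :> R by rewrite sqrtr_gt0.
  have hC1 := HC1 n x y; set s := sqrt n%:R in hs s0 hC1 *.
  have nE : n%:R = s * s by rewrite /s -expr2 sqr_sqrtr // ltW.
  have q1 : 0 <= 1 / q by rewrite divr_ge0 // ltW.
  pose t := q ^+ 2 * n%:R.
  have t0 : 0 < t by rewrite mulr_gt0 // exprn_gt0.
  have st : sqrt t = q * s by rewrite /t sqrtrM ?exprn_ge0 ?(ltW q0) // sqrtr_sqr gtr0_norm.
  have qs1 : 1 <= q * s.
    have : 1 / q <= s by lra.
    by rewrite ler_pdivrMr // [s * q]mulrC.
  have qs0 : 0 < q * s by rewrite mulr_gt0.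
  have t1 : 1 <= t.
    have -> : t = (q * s) ^+ 2 by rewrite /t nE; ring.
    by rewrite expr_ge1 // ltW.
  have y1 := yp_ge1 y.
  have KD : 0 <= K1 * (q * s) by rewrite mulr_ge0 // ltW.
  have pt x' (w : R) : 0 < w -> 1 <= box 0 (K1 * (q * s)) x' w +
      e1^-1 * (corr (erfh e) t x' w + C4 * B / (q * s)).
    move=> w0.
    have := HC4 _ _ _ HG (ltW B0) t x' w t1; rewrite addn0 expr1 st ler_norml mulrA => /andP[h _].
    have -> : box 0 (K1 * (q * s)) x' w = ind (w <= K1 * (q * s)) :> R.
      by rewrite /box add0r (ltW w0).
    case: (lerP w (K1 * (q * s))) => h1.
      rewrite indT lerDl mulr_ge0 ?invr_ge0 ?(ltW e10) //.
      have : 0 <= erfh e 0 t w.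
        by rewrite /erfh -e0; apply: erf_lb => //; rewrite divr_ge0 ?sqrtr_ge0 // ltW.
      lra.
    rewrite indF add0r mulrC ler_pdivlMr // mul1r.
    have : e1 <= erfh e 0 t w.
      by rewrite /erfh /e1; apply: erf_lb => //; rewrite st ler_pdivlMr // ltW.
    lra.
  have h1 : survp n x y <= K n (box 0 (K1 * (q * s))) x y +
      e1^-1 * (K n (corr (erfh e) t) x y + C4 * B / (q * s) * survp n x y).
    rewrite /survp -walkZ -walkDf -walkZ -walkDf; apply: walk_le_pos => // x' w w0.
    by rewrite mulr1; exact: pt.
  have h2 : K n (box 0 (K1 * (q * s))) x y <= survp n./2 x y / 2.
    apply: le_trans (hC1 _ 0 n0 KD hy) _; rewrite mulrC ler_wpM2l ?survp_ge0 //.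
    rewrite ler_pdivrMr //.
    have -> : C1 * (1 + K1 * (q * s)) = C1 + s / 8 by rewrite /q; field; rewrite !gt_eqF.
    lra.
  have h3 : K n (corr (erfh e) t) x y <= D * yp y / s.
    have k1 := HC2 _ _ _ HG (ltW B0) Godd t n x y t1 hy.
    have k2 := HC3 _ _ _ HG (ltW B0) Godd (t + n%:R * v2) x y ltac:(by rewrite (le_trans t1) // lerDl mulr_ge0 // ltW).
    have k3 : (C3 + `|y|) * (B / sqrt (t + n%:R * v2) ^+ (1 + 0)) <= (C3 + 1 + F) * B / q / s * yp y.
      have -> : (C3 + 1 + F) * B / q / s * yp y = ((C3 + 1 + F) * yp y) * (B / (q * s)).
        by field; rewrite !gt_eqF.
      apply: ler_pM; rewrite ?addr_ge0 ?(ltW C30) ?divr_ge0 ?exprn_ge0 ?sqrtr_ge0 ?(ltW B0) //.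
        have := yp_abs F0 hy; have : C3 <= C3 * yp y by rewrite ler_peMr // ltW.
        lra.
      rewrite addn0 expr1 -st; apply: (@sqrt_pow_le _ _ _ _ 1) => //; first exact: ltW.
      by rewrite lerDl mulr_ge0 // ltW.
    have k4 : C2 * (B * (n%:R / sqrt t ^+ (3 + 0) + 1 / sqrt t ^+ (1 + 0))) <= C2 * B * (1 / q ^+ 3 + 1 / q) / s * yp y.
      have -> : C2 * (B * (n%:R / sqrt t ^+ (3 + 0) + 1 / sqrt t ^+ (1 + 0))) = C2 * B * (1 / q ^+ 3 + 1 / q) / s.
        by rewrite st nE !addn0; field; rewrite !gt_eqF.
      rewrite ler_peMr // divr_ge0 ?(ltW s0) // !mulr_ge0 ?(ltW C20) ?(ltW B0) //.
      by rewrite addr_ge0 // divr_ge0 // ?exprn_ge0 // ltW.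
    have -> : D * yp y / s = (C3 + 1 + F) * B / q / s * yp y + C2 * B * (1 / q ^+ 3 + 1 / q) / s * yp y.
      by rewrite /D; ring.
    move: k1 k2; rewrite !ler_norml => /andP[_ k1] /andP[_ k2]; lra.
  have h4 : C4 * B / (q * s) * survp n x y <= C4 * B / q * yp y / s.
    have -> : C4 * B / q * yp y / s = C4 * B / (q * s) * yp y by field; rewrite !gt_eqF.
    apply: ler_wpM2l; first by pos.
    exact: le_trans (survp_le1 f Pst n x y) y1.
  apply: le_trans h1 _; apply: lerD => //.
  have -> : A * yp y / s = e1^-1 * (D * yp y / s + C4 * B / q * yp y / s).
    by rewrite /A; field; rewrite !gt_eqF.
  by rewrite ler_wpM2l ?invr_ge0 ?(ltW e10) //; apply: lerD.
exists (sqrt N.+1%:R + 8 * A); first by rewrite addr_gt0 ?sqrtr_gt0 ?ltr0n // mulr_gt0.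
move=> n x y hy; have y1 := yp_ge1 y.
have sN : 0 < sqrt N.+1%:R :> R by rewrite sqrtr_gt0 ltr0n.
set Cs := sqrt N.+1%:R + 8 * A.
elim/ltn_ind: n => n IH.
have s0 : 0 < sqrt n.+1%:R :> R by rewrite sqrtr_gt0 ltr0n.
case: (leqP N n) => nN; last first.
  rewrite ler_pdivlMr //; apply: (@le_trans _ _ (1 * sqrt n.+1%:R)).
    by rewrite ler_wpM2r ?(ltW s0) // survp_le1.
  rewrite mul1r; apply: (@le_trans _ _ (Cs * 1)); last by rewrite ler_wpM2l // /Cs; lra.
  rewrite mulr1 /Cs; have : sqrt n.+1%:R <= sqrt N.+1%:R :> R by rewrite ler_sqrt ?ler0n // ler_nat ltnW.
  lra.
have [n0 _] := HN n nN.
have := rec n x y nN hy; have := IH n./2 (half_ltn n0).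
set p := survp n./2 x y => h1 h2; apply: le_trans h2 _.
have h0 : 0 < sqrt n./2.+1%:R :> R by rewrite sqrtr_gt0 ltr0n.
(* Halving the time costs a factor at most 3/2 and the recursion gains 1/2, so the induction
   contracts by 3/4. The remaining quarter of [Cs] absorbs the source term, as [Cs >= 8 A]. *)
have g1 : (sqrt n./2.+1%:R)^-1 <= (3 / 2) / sqrt n.+1%:R :> R.
  rewrite -[leLHS]mul1r ler_pdivrMr // mulrAC ler_pdivlMr // mul1r.
  have -> : 3 / 2 = sqrt (9 / 4) :> R.
    by rewrite (_ : 9 / 4 = (3 / 2) ^+ 2); [rewrite sqrtr_sqr ger0_norm // divr_ge0|field].
  rewrite -sqrtrM ?divr_ge0 // ler_sqrt ?mulr_ge0 ?divr_ge0 //.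
  have : (n.+1%:R : R) <= 2 * n./2.+1%:R by rewrite -natrM ler_nat leq_double_half.
  have : 0 <= n./2.+1%:R :> R by rewrite ler0n.
  lra.
have g2 : (sqrt n%:R)^-1 <= 2 / sqrt n.+1%:R :> R.
  have sn : 0 < sqrt n%:R :> R by rewrite sqrtr_gt0 ltr0n.
  rewrite -[leLHS]mul1r ler_pdivrMr // mulrAC ler_pdivlMr // mul1r.
  have -> : 2 = sqrt 4 :> R by rewrite (_ : 4 = 2 ^+ 2); [rewrite sqrtr_sqr ger0_norm|ring].
  by rewrite -sqrtrM // ler_sqrt ?mulr_ge0 // -natrM ler_nat leq_succ4.
set i := (sqrt n.+1%:R)^-1 in g1 g2 *.
have Cy : 0 <= Cs * yp y by rewrite mulr_ge0 ?(le_trans _ y1) // /Cs; lra.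
have Ay : 0 <= A * yp y by rewrite mulr_ge0 ?(le_trans _ y1) // ltW.
have j1 := ler_wpM2l Cy g1; have j2 := ler_wpM2l Ay g2.
have i0 : 0 <= i by rewrite invr_ge0 ltW.
have : 8 * A * yp y * i <= Cs * yp y * i.
  rewrite ler_wpM2r // ler_wpM2r ?(le_trans _ y1) // /Cs; lra.
lra.
Qed.

Definition harm : T -> R -> R := fun x w => w + r x.

Lemma harm_step x w : step P f false harm x w = harm x w.
Proof.
rewrite /step /harm /= -(Hr x).
have -> : \sum_x' P x x' * (w + f x' + r x') = \sum_x' (P x x' * w + P x x' * (f x' + r x')).
  by apply: eq_bigr => x' _; ring.
by rewrite big_split /= -mulr_suml; case: Pst => _ ->; rewrite mul1r.
Qed.

(* The increments of [K n harm] are dominated by those of [survp n], so that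
   [K n harm - C survp n] increases and [K n harm + C survp n] decreases. *)
Lemma harmonic_exists : exists V0 : T -> R -> R, exists2 C : R, 0 < C & forall n x (y : R), - F <= y -> `|K n harm x y - V0 x y| <= C * survp n x y.
Proof.
have F0' := F0; have [X X0 HX] := fin_ub r.
pose C := X + 2 * F.
have C0 : 0 < C by rewrite addr_gt0 // mulr_gt0.
have inc n x (y : R) : - F <= y -> `|K n.+1 harm x y - K n harm x y| <= C * (survp n x y - survp n.+1 x y).
  move=> hy; rewrite walkSr -walkBf.
  have -> : C * (survp n x y - survp n.+1 x y) = K n (fun x w => C * (1 - survp 1 x w)) x y.
    rewrite walkZ walkBf; congr (_ * (_ - _)).
    by rewrite -survpD addn1.
  apply: (@walk_norm_le_on _ _ _ f Pst (fun w => - F <= w)) => //; first exact: (dom_pos F0).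
  move=> x' w' hw'; rewrite -harm_step; apply: (kill_diff Pst HF) => //; first exact: ltW.
  move=> x'' w'' /andP[a b]; apply: le_trans (ler_normD _ _) _; rewrite addrC; apply: lerD => //.
  by rewrite ler_norml; apply/andP; split; lra.
have incD m n x (y : R) : - F <= y -> `|K (m + n) harm x y - K m harm x y| <= C * (survp m x y - survp (m + n) x y).
  move=> hy; elim: n => [|n IH]; first by rewrite addn0 !subrr normr0 mulr0.
  have := inc (m + n)%N x y hy; rewrite -addnS.
  set a := K (m + n.+1) harm x y; set b := K (m + n) harm x y in IH *; set c := K m harm x y in IH *.
  move=> h; have -> : a - c = (a - b) + (b - c) by ring.
  apply: le_trans (ler_normD _ _) _; lra.
pose S x y := [set K n harm x y - C * survp n x y | n in [set: nat]]%classic.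
exists (fun x y => sup (S x y)), C => // n x y hy.
have comp m k : K m harm x y - C * survp m x y <= K k harm x y + C * survp k x y.
  have sm := survp_ge0 f Pst m x y; have sk := survp_ge0 f Pst k x y.
  have Cm : 0 <= C * survp m x y by rewrite mulr_ge0 // ltW.
  have Ck : 0 <= C * survp k x y by rewrite mulr_ge0 // ltW.
  case: (leqP m k) => h.
    have := incD m (k - m)%N x y hy; rewrite subnKC // ler_norml => /andP[a b]; lra.
  have := incD k (m - k)%N x y hy; rewrite subnKC // ?(ltnW h) // ler_norml => /andP[a b]; lra.
have ub : has_ubound (S x y).
  by exists (K 0 harm x y + C * survp 0 x y) => _ [m _ <-]; exact: comp.
have lo : K n harm x y - C * survp n x y <= sup (S x y) by apply: ub_le_sup => //; exists n.
have hi : sup (S x y) <= K n harm x y + C * survp n x y.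
  by apply: ge_sup; [exists (K 0 harm x y - C * survp 0 x y); exists 0%N|move=> _ [m _ <-]; exact: comp].
rewrite ler_norml; apply/andP; split; lra.
Qed.

Lemma sum_inv_sqrt n : \sum_(j < n) (sqrt j.+1%:R)^-1 <= 2 * sqrt n%:R :> R.
Proof.
elim: n => [|n IH]; first by rewrite big_ord0 mulr_ge0 // sqrtr_ge0.
rewrite big_ord_recr /=; apply: le_trans (lerD IH (lexx _)) _.
have a0 : 0 < sqrt n.+1%:R :> R by rewrite sqrtr_gt0 ltr0n.
have b0 : 0 <= sqrt n%:R :> R by rewrite sqrtr_ge0.
have aE : n.+1%:R = sqrt n.+1%:R ^+ 2 :> R by rewrite sqr_sqrtr.
have bE : n%:R = sqrt n%:R ^+ 2 :> R by rewrite sqr_sqrtr.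
have ab : sqrt n%:R ^+ 2 + 1 = sqrt n.+1%:R ^+ 2 :> R by rewrite -aE -bE natr1.
move: a0 b0 ab; set a := sqrt n.+1%:R; set b := sqrt n%:R => a0 b0 ab.
rewrite -(ler_pM2r a0) mulrDl mulVf ?gt_eqF //.
have := sqr_ge0 (a - b); nra.
Qed.

(** Each step from a surviving state adds at most [X ^+ 2] to the mean square, so the total growth
    follows the sum of the survival probabilities, of order [yp y sqrt n]. This pays for the Taylor
    remainder at 0 in [killed_asym0]. *)
Lemma second_moment : exists2 C : R, 0 < C & forall n x (y : R), - F <= y ->
  K n (fun x w => harm x w ^+ 2) x y <= C * (yp y ^+ 2 + yp y * sqrt n.+1%:R).
Proof.
have F0' := F0.
have [X X0 HX] := fin_ub (fun p : T * T => f p.2 + r p.2 - r p.1).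
have [Y Y0 HY] := fin_ub r.
have [C C0 HC] := survival.
pose u : T -> R -> R := fun x w => harm x w ^+ 2.
have st x w : step P f true u x w <= u x w + X ^+ 2.
  apply: le_trans (step_kill_le f Pst _ _ _) _; first by move=> *; exact: sqr_ge0.
  rewrite /step /= /u /harm.
  apply: (@le_trans _ _ (\sum_x' ((w + r x) ^+ 2 * P x x' + 2 * (w + r x) * (P x x' * (f x' + r x') - r x * P x x') + X ^+ 2 * P x x'))).
    apply: ler_sum => x' _; have P0 : 0 <= P x x' by case: Pst.
    have h : (f x' + r x' - r x) ^+ 2 <= X ^+ 2.
      by rewrite -[leLHS](real_normK (num_real _)) lerXn2r // ?nnegrE ?(ltW X0) //; exact: (HX (x, x')).
    have := ler_wpM2l P0 h.
    lra.
  rewrite !big_split /= -!mulr_sumr sumrB -mulr_sumr Hr; case: Pst => _ ->; lra.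
have rec n x (y : R) : K n u x y <= u x y + X ^+ 2 * \sum_(j < n) survp j x y.
  elim: n => [|n IH]; first by rewrite big_ord0 mulr0 addr0.
  rewrite walkSr big_ord_recr /= mulrDr addrA.
  apply: (@le_trans _ _ (K n (fun x w => u x w + X ^+ 2 * 1) x y)).
    by apply: (walk_le f Pst) => x' w'; rewrite mulr1; exact: st.
  by rewrite walkDf walkZ; apply: lerD.
exists ((1 + F + Y) ^+ 2 + X ^+ 2 * (C * 2)).
  by rewrite addr_gt0 // ?exprn_gt0 ?addr_gt0 // !mulr_gt0 // exprn_gt0.
move=> n x y hy; have y1 := yp_ge1 y.
apply: le_trans (rec n x y) _.
have p1 : u x y <= (1 + F + Y) ^+ 2 * yp y ^+ 2.
  rewrite /u -[leLHS](real_normK (num_real _)) -exprMn lerXn2r // ?nnegrE ?mulr_ge0 ?(le_trans _ y1) //; first lra.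
  apply: le_trans (ler_normD _ _) _; have := yp_abs F0 hy; have := HY x.
  have : Y <= Y * yp y by rewrite ler_peMr // ltW.
  lra.
have p2 : \sum_(j < n) survp j x y <= C * yp y * (2 * sqrt n.+1%:R).
  apply: (@le_trans _ _ (\sum_(j < n) C * yp y * (sqrt j.+1%:R)^-1)).
    by apply: ler_sum => j _; exact: HC.
  rewrite -mulr_sumr ler_wpM2l //; first by rewrite mulr_ge0 ?(le_trans _ y1) // ltW.
  apply: le_trans (sum_inv_sqrt n) _; rewrite ler_pM2l // ler_sqrt ?ler0n // ler_nat //.
have := ler_wpM2l (sqr_ge0 X) p2.
set s := sqrt n.+1%:R; have s0 : 0 <= s by rewrite sqrtr_ge0.
have q1 : 0 <= (1 + F + Y) ^+ 2 * (yp y * s) by rewrite mulr_ge0 ?sqr_ge0 // mulr_ge0 // (le_trans _ y1).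
have q2 : 0 <= X ^+ 2 * (C * 2) * yp y ^+ 2 by rewrite mulr_ge0 ?sqr_ge0 // mulr_ge0 ?sqr_ge0 // mulr_ge0 // ltW.
lra.
Qed.

End Killed2.

(** * Local tail of the free walk *)

Lemma sqr_le_norm (R : realType) (x X : R) : `|x| <= X -> x ^+ 2 <= X ^+ 2.
Proof. by move=> h; rewrite -(real_normK (num_real x)) lerXn2r // nnegrE (le_trans _ h). Qed.

(** At width [kappa^17 sqrt n] and distance [kappa^12 sqrt n] the quadratic bound [gauss_tail] blows
    up with [kappa], while the fourth power leaves a factor [kappa^(51 - 48)]. *)
Lemma gauss_tail4 (R : realType) (t y D : R) : 0 < t -> 0 < D -> D <= `|y| ->
  gauss t y <= 16 * (t * Num.sqrt t) / D ^+ 4.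
Proof.
move=> t0 D0 Dy.
have s0 : 0 < Num.sqrt t by rewrite sqrtr_gt0.
have tE : t = Num.sqrt t * Num.sqrt t by rewrite -expr2 sqr_sqrtr // ltW.
have y0 : 0 < `|y| by exact: lt_le_trans Dy.
have yy : 0 < y ^+ 2 by rewrite exprn_even_gt0 //= -normr_gt0.
pose u := y ^+ 2 / (2 * t).
have u0 : 0 < u by rewrite divr_gt0 // mulr_gt0.
have h : expR (- u) <= 4 / u ^+ 2.
  rewrite expRN -[leLHS]mul1r ler_pdivrMr ?expR_gt0 // mulrAC ler_pdivlMr ?exprn_gt0 // mul1r.
  have e1 : 1 + u / 2 <= expR (u / 2) by exact: expR_ge1Dx.
  have -> : expR u = expR (u / 2) ^+ 2.
    by rewrite -expRM_natr; congr expR; field.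
  have : (1 + u / 2) ^+ 2 <= expR (u / 2) ^+ 2 by rewrite lerXn2r // nnegrE ?expR_ge0 //; lra.
  move: u0; set v := expR _; clear; nra.
rewrite /gauss -/u.
apply: (@le_trans _ _ ((Num.sqrt t)^-1 * (4 / u ^+ 2))); first by rewrite ler_wpM2l // invr_ge0 ltW.
have -> : (Num.sqrt t)^-1 * (4 / u ^+ 2) = 16 * (t * Num.sqrt t) / `|y| ^+ 4.
  have -> : `|y| ^+ 4 = (y ^+ 2) ^+ 2 by rewrite -normrX -exprM ger0_norm // exprn_even_ge0.
  rewrite /u; set Y := y ^+ 2 in yy *; set s := Num.sqrt t in s0 tE *.
  by rewrite tE; field; rewrite !gt_eqF.
apply: ler_wpM2l; first by pos.
by rewrite lef_pV2 ?posrE ?exprn_gt0 // lerXn2r // nnegrE ltW.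
Qed.

Section LargeDeviation.
Variables (R : realType) (T : finType) (P : T -> T -> R) (f r : T -> R).
Hypothesis Pst : stochastic P.
Hypothesis HH1 : H1 P.
Hypothesis HH3 : H3 P f.
Hypothesis Hr : forall x, \sum_x' P x x' * (f x' + r x') = r x.
Local Notation Q := (walk P f false).
Local Notation K := (walk P f true).
Local Notation sqrt := Num.sqrt.
Local Notation harm := (harm r).

(** Fubini for two independent walks; in [local_tail] it allows the two halves of a path to be
    integrated in either order. *)
Lemma walk_swap k1 k2 j1 j2 (H : T -> R -> T -> R -> R) x (w : R) y (c : R) :
  walk P f k1 j1 (fun x1 s => walk P f k2 j2 (H x1 s) y c) x w =
  walk P f k2 j2 (fun x2 t => walk P f k1 j1 (fun x1 s => H x1 s x2 t) x w) y c.
Proof.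
elim: j2 y c => [//|j2 IH] y c.
rewrite walkS /step.
have E : forall x1 s, walk P f k2 j2.+1 (H x1 s) y c =
    \sum_y' (P y y' * (if k2 && (c + f y' <= 0) then 0 else 1)) * walk P f k2 j2 (H x1 s) y' (c + f y').
  by move=> x1 s; rewrite walkS /step; apply: eq_bigr => y' _; case: ifP => _; rewrite ?mulr0 ?mul0r ?mulr1.
rewrite (walk_ext P f k1 j1 E) walk_sum; apply: eq_bigr => y' _; rewrite walkZ IH.
by case: ifP => _; rewrite ?mulr0 ?mul0r ?mulr1.
Qed.

Lemma harm_sq_step : exists2 C : R, 0 < C & forall x w,
  step P f false (fun x w => harm x w ^+ 2) x w <= harm x w ^+ 2 + C.
Proof.
have [X X0 HX] := fin_ub r; have [F F0 HF] := fin_ub f.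
exists ((F + 2 * X) ^+ 2); first by pos.
move=> x w.
have E : step P f false (fun x w => harm x w ^+ 2) x w =
   harm x w ^+ 2 + \sum_x' P x x' * (f x' + r x' - r x) ^+ 2.
  have S1 : \sum_x' P x x' = 1 by case: Pst.
  have S2 : \sum_x' P x x' * (f x' + r x' - r x) = 0.
    have -> : \sum_x' P x x' * (f x' + r x' - r x) = \sum_x' (P x x' * (f x' + r x') - P x x' * r x).
      by apply: eq_bigr => x' _; ring.
    by rewrite sumrB Hr -mulr_suml S1 mul1r subrr.
  rewrite /step /=.
  have -> : \sum_x' P x x' * harm x' (w + f x') ^+ 2 =
     \sum_x' (P x x' * harm x w ^+ 2 + (2 * harm x w * (P x x' * (f x' + r x' - r x)) + P x x' * (f x' + r x' - r x) ^+ 2)).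
    by apply: eq_bigr => x' _; rewrite /harm; ring.
  by rewrite big_split /= -mulr_suml S1 mul1r big_split /= -mulr_sumr S2 mulr0 add0r.
rewrite E lerD2l.
have -> : (F + 2 * X) ^+ 2 = \sum_x' P x x' * (F + 2 * X) ^+ 2.
  by rewrite -mulr_suml; case: Pst => _ ->; rewrite mul1r.
apply: ler_sum => x' _; apply: ler_wpM2l; first by case: Pst.
apply: sqr_le_norm; have := HX x; have := HX x'; have := HF x'; rewrite !ler_norml => /andP[? ?] /andP[? ?] /andP[? ?].
by apply/andP; split; lra.
Qed.

(** Chebyshev's inequality for the harmonic coordinate, whose mean square grows at most linearly. *)
Lemma tail : exists2 C : R, 0 < C & forall j y (c D : R), 0 < D ->
  Q j (fun _ t => ind (D <= `|t - c|)) y c <= C * j.+1%:R / D ^+ 2.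
Proof.
have [X X0 HX] := fin_ub r; have [C1 C10 HC1] := harm_sq_step.
exists (4 * X ^+ 2 + 2 * C1); first by pos.
move=> j y c D D0.
wlog -> : c / c = 0.
  move=> H; have := H 0 erefl; congr (_ <= _).
  rewrite -[c in RHS]add0r -walk_shift; apply: walk_ext => x' w'; congr (ind (_ <= `|_|)); ring.
have h : Q j (fun x w => harm x w ^+ 2) y 0 <= harm y 0 ^+ 2 + j%:R * C1.
  elim: j y {c} => [|j IH] y; first by rewrite mul0r addr0.
  rewrite walkSr; apply: le_trans (walk_le f Pst false j HC1 y 0) _.
  rewrite walkDf walk_cst // -natr1 mulrDl mul1r addrA lerD2r; exact: IH.
have hy : harm y 0 ^+ 2 <= X ^+ 2.
  by rewrite /harm add0r; exact: sqr_le_norm.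
have D2 : 0 < D ^+ 2 by pos.
apply: (@le_trans _ _ (Q j (fun x w => (2 / D ^+ 2) * harm x w ^+ 2 + (2 * X ^+ 2 / D ^+ 2)) y 0)).
  apply: (walk_le f Pst) => x w; rewrite subr0.
  case: (lerP D `|w|) => hD; last by rewrite indF addr_ge0 // mulr_ge0 ?sqr_ge0 //; pos.
  rewrite indT mulrAC -mulrDl ler_pdivlMr // mul1r.
  have : D ^+ 2 <= w ^+ 2 by rewrite -(real_normK (num_real w)) lerXn2r // nnegrE ltW.
  have : r x ^+ 2 <= X ^+ 2 by exact: sqr_le_norm.
  have : 0 <= (w + 2 * r x) ^+ 2 by exact: sqr_ge0.
  rewrite /harm; move: (w) (r x) => a b; nra.
rewrite walkDf (walkZ P f false j (2 / D ^+ 2) (fun x w => harm x w ^+ 2)) walk_cst //; set q := Q j _ y 0 in h *.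
have -> : 2 / D ^+ 2 * q + 2 * X ^+ 2 / D ^+ 2 = (2 * q + 2 * X ^+ 2) / D ^+ 2 by ring.
rewrite ler_wpM2r ?invr_ge0 ?(ltW D2) //.
have -> : j.+1%:R = j%:R + 1 :> R by rewrite natr1.
have : 0 <= j%:R * X ^+ 2 by pos.
have -> : (4 * X ^+ 2 + 2 * C1) * (j%:R + 1) = 4 * (j%:R * X ^+ 2) + 4 * X ^+ 2 + 2 * (j%:R * C1) + 2 * C1 by ring.
lra.
Qed.

Lemma concentrationS : exists2 C : R, 0 < C & forall n (z L : R) x w, 0 <= L ->
  Q n (box z L) x w <= C * (1 + L) / sqrt n.+1%:R.
Proof.
have [C C0 HC] := concentration Pst HH1 HH3.
exists (1 + 2 * C); first by pos.
move=> n z L x w L0; case: n => [|n].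
  rewrite sqrtr1 divr1 /= /box; apply: (@le_trans _ _ 1); first by case: (_ <= _ <= _); rewrite ?indT ?indF.
  nra.
apply: le_trans (HC n.+1 isT z L x w L0) _.
have i : (sqrt n.+1%:R)^-1 <= 2 / sqrt n.+2%:R :> R.
  have h1 : 0 < sqrt n.+1%:R :> R by rewrite sqrtr_gt0 ltr0n.
  have h2 : 0 < sqrt n.+2%:R :> R by rewrite sqrtr_gt0 ltr0n.
  rewrite -[leLHS]mul1r ler_pdivrMr // mulrAC ler_pdivlMr // mul1r.
  have -> : 2 = sqrt 4 :> R by rewrite (_ : 4 = 2 ^+ 2); [rewrite sqrtr_sqr ger0_norm|ring].
  by rewrite -sqrtrM // ler_sqrt ?mulr_ge0 // -natrM ler_nat leq_succ4.
have c1 : 0 <= C * (1 + L) by pos.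
apply: le_trans (ler_wpM2l c1 i) _.
have -> : C * (1 + L) * (2 / sqrt n.+2%:R) = 2 * C * (1 + L) / sqrt n.+2%:R by ring.
apply: ler_wpM2r; first by rewrite invr_ge0 sqrtr_ge0.
by apply: ler_wpM2r; lra.
Qed.

(* Either the first or the second half of the walk covers half of the distance to
   the window; the other half spreads the walk over [sqrt j] cells. *)
Lemma local_tail : exists2 C : R, 0 < C & forall j (z a : R) x (w : R), 0 <= a -> w < z ->
  Q j (box z a) x w <= C * (1 + a) * sqrt j.+1%:R / (z - w) ^+ 2.
Proof.
have [C1 C10 HC1] := concentrationS; have [C2 C20 HC2] := tail.
pose N := #|T|%:R : R.
have N0 : 0 <= N by rewrite ler0n.
exists (8 * C1 * C2 * (1 + N)); first by (have : 0 < 1 + N by exact: ltr_wpDr); pos.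
move=> j z a x w a0 wz.
pose j1 := j./2; pose j2 := (j - j1)%N.
have jE : j = (j1 + j2)%N by rewrite /j1 /j2; lia.
have i1 : (sqrt j1.+1%:R)^-1 <= 2 / sqrt j.+1%:R :> R.
  have h1 : 0 < sqrt j1.+1%:R :> R by rewrite sqrtr_gt0 ltr0n.
  have h2 : 0 < sqrt j.+1%:R :> R by rewrite sqrtr_gt0 ltr0n.
  rewrite -[leLHS]mul1r ler_pdivrMr // mulrAC ler_pdivlMr // mul1r.
  have -> : 2 = sqrt 4 :> R by rewrite (_ : 4 = 2 ^+ 2); [rewrite sqrtr_sqr ger0_norm|ring].
  by rewrite -sqrtrM // ler_sqrt ?mulr_ge0 // -natrM ler_nat /j1; lia.
have i2 : (sqrt j2.+1%:R)^-1 <= 2 / sqrt j.+1%:R :> R.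
  have h1 : 0 < sqrt j2.+1%:R :> R by rewrite sqrtr_gt0 ltr0n.
  have h2 : 0 < sqrt j.+1%:R :> R by rewrite sqrtr_gt0 ltr0n.
  rewrite -[leLHS]mul1r ler_pdivrMr // mulrAC ler_pdivlMr // mul1r.
  have -> : 2 = sqrt 4 :> R by rewrite (_ : 4 = 2 ^+ 2); [rewrite sqrtr_sqr ger0_norm|ring].
  by rewrite -sqrtrM // ler_sqrt ?mulr_ge0 // -natrM ler_nat /j2 /j1; lia.
have j1j : (j1.+1%:R : R) <= j.+1%:R by rewrite ler_nat /j1; lia.
have j2j : (j2.+1%:R : R) <= j.+1%:R by rewrite ler_nat /j2 /j1; lia.
pose D := (z - w) / 2.
have D0 : 0 < D by rewrite /D; lra.
pose A := C1 * (1 + a) * (2 / sqrt j.+1%:R).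
have A0 : 0 <= A by rewrite /A; pos.
have b1 n y s : (sqrt n.+1%:R)^-1 <= 2 / sqrt j.+1%:R :> R -> forall z, Q n (box z a) y s <= A.
  move=> i z'; apply: le_trans (HC1 n z' a y s a0) _; apply: ler_wpM2l => //; pos.
have t1 n y (c : R) : (n.+1%:R : R) <= j.+1%:R -> Q n (fun _ t => ind (D <= `|t - c|)) y c <= C2 * j.+1%:R / D ^+ 2.
  move=> hn; apply: le_trans (HC2 n y c D D0) _; rewrite ler_wpM2r ?invr_ge0 ?exprn_ge0 ?(ltW D0) // ler_wpM2l //.
  exact: ltW.
(* If the first half stays close, the second has to cover [D]. Its starting state is replaced by a
   sum over all states [y]; this makes the two halves independent, at the cost of the factor [N]. *)
pose H (x1 : T) (s : R) (x2 : T) (t : R) : R := ind (D <= `|t - 0|) * box z a x2 (s + t).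
have pt x1 (s : R) : Q j2 (box z a) x1 s <= A * ind (D <= `|s - w|) + \sum_y Q j2 (H x1 s) y 0.
  have Hge y : 0 <= Q j2 (H x1 s) y 0.
    apply: (walk_ge0 f Pst) => x2 t; rewrite /H mulr_ge0 ?ind_ge0 ?box_ge0 //.
  have Sge : 0 <= \sum_y Q j2 (H x1 s) y 0 by apply: sumr_ge0.
  case: (lerP D `|s - w|) => hD.
    by rewrite indT mulr1; apply: le_trans (b1 j2 x1 s i2 z) _; rewrite lerDl.
  rewrite indF mulr0 add0r (bigD1 x1) //=.
  apply: (@le_trans _ _ (Q j2 (H x1 s) x1 0)); last by rewrite lerDl; apply: sumr_ge0.
  rewrite -[s in leLHS]add0r -walk_shift; apply: (walk_le f Pst) => x2 t.
  rewrite /H subr0 [s + t]addrC /box; case: (boolP (z <= t + s <= z + a)) => [/andP[h1 h2]|_].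
    have -> : D <= `|t|.
      have := ler_norm t; have := ler_norm (s - w); rewrite /D in hD *; lra.
    by rewrite !indT mulr1.
  by rewrite indF mulr0.
rewrite jE walkD.
apply: le_trans (walk_le f Pst false j1 pt x w) _.
rewrite walkDf walkZ walk_sum.
have h1 : A * Q j1 (fun _ t => ind (D <= `|t - w|)) x w <= A * (C2 * j.+1%:R / D ^+ 2).
  by apply: ler_wpM2l => //; exact: t1.
have h2 : \sum_y Q j1 (fun x1 s => Q j2 (H x1 s) y 0) x w <= \sum_(y : T) A * (C2 * j.+1%:R / D ^+ 2).
  apply: ler_sum => y _; rewrite walk_swap.
  apply: (@le_trans _ _ (Q j2 (fun _ t => A * ind (D <= `|t - 0|)) y 0)).
    apply: (walk_le f Pst) => x2 t; rewrite /H walkZ mulrC; apply: ler_wpM2r; first exact: ind_ge0.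
    have -> : Q j1 (fun _ s => box z a x2 (s + t)) x w = Q j1 (box z a) x (w + t).
      by rewrite -walk_shift; apply: walk_ext.
    exact: b1.
  by rewrite walkZ; apply: ler_wpM2l => //; exact: t1.
apply: le_trans (lerD h1 h2) _.
have sumN (b : R) : \sum_(y : T) b = N * b by rewrite sumr_const mulr_natl.
rewrite sumN -jE.
have s0 : 0 < sqrt j.+1%:R :> R by rewrite sqrtr_gt0 ltr0n.
have sE : j.+1%:R = sqrt j.+1%:R * sqrt j.+1%:R :> R by rewrite -expr2 sqr_sqrtr.
have -> : (z - w) = 2 * D by rewrite /D; field.
rewrite /A; set s := sqrt j.+1%:R in s0 sE *; rewrite sE.
rewrite le_eqVlt; apply/orP; left; apply/eqP; by field; rewrite !gt_eqF.
Qed.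

(** The free paths lost to killing are split at their first entry into the nonpositive half-line;
    what remains is a free walk of some [j < l] steps, worth at most [M]. *)
Lemma kill_sup l (u : T -> R -> R) (M : R) : (forall x w, 0 <= u x w) -> 0 <= M ->
  (forall j x (w : R), (j < l)%N -> w <= 0 -> Q j u x w <= M) ->
  forall x w, Q l u x w - K l u x w <= M.
Proof.
move=> u0 M0; elim: l => [|l IH] HM x w; first by rewrite subrr.
rewrite !walkS /step -sumrB.
have -> : M = \sum_x' P x x' * M by rewrite -mulr_suml; case: Pst => _ ->; rewrite mul1r.
apply: ler_sum => x' _; rewrite -mulrBr; apply: ler_wpM2l; first by case: Pst.
case: ifP => //= h; last by apply: IH => j y v jl; apply: HM; exact: ltnW.
by rewrite subr0; apply: HM.
Qed.

End LargeDeviation.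

(** * Local limit theorem for the killed walk *)

Lemma inv_pow_le (R : realType) (c s a : R) j J : 0 < c -> c <= 1 -> 0 < s -> c * s <= a -> (j <= J)%N ->
  1 / a ^+ j <= c ^- J / s ^+ j.
Proof.
move=> c0 c1 s0 ca jJ.
have cs0 : 0 < c * s by rewrite mulr_gt0.
apply: (@le_trans _ _ (1 / (c * s) ^+ j)).
  rewrite !div1r lef_pV2 ?posrE ?exprn_gt0 // ?(lt_le_trans cs0) // lerXn2r // nnegrE ?(ltW cs0) //.
  exact: le_trans (ltW cs0) ca.
rewrite div1r exprMn invfM ler_wpM2r ?invr_ge0 ?exprn_ge0 ?(ltW s0) //.
by rewrite lef_pV2 ?posrE ?exprn_gt0 // ler_wiXn2l // ltW.
Qed.

Lemma sqrt_half_inv (R : realType) n : (0 < n)%N -> (Num.sqrt n./2.+1%:R)^-1 <= 2 / Num.sqrt n%:R :> R.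
Proof.
move=> n0.
have h0 : 0 < Num.sqrt n./2.+1%:R :> R by rewrite sqrtr_gt0 ltr0n.
have s0 : 0 < Num.sqrt n%:R :> R by rewrite sqrtr_gt0 ltr0n.
rewrite -[leLHS]mul1r ler_pdivrMr // mulrAC ler_pdivlMr // mul1r.
have -> : 2 = Num.sqrt 4 :> R by rewrite (_ : 4 = 2 ^+ 2); [rewrite sqrtr_sqr ger0_norm|ring].
rewrite -sqrtrM // ler_sqrt ?mulr_ge0 // -natrM ler_nat.
by apply: leq_trans (leqnSn _) (leq_trans (leq_double_half n) _); rewrite leq_mul2r orbT.
Qed.

(** * The odd Gaussian kernel near the origin *)

Section OddKernel.
Variable R : realType.
Local Notation sqrt := Num.sqrt.

Lemma gauss_at0 (t : R) : gauss t 0 = (sqrt t)^-1.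
Proof. by rewrite /gauss expr0n /= mul0r oppr0 expR0 mulr1. Qed.

Lemma gauss_scale (a n w : R) : 0 < a -> 0 < n -> gauss (a * n) w = gauss a (w / sqrt n) / sqrt n.
Proof.
move=> a0 n0; have sn : 0 < sqrt n by rewrite sqrtr_gt0.
have sa : 0 < sqrt a by rewrite sqrtr_gt0.
have nE : n = sqrt n ^+ 2 by rewrite sqr_sqrtr // ltW.
rewrite /gauss sqrtrM ?(ltW a0) // invfM -mulrA [RHS]mulrAC -mulrA; congr (_ * (_ * expR (- _))).
by rewrite {1}nE; field; rewrite !gt_eqF.
Qed.

Lemma gaussN (t w : R) : gauss t (- w) = gauss t w.
Proof. by rewrite /gauss sqrrN. Qed.

Lemma gausso_odd (z t : R) : gausso z 0 t 0 = 0.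
Proof. by rewrite /gausso !gaussd0 sub0r add0r gaussN subrr. Qed.

Lemma gausso_slope (z t : R) : gausso z 1 t 0 = 2 * (z / t) * gauss t z.
Proof. by rewrite /gausso /gaussd /= sub0r add0r gaussN; ring. Qed.

Lemma gausso_ge0 (z t w : R) : 0 < t -> 0 <= z -> 0 <= w -> 0 <= gausso z 0 t w.
Proof.
move=> t0 z0 w0; rewrite /gausso !gaussd0 subr_ge0 /gauss ler_wpM2l ?invr_ge0 ?sqrtr_ge0 //.
rewrite ler_expR lerN2 ler_wpM2r ?invr_ge0 ?mulr_ge0 ?(ltW t0) //.
have := mulr_ge0 z0 w0; nra.
Qed.

(** With [u = w / b] the kernel is [exp(-(u^2 + 1)/2) (exp u - exp(- u)) / b], and its growth from 0
    is at least linear for [u <= 1]. *)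
Lemma gausso_lb (b q w : R) : 0 < b -> 0 <= q -> q * b <= w <= b ->
  q / (expR 1 * b) <= gausso b 0 (b ^+ 2) w.
Proof.
move=> b0 q0 /andP[h1 h2].
have sb : sqrt (b ^+ 2) = b by rewrite sqrtr_sqr gtr0_norm.
pose u := w / b.
have u1 : q <= u by rewrite ler_pdivlMr.
have u2 : u <= 1 by rewrite ler_pdivrMr // mul1r.
have u0 : 0 <= u by exact: le_trans u1.
have E1 : - ((w - b) ^+ 2 / (2 * b ^+ 2)) = - ((u ^+ 2 + 1) / 2) + u.
  by rewrite /u; field; rewrite gt_eqF.
have E2 : - ((w + b) ^+ 2 / (2 * b ^+ 2)) = - ((u ^+ 2 + 1) / 2) + - u.
  by rewrite /u; field; rewrite gt_eqF.
rewrite /gausso !gaussd0 /gauss sb E1 E2 !expRD -!mulrBr.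
have -> : q / (expR 1 * b) = b^-1 * (expR (- 1) * q).
  by rewrite expRN; field; rewrite !gt_eqF // expR_gt0.
apply: ler_wpM2l; first by rewrite invr_ge0 ltW.
apply: ler_pM; [exact: expR_ge0|done| |].
  by rewrite ler_expR lerN2; nra.
have e1 : 1 + u <= expR u by exact: expR_ge1Dx.
have e2 : expR (- u) <= 1 by rewrite -expR0 ler_expR oppr_le0.
lra.
Qed.

End OddKernel.

Section KilledWalk.
Variables (R : realType) (T : finType) (P : T -> T -> R) (f r rho : T -> R) (v2 F : R).
Hypothesis Pst : stochastic P.
Hypothesis HH1 : H1 P.
Hypothesis HH3 : H3 P f.
Hypothesis Hr : forall x, \sum_x' P x x' * (f x' + r x') = r x.
Hypothesis Hrho : forall x, \sum_x' P x x' * (f x' + r x' - r x) ^+ 2 + \sum_x' P x x' * rho x'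
                = v2 + rho x.
Hypothesis v20 : 0 < v2.
Hypothesis F0 : 0 < F.
Hypothesis HF : forall x, `|f x| <= F.
Local Notation Q := (walk P f false).
Local Notation K := (walk P f true).
Local Notation survp := (survp P f).
Local Notation sqrt := Num.sqrt.
Local Notation corr := (corr r rho).
Local Notation harm := (harm r).
Local Notation c0 := (sqrt (2 * pi) : R).

Variables (V0 : T -> R -> R) (CV : R).
Hypothesis CV0 : 0 < CV.
Hypothesis HV : forall n x (y : R), - F <= y -> `|K n harm x y - V0 x y| <= CV * survp n x y.

Ltac clr := clear -Pst HH1 HH3 Hr Hrho v20 F0 HF CV0 HV.
Ltac lra0 := clr; lra.
Ltac nra0 := clr; nra.

Lemma V0_bound : exists2 C : R, 0 < C & forall x (y : R), - F <= y -> `|V0 x y| <= C * yp y.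
Proof.
have F0' := F0; have CV0' := CV0; have [X X0 HX] := fin_ub r.
exists (1 + F + X + CV); first by pos.
move=> x y hy; have y1 := yp_ge1 y.
have := HV 0 x hy; rewrite /survp /= mulr1 /harm distrC => h.
have -> : V0 x y = (V0 x y - (y + r x)) + (y + r x) by ring.
apply: le_trans (ler_normD _ _) _.
have h2 : `|y + r x| <= `|y| + `|r x| by exact: ler_normD.
have h3 := yp_abs F0 hy; have h4 := HX x.
have h5 : (X + CV) * 1 <= (X + CV) * yp y by apply: ler_wpM2l => //; pos.
lra.
Qed.

(** Over the last [k] steps the heat flow carries [G] to time [t + k v2]. For the first [m] steps
    the resulting function is linearised at 0, where it vanishes, to its slope times [harm]: the
    Taylor remainder is paid by [second_moment], and [K m harm] is close to [V0]. *)
Lemma killed_asym0 : exists2 C : R, 0 < C & forall G i B, heat G i B -> 0 <= B ->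
  (forall t : R, 0 < t -> G 0%N t 0 = 0) -> forall (t : R) m k x (y : R), 1 <= t -> - F <= y ->
  yp y <= sqrt m.+1%:R ->
  `|K (m + k) (corr G t) x y - G 1%N (t + k%:R * v2) 0 * V0 x y| <=
    C * (B * yp y) * ((k%:R / sqrt t ^+ (3 + i) + 1 / sqrt t ^+ (1 + i)) / sqrt m.+1%:R
      + sqrt m.+1%:R / sqrt (t + k%:R * v2) ^+ (2 + i)
      + 1 / sqrt (t + k%:R * v2) ^+ (1 + i) / sqrt m.+1%:R).
Proof.
have F0' := F0; have CV0' := CV0; have v20' := v20.
have [C1 C10 HC1] := killed_corr Pst Hr Hrho v20 F0 HF.
have [C2 C20 HC2] := survival Pst HH1 HH3 Hr Hrho v20 F0 HF.
have [C3 C30 HC3] := second_moment Pst HH1 HH3 Hr Hrho v20 F0 HF.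
have [Y Y0 HY] := fin_ub rho.
exists (C1 * C2 + (2 * C3 + Y * C2) + CV * C2); first by pos.
move=> G i B HG B0 Godd t m k x y t1 hy hm.
have t0 : 0 < t by lra.
set t' := t + k%:R * v2.
have tt' : t <= t' by rewrite lerDl mulr_ge0 // ltW.
have t'0 : 0 < t' by lra.
have y1 := yp_ge1 y.
have sm : 0 < sqrt m.+1%:R :> R by rewrite sqrtr_gt0 ltr0n.
have sv := HC2 m x y hy; have mm := HC3 m x y hy.
have sv0 := survp_ge0 f Pst m x y.
set s := sqrt m.+1%:R in hm sm sv mm *.
set M2 := B / sqrt t' ^+ (2 + i); set M1 := B / sqrt t' ^+ (1 + i).
have M20 : 0 <= M2 by rewrite /M2; pos.
have M10 : 0 <= M1 by rewrite /M1; pos.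
pose E := k%:R / sqrt t ^+ (3 + i) + 1 / sqrt t ^+ (1 + i).
have E0 : 0 <= E by rewrite /E; pos.
(* The heat error of the last [k] steps is met only by paths surviving the first [m], which gains a
   factor [1 / sqrt m]. *)
have a1 : `|K (m + k) (corr G t) x y - K m (corr G t') x y| <= C1 * (B * E) * survp m x y.
  rewrite walkD -walkBf /survp -walkZ.
  apply: (@walk_norm_le_on _ _ _ f Pst (fun w => - F <= w)) => //; first exact: (dom_pos F0).
  by move=> x' w' hw'; rewrite mulr1; exact: HC1.
have a2 : `|K m (corr G t') x y - G 1%N t' 0 * K m harm x y| <=
    M2 * (K m (fun x w => harm x w ^+ 2) x y + Y * survp m x y).
  have -> : K m (corr G t') x y - G 1%N t' 0 * K m harm x y =
    K m (fun x w => corr G t' x w - G 1%N t' 0 * harm x w) x y by rewrite walkBf walkZ.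
  have -> : M2 * (K m (fun x w => harm x w ^+ 2) x y + Y * survp m x y) =
    K m (fun x w => M2 * (harm x w ^+ 2 + Y * 1)) x y by rewrite walkZ walkDf walkZ.
  apply: (walk_norm_le f Pst) => x' w'; rewrite mulr1 [leRHS]mulrDr.
  have -> : corr G t' x' w' - G 1%N t' 0 * harm x' w' =
    (G 0%N t' (0 + harm x' w') - G 0%N t' 0 - harm x' w' * G 1%N t' 0) + rho x' / 2 * G 2%N t' (w' + r x').
    by rewrite /corr add0r Godd // /harm; ring.
  apply: le_trans (ler_normD _ _) _; apply: lerD.
    apply: (taylor2 (g2 := G 2%N t')); try by move=> c; apply: (heat_dw HG).
    by move=> c; exact: (heat_bd HG).
  rewrite normrM mulrC; apply: ler_pM => //; first by apply: (heat_bd HG).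
  rewrite normrM (ger0_norm (ltac:(by rewrite invr_ge0) : 0 <= (2 : R)^-1)).
  have := HY x'; have := normr_ge0 (rho x'); lra.
have a3 : `|G 1%N t' 0 * K m harm x y - G 1%N t' 0 * V0 x y| <= M1 * (CV * survp m x y).
  rewrite -mulrBr normrM; apply: ler_pM => //; first by apply: (heat_bd HG).
  exact: HV.
have tot : `|K (m + k) (corr G t) x y - G 1%N t' 0 * V0 x y| <=
   C1 * (B * E) * survp m x y + M2 * (K m (fun x w => harm x w ^+ 2) x y + Y * survp m x y) + M1 * (CV * survp m x y).
  set a := K (m + k) _ x y in a1 *; set b := K m (corr G t') x y in a1 a2; set c := _ * K m _ x y in a2 a3.
  set d := G 1%N t' 0 * V0 x y in a3 *.
  have -> : a - d = (a - b) + (b - c) + (c - d) by ring.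
  apply: le_trans (ler_normD _ _) _; apply: le_trans (lerD (ler_normD _ _) (lexx _)) _.
  by apply: lerD => //; apply: lerD.
apply: le_trans tot _.
have yy : yp y ^+ 2 <= yp y * s by rewrite expr2 ler_wpM2l // (le_trans _ y1).
have mm' : K m (fun x w => harm x w ^+ 2) x y <= 2 * C3 * (yp y * s).
  apply: le_trans mm _; have := ler_wpM2l (ltW C30) yy; lra.
have ss : survp m x y <= C2 * (yp y * s).
  apply: le_trans sv _; rewrite -mulrA ler_wpM2l ?(ltW C20) // ler_wpM2l //; first by rewrite (le_trans _ y1).
  have s1 : 1 <= s by rewrite (le_trans y1).
  by rewrite -[leLHS]mul1r ler_pdivrMr // -expr2 expr_ge1 // ltW.
have b1 : C1 * (B * E) * survp m x y <= C1 * C2 * (B * yp y) * (E / s).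
  have -> : C1 * C2 * (B * yp y) * (E / s) = C1 * (B * E) * (C2 * yp y / s) by ring.
  by apply: ler_wpM2l => //; pos.
have b2 : M2 * (K m (fun x w => harm x w ^+ 2) x y + Y * survp m x y) <= (2 * C3 + Y * C2) * (B * yp y) * (s / sqrt t' ^+ (2 + i)).
  have -> : (2 * C3 + Y * C2) * (B * yp y) * (s / sqrt t' ^+ (2 + i)) = M2 * (2 * C3 * (yp y * s) + Y * (C2 * (yp y * s))).
    by rewrite /M2; ring.
  by apply: ler_wpM2l => //; apply: lerD => //; apply: ler_wpM2l => //; exact: ltW.
have b3 : M1 * (CV * survp m x y) <= CV * C2 * (B * yp y) * (1 / sqrt t' ^+ (1 + i) / s).
  have -> : CV * C2 * (B * yp y) * (1 / sqrt t' ^+ (1 + i) / s) = M1 * (CV * (C2 * yp y / s)).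
    by rewrite /M1; ring.
  by apply: ler_wpM2l => //; apply: ler_wpM2l => //; exact: ltW.
rewrite -/E; set e1 := E / s in b1 *; set e2 := s / sqrt t' ^+ (2 + i) in b2 *; set e3 := _ / s in b3 *.
have By : 0 <= B * yp y by rewrite mulr_ge0 // (le_trans _ y1).
have e10 : 0 <= e1 by rewrite /e1; pos.
have e20 : 0 <= e2 by rewrite /e2; pos.
have e30 : 0 <= e3 by rewrite /e3; pos.
apply: le_trans (lerD (lerD b1 b2) b3) _.
set A1 := C1 * C2; set A2 := 2 * C3 + Y * C2; set A3 := CV * C2.
have A10 : 0 <= A1 by rewrite /A1; pos.
have A20 : 0 <= A2 by rewrite /A2; pos.
have A30 : 0 <= A3 by rewrite /A3; pos.
have -> : A1 * (B * yp y) * e1 + A2 * (B * yp y) * e2 + A3 * (B * yp y) * e3 = (B * yp y) * (A1 * e1 + A2 * e2 + A3 * e3) by ring.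
have -> : (A1 + A2 + A3) * (B * yp y) * (e1 + e2 + e3) = (B * yp y) * ((A1 + A2 + A3) * (e1 + e2 + e3)) by ring.
apply: ler_wpM2l => //.
rewrite -subr_ge0.
have -> : (A1 + A2 + A3) * (e1 + e2 + e3) - (A1 * e1 + A2 * e2 + A3 * e3) =
   A1 * e2 + A1 * e3 + A2 * e1 + A2 * e3 + A3 * e1 + A3 * e2 by ring.
by pos.
Qed.

(** With [m] close to [g^2 n], linearising and shifting the time by [m v2] have relative cost
    [O(g)], and the terms carrying the survival probability [O(1 / (g sqrt n))]: [g] is fixed first,
    then [n] is taken large. *)
Lemma killed_asym (th eta : R) : 0 < th -> 0 < eta -> exists N, forall n, (N <= n)%N ->
  forall t : R, th * n%:R <= t -> forall G i B, heat G i B -> 0 <= B ->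
  (forall t : R, 0 < t -> G 0%N t 0 = 0) -> (i <= 1)%N -> forall x (y : R), - F <= y ->
  yp y ^+ 2 <= sqrt n%:R ->
  `|K n (corr G t) x y - G 1%N (t + n%:R * v2) 0 * V0 x y| <= eta * (B * yp y) / sqrt n%:R ^+ (1 + i).
Proof.
move=> th0 eta0; have F0' := F0; have v20' := v20.
have [C1 C10 HC1] := killed_asym0.
have [C2 C20 HC2] := V0_bound.
pose q := Num.min (sqrt th) 1; pose c := Num.min (sqrt (v2 / 2)) 1.
have q0 : 0 < q by rewrite lt_min sqrtr_gt0 th0 ltr01.
have c00 : 0 < c by rewrite lt_min sqrtr_gt0 ltr01 divr_gt0.
have q1 : q <= 1 by rewrite ge_min lexx orbT.
have c1 : c <= 1 by rewrite ge_min lexx orbT.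
pose A1 := C1 * (2 * q ^- 4 + c ^- 4); pose A2 := C1 * (2 * c ^- 4) + v2 * c ^- 4 * C2.
have A10 : 0 < A1 by rewrite /A1; pos.
have A20 : 0 < A2 by rewrite /A2; pos.
pose g := Num.min (1 / 2) (eta / (2 * A2)).
have g0 : 0 < g by rewrite lt_min; apply/andP; split; pos.
have g1 : g <= 1 / 2 by rewrite ge_min lexx.
have g2 : A2 * g <= eta / 2.
  have : g <= eta / (2 * A2) by rewrite ge_min lexx orbT.
  by rewrite ler_pdivlMr; [lra|pos].
have gg : g ^+ 2 <= 1 / 4 by nra.
have gg0 : 0 < g ^+ 2 by pos.
have [N HN] := sqrt_large (1 / g ^+ 2 + 2 * A1 / (g * eta) + 1 / th + 1).
exists N => n /HN[n0 hs] t ht G i B HG B0 Godd i1 x y hy hyn.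
have n0' : 0 < n%:R :> R by rewrite ltr0n.
have s0 : 0 < sqrt n%:R :> R by rewrite sqrtr_gt0.
set s := sqrt n%:R in hs s0 hyn *.
have nE : n%:R = s * s by rewrite /s -expr2 sqr_sqrtr // ltW.
have u1 : 0 <= 1 / g ^+ 2 by pos.
have u2 : 0 <= 2 * A1 / (g * eta) by pos.
have u3 : 0 <= 1 / th by pos.
have s1 : 1 <= s by lra.
have sth : 1 <= th * s.
  by have : 1 / th <= s by [lra]; rewrite ler_pdivrMr // [s * th]mulrC.
have sg : 1 <= g ^+ 2 * s.
  by have : 1 / g ^+ 2 <= s by [lra]; rewrite ler_pdivrMr // [s * g ^+ 2]mulrC.
have t1 : 1 <= t.
  apply: le_trans ht; rewrite nE mulrA; apply: le_trans sth _; rewrite ler_peMr //; pos.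
have t0 : 0 < t by lra.
have gn0 : 0 <= g ^+ 2 * n%:R by pos.
have /andP[m1 m2] := Num.Theory.truncn_itv gn0.
set m := Num.truncn _ in m1 m2.
have gns : s <= g ^+ 2 * n%:R.
  by rewrite nE mulrA -[leLHS]mul1r ler_pM2r.
have mn : (m <= n)%N.
  rewrite -(ler_nat R); apply: le_trans m1 _; rewrite -[leRHS]mul1r ler_wpM2r ?ler0n //; lra.
pose k := (n - m)%N.
have nmk : n = (m + k)%N by rewrite subnKC.
have kR : k%:R = n%:R - m%:R :> R by rewrite natrB.
have k2 : n%:R / 2 <= k%:R :> R.
  rewrite kR; have : g ^+ 2 * n%:R <= 1 / 4 * n%:R by rewrite ler_wpM2r // ltW.
  lra.
have kn : k%:R <= n%:R :> R by rewrite ler_nat leq_subr.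
have sm : 0 < sqrt m.+1%:R :> R by rewrite sqrtr_gt0 ltr0n.
have sm1 : g * s <= sqrt m.+1%:R.
  have -> : g * s = sqrt (g ^+ 2 * n%:R) by rewrite sqrtrM ?sqr_ge0 // sqrtr_sqr gtr0_norm.
  by rewrite ler_sqrt ?ler0n // ltW.
have sm2 : sqrt m.+1%:R <= 2 * (g * s).
  have -> : 2 * (g * s) = sqrt ((2 * g) ^+ 2 * n%:R).
    by rewrite sqrtrM ?sqr_ge0 // sqrtr_sqr gtr0_norm ?mulr_gt0 // -/s mulrA.
  rewrite ler_sqrt; last by pos.
  rewrite -natr1; have -> : (2 * g) ^+ 2 * n%:R = 4 * (g ^+ 2 * n%:R) by ring.
  lra.
have ym : yp y <= sqrt m.+1%:R.
  rewrite -[leLHS]ger0_norm ?(le_trans _ (yp_ge1 y)) // -sqrtr_sqr ler_sqrt ?ler0n //.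
  by apply: le_trans hyn _; apply: le_trans gns _; exact: ltW.
pose t' := t + k%:R * v2.
have kv0 : 0 <= k%:R * v2 by rewrite mulr_ge0 // ltW.
have t'0 : 0 < t' by exact: ltr_wpDr.
have st : q * s <= sqrt t.
  apply: (@le_trans _ _ (sqrt th * s)); first by rewrite ler_wpM2r ?(ltW s0) // ge_min lexx.
  by rewrite -sqrtrM ?(ltW th0) // ler_sqrt // ltW.
have st' : c * s <= sqrt t'.
  apply: (@le_trans _ _ (sqrt (v2 / 2) * s)); first by rewrite ler_wpM2r ?(ltW s0) // ge_min lexx.
  have v22 : 0 <= v2 / 2 by pos.
  rewrite -sqrtrM // ler_sqrt ?(ltW t'0) //.
  have := ler_wpM2l (ltW v20) k2; rewrite /t'; move: t0; lra0.
have main := HC1 G i B HG B0 Godd t m k x y t1 hy ym.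
rewrite -nmk -/t' in main.
set S := s ^+ (1 + i).
have S0 : 0 < S by rewrite exprn_gt0.
have i3 := inv_pow_le (j := 3 + i) (J := 4) q0 q1 s0 st ltac:(by rewrite (leq_add2l 3 i 1)).
have i1' := inv_pow_le (j := 1 + i) (J := 4) q0 q1 s0 st ltac:(by rewrite (leq_trans (leq_add (leqnn 1) i1))).
have j2 := inv_pow_le (j := 2 + i) (J := 4) c00 c1 s0 st' ltac:(by rewrite (leq_trans (leq_add (leqnn 2) i1))).
have j1 := inv_pow_le (j := 1 + i) (J := 4) c00 c1 s0 st' ltac:(by rewrite (leq_trans (leq_add (leqnn 1) i1))).
have j3 := inv_pow_le (j := 3 + i) (J := 4) c00 c1 s0 st' ltac:(by rewrite (leq_add2l 3 i 1)).
have e3 : s ^+ (3 + i) = s * s * S by rewrite /S -expr2 -exprD.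
have e2 : s ^+ (2 + i) = s * S by rewrite /S -exprS.
have gs0 : 0 < g * s by pos.
have ism : (sqrt m.+1%:R)^-1 <= (g * s)^-1 by rewrite lef_pV2.
have iq : 0 <= q ^- 4 by pos.
have ic : 0 <= c ^- 4 by pos.
have iS : 0 <= S^-1 by pos.
have igs : 0 <= (g * s)^-1 by pos.
have p1 : (k%:R / sqrt t ^+ (3 + i) + 1 / sqrt t ^+ (1 + i)) / sqrt m.+1%:R <= 2 * q ^- 4 / S / (g * s).
  apply: ler_pM; [by pos|by pos| |done].
  have h1 : k%:R / sqrt t ^+ (3 + i) <= q ^- 4 / S.
    apply: (@le_trans _ _ (n%:R * (q ^- 4 / s ^+ (3 + i)))).
      by apply: ler_pM; [done|pos|done|rewrite -div1r].
    by rewrite e3 nE le_eqVlt; apply/orP; left; apply/eqP; field; rewrite !gt_eqF.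
  have := lerD h1 i1'; rewrite -/S; lra0.
have p2 : sqrt m.+1%:R / sqrt t' ^+ (2 + i) <= 2 * g * c ^- 4 / S.
  apply: (@le_trans _ _ (2 * (g * s) * (c ^- 4 / s ^+ (2 + i)))).
    by apply: ler_pM; [exact: ltW|pos|done|rewrite -div1r].
  by rewrite e2 le_eqVlt; apply/orP; left; apply/eqP; field; rewrite !gt_eqF.
have p3 : 1 / sqrt t' ^+ (1 + i) / sqrt m.+1%:R <= c ^- 4 / S / (g * s).
  by apply: ler_pM; [pos|pos|done|done].
have By : 0 <= B * yp y by rewrite mulr_ge0 // ltW // yp_gt0.
have q4 : `|G 1%N (t + n%:R * v2) 0 * V0 x y - G 1%N t' 0 * V0 x y| <= v2 * c ^- 4 * C2 * g * (B * yp y) / S.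
  rewrite -mulrBl normrM.
  have h : `|G 1%N (t + n%:R * v2) 0 - G 1%N t' 0| <= B * (c ^- 4 / s ^+ (3 + i)) * (m%:R * v2).
    have -> : t + n%:R * v2 = t' + m%:R * v2 by rewrite /t' nmk natrD; ring.
    have := @mean_value_le R (fun t => G 1%N t 0) (fun t => G 3%N t 0 / 2) t' (t' + m%:R * v2) (B * (c ^- 4 / s ^+ (3 + i))).
    rewrite (_ : t' + m%:R * v2 - t' = m%:R * v2); last by ring.
    apply; first by rewrite lerDl mulr_ge0 // ltW.
      by move=> z /andP[hz _]; apply: (heat_dt HG) => //; exact: lt_le_trans hz.
    move=> z /andP[hz _]; rewrite normrM (ger0_norm (ltac:(by rewrite invr_ge0) : 0 <= (2 : R)^-1)).
    have h3 := heat_bd HG (k := 3%N) 0 isT (lt_le_trans t'0 hz).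
    have h4 := sqrt_pow_le (3 + i) B0 t'0 hz.
    have h5 : B / sqrt t' ^+ (3 + i) <= B * (c ^- 4 / s ^+ (3 + i)) by apply: ler_wpM2l => //; rewrite -div1r.
    move: h3 h4 h5 (normr_ge0 (G 3%N z 0)); lra0.
  apply: (@le_trans _ _ (B * (c ^- 4 / s ^+ (3 + i)) * (g * n%:R * v2) * (C2 * yp y))).
    apply: ler_pM => //; last exact: HC2.
    apply: le_trans h _; apply: ler_wpM2l; first by pos.
    apply: ler_wpM2r; first exact: ltW.
    apply: le_trans m1 _; apply: ler_wpM2r; first exact: ltW.
    by move: g0 g1; nra0.
  by rewrite e3 nE le_eqVlt; apply/orP; left; apply/eqP; field; rewrite !gt_eqF.
set X := K n (corr G t) x y in main *; set Y1 := G 1%N t' 0 * V0 x y in main q4; set Y2 := G 1%N _ 0 * V0 x y in q4 *.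
have -> : X - Y2 = (X - Y1) - (Y2 - Y1) by ring.
apply: le_trans (ler_normB _ _) _.
have main' := le_trans main (ler_wpM2l (ltac:(by pos) : 0 <= C1 * (B * yp y)) (lerD (lerD p1 p2) p3)).
apply: le_trans (lerD main' q4) _.
have -> : C1 * (B * yp y) * (2 * q ^- 4 / S / (g * s) + 2 * g * c ^- 4 / S + c ^- 4 / S / (g * s)) +
   v2 * c ^- 4 * C2 * g * (B * yp y) / S = (A1 / (g * s) + A2 * g) * ((B * yp y) / S).
  by rewrite /A1 /A2; field; rewrite !gt_eqF.
rewrite -[leRHS]mulrA; apply: ler_wpM2r; first by pos.
have : A1 / (g * s) <= eta / 2.
  rewrite ler_pdivrMr //; have : 2 * A1 / (g * eta) <= s by move: u1 u2 u3 hs; lra0.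
  by rewrite ler_pdivrMr; [lra0|pos].
by move: g2; lra0.
Qed.

Lemma walk_norm_le_pos n (u v : T -> R -> R) : (0 < n)%N -> (forall x (w : R), 0 < w -> `|u x w| <= v x w) ->
  forall x w, `|K n u x w| <= K n v x w.
Proof.
move=> n0 uv x w; rewrite ler_norml -mulN1r -walkZ; apply/andP; split.
  by apply: (walk_le_pos f Pst) => // x' w' /(uv x'); rewrite mulN1r ler_norml => /andP[].
by apply: (walk_le_pos f Pst) => // x' w' /(uv x'); rewrite ler_norml => /andP[].
Qed.

Lemma box_bound : exists2 C : R, 0 < C & forall n x (y D z : R), (0 < n)%N -> 0 <= D -> - F <= y ->
  K n (box z D) x y <= C * yp y * (1 + D) / n%:R.
Proof.
have [C1 C10 HC1] := survp_box Pst HH1 HH3 v20 F0.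
have [C2 C20 HC2] := survival Pst HH1 HH3 Hr Hrho v20 F0 HF.
exists (2 * C1 * C2); first by pos.
move=> n x y D z n0 D0 hy; apply: le_trans (HC1 n x y D z n0 D0 hy) _.
have n0' : 0 < n%:R :> R by rewrite ltr0n.
have s0 : 0 < sqrt n%:R :> R by rewrite sqrtr_gt0.
have nE : n%:R = sqrt n%:R * sqrt n%:R :> R by rewrite -expr2 sqr_sqrtr // ltW.
have y0 := yp_gt0 y.
have h : survp n./2 x y <= C2 * yp y * (2 / sqrt n%:R).
  apply: le_trans (HC2 _ x y hy) _; apply: ler_wpM2l; first by pos.
  exact: sqrt_half_inv.
have -> : 2 * C1 * C2 * yp y * (1 + D) / n%:R = C1 * (1 + D) / sqrt n%:R * (C2 * yp y * (2 / sqrt n%:R)).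
  by rewrite {1}nE; field; rewrite gt_eqF.
by apply: ler_wpM2l => //; pos.
Qed.

Lemma survival_sqrt : exists2 C : R, 0 < C & forall n x (y : R), (0 < n)%N -> - F <= y ->
  survp n x y <= C * yp y / sqrt n%:R.
Proof.
have [C C0 HC] := survival Pst HH1 HH3 Hr Hrho v20 F0 HF.
exists C => // n x y n0 hy; apply: le_trans (HC n x y hy) _.
have y0 := yp_gt0 y.
apply: ler_wpM2l; first by pos.
by rewrite lef_pV2 ?posrE ?sqrtr_gt0 ?ltr0n // ler_sqrt ?ler0n // ler_nat.
Qed.

(** The constant [c0 / 2] is compared with the error function at time [q^2 n]: they agree beyond a
    strip of width [K1 q sqrt n], whose surviving mass is [O(q / sqrt n)]. After [n] steps the slope
    at 0 is [1 / sqrt ((v2 + q^2) n)], so a small [q] gives the limit. *)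
Lemma survp_lim x (y eta : R) : - F <= y -> 0 < eta -> exists N, forall n, (N <= n)%N ->
  (0 < n)%N /\ `|c0 / 2 * survp n x y - V0 x y / sqrt v2 / sqrt n%:R| <= eta / sqrt n%:R.
Proof.
move=> hy eta0; have F0' := F0; have v20' := v20; have y1 := yp_ge1 y; have y0 := yp_gt0 y.
have [e [He e0 Hlim]] := erf_exists R.
have c01 := sqrt2pi_ge1 R; have c00 : 0 < c0 by exact: lt_le_trans c01.
have [B B0 HG] := heat_erf He.
have [B' B'0 HB'] := gaussd_bound R.
have Godd (t : R) : 0 < t -> erfh e 0 t 0 = 0 by move=> _; rewrite /erfh mul0r.
have [C1 C10 HC1] := box_bound.
have [C2 C20 HC2] := survival_sqrt.
have [C4 C40 HC4] := corr_close r rho.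
pose eta1 := Num.min (c0 / 2) (eta / (8 * (C2 * yp y))).
have eta10 : 0 < eta1 by rewrite lt_min; apply/andP; split; [lra|pos].
have eta1a : eta1 <= c0 / 2 by rewrite ge_min lexx.
have eta1b : eta1 * (C2 * yp y) <= eta / 8.
  have : eta1 <= eta / (8 * (C2 * yp y)) by rewrite ge_min lexx orbT.
  rewrite ler_pdivlMr; first lra.
  by pos.
have [K1' HK1'] := Hlim eta1 eta10.
pose K1 := Num.max K1' 1.
have K1K : K1' <= K1 by rewrite le_max lexx.
have K10 : 0 < K1 by rewrite lt_max ltr01 orbT.
have sv : 0 < sqrt v2 by rewrite sqrtr_gt0.
(* Collects the two errors linear in [q]: replacing [v2 + q^2] by [v2], and the mass of the
   strip. *)
pose D := B' / sqrt v2 ^+ 3 * (`|V0 x y| + 1) + 2 * c0 * C1 * K1 * yp y.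
have V1 : 0 < `|V0 x y| + 1 by exact: ltr_wpDl.
have D0 : 0 < D by rewrite /D; pos.
pose q := Num.min 1 (eta / (8 * D)).
have q0 : 0 < q by rewrite lt_min; apply/andP; split; [lra|pos].
have q1 : q <= 1 by rewrite ge_min lexx.
have qD : D * q <= eta / 8.
  have : q <= eta / (8 * D) by rewrite ge_min lexx orbT.
  rewrite ler_pdivlMr; first lra.
  by pos.
have By0 : 0 < B * yp y by pos.
have [N1 HN1] := killed_asym (ltac:(by rewrite exprn_gt0) : 0 < q ^+ 2) (ltac:(by pos) : 0 < eta / (8 * (B * yp y))).
pose A := C4 * B / q * (C2 * yp y) + c0 * C1 * yp y.
have A0 : 0 < A by rewrite /A; pos.
have [N2 HN2] := sqrt_large (yp y ^+ 2 + 1 / q + 8 * A / eta).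
exists (maxn N1 N2) => n; rewrite geq_max => /andP[/HN1 main /HN2[n0 hs]]; split=> //.
have n0' : 0 < n%:R :> R by rewrite ltr0n.
have s0 : 0 < sqrt n%:R :> R by rewrite sqrtr_gt0.
have hC1 := HC1 n x y; have hC2 := HC2 n x y n0 hy.
have yy0 : 0 <= yp y ^+ 2 by pos.
have q10 : 0 <= 1 / q by pos.
have Ae0 : 0 <= 8 * A / eta by pos.
have {main} main := main (q ^+ 2 * n%:R) (lexx _) _ _ _ HG (ltW B0) Godd isT x y hy
  (ltac:(move: hs yy0 q10 Ae0; lra0) : yp y ^+ 2 <= sqrt n%:R).
set s := sqrt n%:R in hs s0 main hC2 *.
have nE : n%:R = s * s by rewrite /s -expr2 sqr_sqrtr // ltW.
set t := q ^+ 2 * n%:R in main.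
have t0 : 0 < t by rewrite mulr_gt0 // exprn_gt0.
have st : sqrt t = q * s by rewrite /t sqrtrM ?exprn_ge0 ?(ltW q0) // sqrtr_sqr gtr0_norm.
have qs1 : 1 <= q * s.
  have : 1 / q <= s by move: hs yy0 q10 Ae0; lra0.
  by rewrite ler_pdivrMr // [s * q]mulrC.
have qs0 : 0 < q * s by rewrite mulr_gt0.
have t1 : 1 <= t.
  have -> : t = (q * s) ^+ 2 by rewrite /t nE; ring.
  by rewrite expr_ge1 // ltW.
have KD : 0 <= K1 * (q * s) by rewrite mulr_ge0 // ltW.
have pt x' (w : R) : 0 < w -> `|c0 / 2 * 1 - corr (erfh e) t x' w| <=
    (eta1 + C4 * B / (q * s)) * 1 + c0 * box 0 (K1 * (q * s)) x' w.
  move=> w0.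
  have h := HC4 _ _ _ HG (ltW B0) t x' w t1; rewrite addn0 expr1 st in h.
  have h2 : `|c0 / 2 - erfh e 0 t w| <= eta1 + c0 * box 0 (K1 * (q * s)) x' w.
    have -> : box 0 (K1 * (q * s)) x' w = ind (w <= K1 * (q * s)) :> R.
      by rewrite /box add0r (ltW w0).
    rewrite /erfh st; case: (lerP w (K1 * (q * s))) => h1.
      rewrite indT mulr1.
      have u1 : 0 <= e (w / (q * s)).
        by rewrite -e0; apply: erf_lb => //; rewrite divr_ge0 // ltW.
      have u2 : e (w / (q * s)) <= e K1.
        by apply: erf_lb => //; rewrite ler_pdivrMr.
      have := HK1' K1 K1K; rewrite !ler_norml => /andP[_ u3].
      move: u1 u2 u3 eta1a c01 eta10; clr => *; apply/andP; split; lra.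
    rewrite indF mulr0 addr0 distrC; apply: HK1'; apply: le_trans K1K _.
    by rewrite ler_pdivlMr // ltW.
  set a := corr _ _ _ _ in h *; set b := erfh e 0 t w in h h2.
  have -> : c0 / 2 * 1 - a = (c0 / 2 - b) - (a - b) by ring.
  apply: le_trans (ler_normB _ _) _.
  rewrite mulr1 [leRHS]addrAC; apply: lerD => //.
  by rewrite -mulrA.
have h1 : `|c0 / 2 * survp n x y - K n (corr (erfh e) t) x y| <=
    (eta1 + C4 * B / (q * s)) * survp n x y + c0 * K n (box 0 (K1 * (q * s))) x y.
  have E1 : c0 / 2 * survp n x y - K n (corr (erfh e) t) x y =
     K n (fun x w => c0 / 2 * 1 - corr (erfh e) t x w) x y by rewrite walkBf walkZ.
  have E2 : (eta1 + C4 * B / (q * s)) * survp n x y + c0 * K n (box 0 (K1 * (q * s))) x y =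
     K n (fun x w => (eta1 + C4 * B / (q * s)) * 1 + c0 * box 0 (K1 * (q * s)) x w) x y by rewrite walkDf !walkZ.
  by rewrite E1 E2; exact: walk_norm_le_pos.
have h2 : (eta1 + C4 * B / (q * s)) * survp n x y <= eta / 8 / s + C4 * B / q * (C2 * yp y) / s / s.
  apply: (@le_trans _ _ ((eta1 + C4 * B / (q * s)) * (C2 * yp y / s))).
    by apply: ler_wpM2l => //; pos.
  rewrite mulrDl; apply: lerD.
    by rewrite mulrA ler_wpM2r // invr_ge0 ltW.
  by rewrite le_eqVlt; apply/orP; left; apply/eqP; field; rewrite !gt_eqF.
have h3 : c0 * K n (box 0 (K1 * (q * s))) x y <= c0 * C1 * yp y / s / s + c0 * C1 * yp y * K1 * q / s.
  apply: le_trans (ler_wpM2l (ltW c00) (hC1 _ 0 n0 KD hy)) _.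
  by rewrite nE le_eqVlt; apply/orP; left; apply/eqP; field; rewrite !gt_eqF.
have h4 : `|gauss (t + n%:R * v2) 0 * V0 x y - V0 x y / sqrt v2 / s| <= B' / sqrt v2 ^+ 3 * (`|V0 x y| + 1) * q / s.
  have -> : t + n%:R * v2 = (v2 + q ^+ 2) * n%:R by rewrite /t; ring.
  have vq : 0 < v2 + q ^+ 2 by pos.
  rewrite gauss_scale // mul0r -/s.
  have -> : gauss (v2 + q ^+ 2) 0 / s * V0 x y - V0 x y / sqrt v2 / s =
     (gauss (v2 + q ^+ 2) 0 - gauss v2 0) * V0 x y / s by rewrite [gauss v2 0]gauss_at0; ring.
  rewrite !normrM [`|s^-1|]gtr0_norm ?invr_gt0 //; apply: ler_wpM2r; first by rewrite invr_ge0 ltW.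
  have -> : B' / sqrt v2 ^+ 3 * (`|V0 x y| + 1) * q = B' / sqrt v2 ^+ 3 * q * (`|V0 x y| + 1) by ring.
  apply: ler_pM => //; last by rewrite lerDl.
  apply: le_trans (gauss_time 0 B'0 HB' v20 (ltac:(by pos) : 0 <= q ^+ 2)) _.
  apply: ler_wpM2l; first by pos.
  by rewrite expr2 ler_piMl // ltW.
have m : eta / (8 * (B * yp y)) * (B * yp y) / s ^+ (1 + 0) = eta / 8 / s.
  by rewrite addn0 expr1; field; rewrite !gt_eqF.
rewrite m {m} in main.
have G1 : erfh e 1 (t + n%:R * v2) 0 = gauss (t + n%:R * v2) 0 by rewrite /erfh gaussd0.
rewrite G1 in main.
have qD' : B' / sqrt v2 ^+ 3 * (`|V0 x y| + 1) * q + c0 * C1 * yp y * K1 * q <= eta / 8.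
  apply: le_trans qD.
  have : 0 <= c0 * C1 * yp y * K1 * q by pos.
  rewrite /D; lra0.
have As : A / s <= eta / 8.
  rewrite ler_pdivrMr //; have : 8 * A / eta <= s by move: hs yy0 q10 Ae0; lra0.
  by rewrite ler_pdivrMr //; lra0.
have is0 : 0 <= s^-1 by rewrite invr_ge0 ltW.
have g1 : C4 * B / q * (C2 * yp y) / s / s + c0 * C1 * yp y / s / s <= eta / 8 / s.
  have -> : C4 * B / q * (C2 * yp y) / s / s + c0 * C1 * yp y / s / s = A / s / s by rewrite /A; ring.
  exact: ler_wpM2r.
have g2 : B' / sqrt v2 ^+ 3 * (`|V0 x y| + 1) * q / s + c0 * C1 * yp y * K1 * q / s <= eta / 8 / s.
  by rewrite -mulrDl; exact: ler_wpM2r.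
have eb : 0 <= eta / 8 / s by pos.
set a := c0 / 2 * survp n x y in h1 *; set b := K n _ x y in h1 main; set c := gauss _ 0 * _ in main h4.
have -> : a - V0 x y / sqrt v2 / s = (a - b) + (b - c) + (c - V0 x y / sqrt v2 / s) by ring.
apply: le_trans (ler_normD _ _) _; apply: le_trans (lerD (ler_normD _ _) (lexx _)) _.
move: h1 h2 h3 h4 main g1 g2 eb.
set X1 := _ * survp n x y; set X2 := c0 * K n _ x y; set Y1 := _ / s; set Y2 := _ / s / s; set Y3 := _ / s; set Y4 := _ / s; set Y5 := _ / s.
have -> : eta / s = 8 * Y1 by rewrite /Y1; field; rewrite gt_eqF.
by lra0.
Qed.

Lemma Vfun_eq nu x (y : R) : sigma2 P nu f = v2 -> - F <= y -> Vfun P nu f x y = V0 x y.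
Proof.
move=> Hs hy; have F0' := F0; have c01 := sqrt2pi_ge1 R.
have sv : 0 < sqrt v2 by rewrite sqrtr_gt0.
have c00 : 0 < c0 by exact: lt_le_trans c01.
have lim : ((fun n : nat => Num.sqrt n%:R * prob_surv P f n x y) @ \oo --> 2 * V0 x y / (c0 * sqrt v2))%classic.
  apply/cvgrPdist_le => eta eta0.
  have [N HN] := survp_lim x hy (ltac:(by pos) : 0 < c0 / 2 * eta).
  exists N => // n /= /HN[n0 h]; rewrite prob_survE.
  have n0' : 0 < n%:R :> R by rewrite ltr0n.
  have s0 : 0 < sqrt n%:R :> R by rewrite sqrtr_gt0.
  rewrite distrC; set s := sqrt n%:R in s0 h *.
  have -> : s * survp n x y - 2 * V0 x y / (c0 * sqrt v2) =
     2 / c0 * s * (c0 / 2 * survp n x y - V0 x y / sqrt v2 / s) by field; rewrite !gt_eqF.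
  rewrite normrM ger0_norm; last by pos.
  apply: le_trans (ler_wpM2l _ h) _; first by pos.
  by rewrite le_eqVlt; apply/orP; left; apply/eqP; field; rewrite !gt_eqF.
rewrite /Vfun /sigma Hs (cvg_lim _ lim) //.
by field; rewrite !gt_eqF.
Qed.

(** [box_bound] would give only [q ^+ 2]. The extra power reflects the vanishing of the surviving
    density at 0: the part of the strip above [q ^+ 3 sqrt m] is dominated by a multiple of an odd
    kernel, whose killed expectation is governed by its small slope at 0. *)
Lemma near_boundary : exists2 C : R, 0 < C & forall q : R, 0 < q -> q <= 1 ->
  exists N, forall m, (N <= m)%N -> forall x (y : R), - F <= y -> yp y ^+ 2 <= sqrt m%:R ->
  K m (box 0 (q ^+ 2 * sqrt m%:R)) x y <= C * q ^+ 3 * yp y / sqrt m%:R.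
Proof.
have F0' := F0; have v20' := v20.
have [B B0 HG] := heat_gausso R.
have [C1 C10 HC1] := box_bound.
have [C2 C20 HC2] := survival_sqrt.
have [C3 C30 HC3] := V0_bound.
have [C4 C40 HC4] := corr_close r rho.
have sv : 0 < sqrt v2 by rewrite sqrtr_gt0.
pose E := expR 1 : R.
have E0 : 0 < E by exact: expR_gt0.
exists (2 * C1 + E * B + 2 * E * C3 / (v2 * sqrt v2) + E * C4 * B * C2); first by pos.
move=> q q0 q1.
have q20 : 0 < q ^+ 2 by pos.
have [N1 HN1] := killed_asym (ltac:(by pos) : 0 < q ^+ 4) q20.
have [N2 HN2] := sqrt_large (1 / q ^+ 6).
exists (maxn N1 N2) => m; rewrite geq_max => /andP[/HN1 main /HN2[m0 hs]] x y hy hym.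
have y0 := yp_gt0 y.
have m0' : 0 < m%:R :> R by rewrite ltr0n.
have s0 : 0 < sqrt m%:R :> R by rewrite sqrtr_gt0.
have hC1 := HC1 m x y; have hC2 := HC2 m x y m0 hy.
have {main} main z := main (q ^+ 4 * m%:R) (lexx _) _ _ _ (HG z) (ltW B0)
  (fun t _ => gausso_odd z t) isT x y hy hym.
set s := sqrt m%:R in hs s0 main hC2 hym *.
have mE : m%:R = s * s by rewrite /s -expr2 sqr_sqrtr // ltW.
have qs6 : 1 <= q ^+ 6 * s by move: hs; rewrite ler_pdivrMr ?exprn_gt0 // mulrC.
(* The kernel has pole [b] and time [b ^+ 2]. On [[q b, b]] it is at least [q / (E b)], and the
   inverse of this is the factor [E q s] below. *)
pose b := q ^+ 2 * s.
have b0 : 0 < b by rewrite /b; pos.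
have tE : q ^+ 4 * m%:R = b ^+ 2 by rewrite /b mE; ring.
have sb : sqrt (b ^+ 2) = b by rewrite sqrtr_sqr gtr0_norm.
have q61 : q ^+ 6 <= q ^+ 2 by rewrite (exprD q 2 4) ler_piMr ?exprn_ile1 ?exprn_ge0 // ltW.
have b1 : 1 <= b by apply: le_trans qs6 _; rewrite /b ler_pM2r.
have bb1 : 1 <= b ^+ 2 by rewrite expr_ge1 // ltW.
have {main} main := main b; rewrite tE in main.
have q3s : 0 <= q ^+ 3 * s by pos.
have Eqs : 0 < E * q * s by pos.
have pt x' (w : R) : 0 < w -> box 0 (q ^+ 2 * s) x' w <= box 0 (q ^+ 3 * s) x' w +
    (E * q * s) * (corr (gausso b) (b ^+ 2) x' w + C4 * B / b ^+ 2 * 1).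
  move=> w0.
  have := HC4 _ _ _ (HG b) (ltW B0) (b ^+ 2) x' w bb1; rewrite sb ler_norml mulrA => /andP[h _].
  have g0 := gausso_ge0 (exprn_gt0 2 b0) (ltW b0) (ltW w0).
  have g1 : 0 <= corr (gausso b) (b ^+ 2) x' w + C4 * B / b ^+ 2 * 1.
    by rewrite mulr1; move: h g0; lra0.
  have bx L : box 0 L x' w = ind (w <= L) :> R by rewrite /box add0r (ltW w0).
  rewrite !bx; case: (lerP w (q ^+ 3 * s)) => h1.
    rewrite [ind true]indT; case: (w <= q ^+ 2 * s); rewrite ?[ind true]indT ?[ind false]indF.
      by rewrite lerDl; apply: mulr_ge0 => //; exact: ltW.
    by apply: addr_ge0 => //; apply: mulr_ge0 => //; exact: ltW.
  rewrite [ind false]indF add0r; case: (lerP w (q ^+ 2 * s)) => h2; last first.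
    by rewrite indF; apply: mulr_ge0 => //; exact: ltW.
  rewrite indT.
  have qb : q * b <= w <= b by rewrite /b h2 andbT mulrA -exprS ltW.
  have lb := gausso_lb b0 (ltW q0) qb.
  rewrite -ler_pdivrMl //.
  have -> : (E * q * s)^-1 * 1 = q / (expR 1 * b) by rewrite -/E /b; field; rewrite !gt_eqF.
  apply: le_trans lb _; rewrite mulr1; move: h; lra0.
have h1 : K m (box 0 (q ^+ 2 * s)) x y <= K m (box 0 (q ^+ 3 * s)) x y +
    (E * q * s) * (K m (corr (gausso b) (b ^+ 2)) x y + C4 * B / b ^+ 2 * survp m x y).
  apply: (@le_trans _ _ (K m (fun x' w => box 0 (q ^+ 3 * s) x' w +
    (E * q * s) * (corr (gausso b) (b ^+ 2) x' w + C4 * B / b ^+ 2 * 1)) x y)).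
    exact: (walk_le_pos f Pst).
  by rewrite walkDf walkZ walkDf walkZ.
have h2 : K m (box 0 (q ^+ 3 * s)) x y <= 2 * C1 * q ^+ 3 * yp y / s.
  apply: le_trans (hC1 _ 0 m0 q3s hy) _.
  have -> : 2 * C1 * q ^+ 3 * yp y / s = C1 * yp y * (q ^+ 3 * s + q ^+ 3 * s) / m%:R.
    by rewrite mE; field; rewrite gt_eqF.
  apply: ler_wpM2r; first by pos.
  apply: ler_wpM2l; first by pos.
  rewrite lerD2r; apply: le_trans qs6 _; rewrite ler_pM2r // (exprD q 3 3) ler_piMr ?exprn_ge0 ?exprn_ile1 // ltW //.
have h3 : K m (corr (gausso b) (b ^+ 2)) x y <= (2 * C3 / (v2 * sqrt v2) + B) * (q ^+ 2 * yp y / s ^+ 2).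
  move: main; rewrite ler_norml => /andP[_ main].
  have T0 : 0 < m%:R * v2 by pos.
  have TT : m%:R * v2 <= b ^+ 2 + m%:R * v2 by rewrite lerDr; pos.
  have TT0 := lt_le_trans T0 TT.
  have g : gausso b 1 (b ^+ 2 + m%:R * v2) 0 * V0 x y <= 2 * C3 / (v2 * sqrt v2) * (q ^+ 2 * yp y / s ^+ 2).
    have V1 : V0 x y <= C3 * yp y by apply: le_trans (ler_norm _) _; exact: HC3.
    rewrite gausso_slope.
    have gg : 2 * (b / (b ^+ 2 + m%:R * v2)) * gauss (b ^+ 2 + m%:R * v2) b <= 2 * (b / (m%:R * v2)) * (sqrt (m%:R * v2))^-1.
      apply: ler_pM; [by pos|exact: gauss_ge0| |].
        by apply: ler_wpM2l => //; apply: ler_wpM2l; rewrite ?lef_pV2 // ltW.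
      apply: le_trans (gauss_le _ TT0) _; rewrite lef_pV2 ?posrE ?sqrtr_gt0 //.
      by rewrite ler_sqrt // ltW.
    have gg0 : 0 <= 2 * (b / (b ^+ 2 + m%:R * v2)) * gauss (b ^+ 2 + m%:R * v2) b.
      by apply: mulr_ge0; [pos|exact: gauss_ge0].
    apply: le_trans (ler_wpM2l gg0 V1) _.
    have C3y : 0 <= C3 * yp y by pos.
    apply: le_trans (ler_wpM2r C3y gg) _.
    rewrite sqrtrM ?(ltW m0') // -/s mE /b.
    by rewrite le_eqVlt; apply/orP; left; apply/eqP; field; rewrite !gt_eqF.
  have -> : (2 * C3 / (v2 * sqrt v2) + B) * (q ^+ 2 * yp y / s ^+ 2) =
     2 * C3 / (v2 * sqrt v2) * (q ^+ 2 * yp y / s ^+ 2) + q ^+ 2 * (B * yp y) / s ^+ 2 by ring.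
  move: g main; rewrite -[(1 + 1)%N]/2%N; set a := _ * V0 x y; set c := _ * (_ / s ^+ 2); set d := _ / s ^+ 2; lra0.
have h4 : C4 * B / b ^+ 2 * survp m x y <= C4 * B * C2 * (q ^+ 2 * yp y / s ^+ 2).
  apply: (@le_trans _ _ (C4 * B / b ^+ 2 * (C2 * yp y / s))).
    by apply: ler_wpM2l => //; pos.
  have -> : C4 * B / b ^+ 2 * (C2 * yp y / s) = C4 * B * C2 * (yp y / s ^+ 2 * (1 / (q ^+ 4 * s))).
    by rewrite /b; field; rewrite !gt_eqF.
  apply: ler_wpM2l; first by pos.
  have -> : q ^+ 2 * yp y / s ^+ 2 = yp y / s ^+ 2 * q ^+ 2 by ring.
  apply: ler_wpM2l; first by pos.
  rewrite ler_pdivrMr; last by pos.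
  by rewrite mulrA -exprD.
apply: le_trans h1 _; apply: le_trans (lerD h2 (ler_wpM2l (ltW Eqs) (lerD h3 h4))) _.
rewrite le_eqVlt; apply/orP; left; apply/eqP; field; rewrite !gt_eqF //.
Qed.

Variable nu : T -> R.
Hypothesis nuP : invariant_prob P nu.
Variable a : R.
Hypothesis a0 : 0 < a.

Ltac clr ::= clear -Pst HH1 HH3 Hr Hrho v20 F0 HF CV0 HV nuP a0.

Definition unitf (psi : T -> R) : Prop := forall x, 0 <= psi x <= 1.

Lemma unitf_norm psi : unitf psi -> forall x, `|psi x| <= 1.
Proof. by move=> H x; have /andP[h1 h2] := H x; rewrite ger0_norm. Qed.

Lemma nuE_unitf psi : unitf psi -> 0 <= nuE nu psi <= 1.
Proof.
have [n0 [n1 _]] := nuP; move=> H; apply/andP; split.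
  by apply: sumr_ge0 => x _; have /andP[h1 h2] := H x; rewrite mulr_ge0.
by rewrite -n1; apply: ler_sum => x _; have /andP[h1 h2] := H x; rewrite ler_piMl.
Qed.

Lemma win_ge0 psi z b x w : unitf psi -> 0 <= win psi z b x w.
Proof. by move=> H; rewrite /win; case: ifP => // _; case/andP: (H x). Qed.

Lemma win_le_box psi z b x w : unitf psi -> win psi z b x w <= box z b x w.
Proof. by move=> H; rewrite /win /box; case: ifP => _; rewrite ?indT //; case/andP: (H x). Qed.

Lemma gauss_far (k s l u : R) : 0 < k -> 0 < s -> 0 < l -> l <= k ^+ 34 * (s * s) ->
  k ^+ 12 * s / 2 <= `|u| -> gauss (l * v2) u <= (16 * 16) * (v2 * sqrt v2) * (k ^+ 3 / s).
Proof.
move=> k0 s0 l0 hl hu; have v20' := v20.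
have sv : 0 < sqrt v2 by rewrite sqrtr_gt0.
have D0 : 0 < k ^+ 12 * s / 2 by pos.
have sl : sqrt l <= k ^+ 17 * s.
  have -> : k ^+ 17 * s = sqrt (k ^+ 34 * (s * s)).
    have -> : k ^+ 34 * (s * s) = (k ^+ 17 * s) ^+ 2 by ring.
    by rewrite sqrtr_sqr gtr0_norm //; pos.
  by rewrite ler_sqrt //; pos.
apply: le_trans (gauss_tail4 (ltac:(by pos) : 0 < l * v2) D0 hu) _.
rewrite sqrtrM ?(ltW l0) //.
have -> : (16 * 16) * (v2 * sqrt v2) * (k ^+ 3 / s) =
  16 * (k ^+ 34 * (s * s) * v2 * (k ^+ 17 * s * sqrt v2)) / (k ^+ 12 * s / 2) ^+ 4.
  by field; rewrite !gt_eqF.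
apply: ler_wpM2r; first by pos.
apply: ler_wpM2l => //.
by apply: ler_pM; [pos|pos|rewrite ler_wpM2r // ltW|rewrite ler_wpM2r // ltW].
Qed.

(** Two regimes of [j]. Up to [sqrt j.+1 <= k^27 sqrt n], [local_tail] gives [k^(27 - 24)]. Beyond,
    [j] is large enough for [llt], whose error [k^30 / sqrt j] is [O(k^3 / sqrt n)] and whose
    Gaussian is small by [gauss_far]. *)
Lemma below_window : exists2 C : R, 0 < C & forall k : R, 0 < k -> k <= 1 ->
  exists N, forall n, (N <= n)%N -> forall psi (z : R) l, unitf psi -> l%:R <= k ^+ 34 * n%:R ->
  k ^+ 12 * sqrt n%:R / 2 <= z -> forall j x (w : R), (j < l)%N -> w <= 0 ->
  Q j (win psi z a) x w <= C * (k ^+ 3 / sqrt n%:R).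
Proof.
have a0' := a0; have v20' := v20; have c01 := sqrt2pi_ge1 R.
have c00 : 0 < c0 by exact: lt_le_trans c01.
have sv : 0 < sqrt v2 by rewrite sqrtr_gt0.
have [C1 C10 HC1] := local_tail Pst HH1 HH3 Hr.
exists (4 * C1 * (1 + a) + 2 + (16 * 16) * a * (v2 * sqrt v2)); first by pos.
move=> k k0 k1.
have [N1 HN1] := llt Pst nuP HH1 HH3 Hr Hrho v20 a0 (ltac:(by pos) : 0 < k ^+ 30).
(* Guarantees that [j] exceeds the threshold [N1] of [llt] as soon as the first regime ends. *)
have [N2 HN2] := sqrt_large (sqrt (N1.+2)%:R / k ^+ 27).
exists N2 => n /HN2[n0 hs] psi z l Hpsi hl hz j x w jl w0.
have n0' : 0 < n%:R :> R by rewrite ltr0n.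
have s0 : 0 < sqrt n%:R :> R by rewrite sqrtr_gt0.
set s := sqrt n%:R in hs s0 hz *.
have nE : n%:R = s * s by rewrite /s -expr2 sqr_sqrtr // ltW.
have z0 : 0 < z by apply: lt_le_trans hz; pos.
have zw : z <= z - w by rewrite lerDl oppr_ge0.
have ks0 : 0 <= k ^+ 3 / s by pos.
case: (lerP (sqrt j.+1%:R) (k ^+ 27 * s)) => hj.
  apply: (@le_trans _ _ (4 * C1 * (1 + a) * (k ^+ 3 / s))); last first.
    by apply: ler_wpM2r => //; rewrite -addrA lerDl; pos.
  have h1 : Q j (win psi z a) x w <= Q j (box z a) x w.
    by apply: (walk_le f Pst) => x' w'; exact: win_le_box.
  apply: le_trans h1 _.
  apply: le_trans (HC1 j z a x w (ltW a0) (le_lt_trans w0 z0)) _.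
  have -> : 4 * C1 * (1 + a) * (k ^+ 3 / s) = C1 * (1 + a) * (k ^+ 27 * s) / (k ^+ 12 * s / 2) ^+ 2.
    by field; rewrite !gt_eqF.
  apply: ler_pM; [by pos|by rewrite invr_ge0 exprn_ge0 // (le_trans (ltW z0))| |].
    by apply: ler_wpM2l => //; pos.
  have D0 : 0 < k ^+ 12 * s / 2 by pos.
  have zw0 : 0 < z - w by exact: lt_le_trans zw.
  rewrite lef_pV2 ?posrE ?exprn_gt0 // lerXn2r // ?nnegrE ?(ltW D0) ?(ltW zw0) //.
  exact: le_trans hz zw.
have jN : (N1 < j)%N.
  have : sqrt N1.+2%:R < sqrt j.+1%:R :> R.
    by apply: le_lt_trans hj; move: hs; rewrite ler_pdivrMr ?exprn_gt0 // mulrC.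
  by rewrite ltr_sqrt ?ltr0n // ltr_nat ltnS => /ltnW.
have j0 : (0 < j)%N by exact: leq_ltn_trans jN.
have j0' : 0 < j%:R :> R by rewrite ltr0n.
have sj : k ^+ 27 * s / 2 <= sqrt j%:R.
  have : sqrt j.+1%:R <= 2 * sqrt j%:R :> R.
    have -> : 2 = sqrt 4 :> R by rewrite (_ : 4 = 2 ^+ 2); [rewrite sqrtr_sqr ger0_norm|ring].
    by rewrite -sqrtrM // ler_sqrt ?mulr_ge0 // -natrM ler_nat leq_succ4.
  by move: hj; lra0.
have h1 := HN1 j (ltnW jN) psi z x w (unitf_norm Hpsi).
have /andP[p0 p1] := nuE_unitf Hpsi.
have ljR : j%:R <= k ^+ 34 * (s * s) by rewrite -nE; apply: le_trans hl; rewrite ler_nat ltnW.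
have h2 : gauss (j%:R * v2) (w - z) <= (16 * 16) * (v2 * sqrt v2) * (k ^+ 3 / s).
  apply: gauss_far => //; rewrite -normrN opprB; apply: le_trans hz _; apply: le_trans zw (ler_norm _).
have h3 : k ^+ 30 / sqrt j%:R <= 2 * (k ^+ 3 / s).
  rewrite ler_pdivrMr ?sqrtr_gt0 //.
  have -> : k ^+ 30 = 2 * (k ^+ 3 / s) * (k ^+ 27 * s / 2) by field; rewrite gt_eqF.
  by apply: ler_wpM2l => //; pos.
have h4 : a * nuE nu psi * (gauss (j%:R * v2) (w - z) / c0) <= (16 * 16) * a * (v2 * sqrt v2) * (k ^+ 3 / s).
  have -> : (16 * 16) * a * (v2 * sqrt v2) * (k ^+ 3 / s) = a * ((16 * 16) * (v2 * sqrt v2) * (k ^+ 3 / s)) by ring.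
  apply: ler_pM; [by pos|by rewrite divr_ge0 ?gauss_ge0 // ltW|by rewrite ler_piMr // ltW|].
  rewrite ler_pdivrMr //; apply: le_trans h2 _; rewrite ler_peMr //; pos.
move: h1; rewrite ler_norml => /andP[_ h1].
have h5 : 0 <= 4 * C1 * (1 + a) * (k ^+ 3 / s) by pos.
rewrite !mulrDl; move: h1 h3 h4 h5; set A := _ / sqrt j%:R; set B := a * nuE nu psi * _; lra0.
Qed.

(** Killing is left unresolved only when the start [w] and the window are both near 0; there the
    height [1 / (k^17 sqrt n)] of the kernel is taken as the error. Otherwise either the window is
    far from 0 and killing changes little, or start and window are far apart and all terms are
    small. *)
Lemma kernel_approx : exists2 C : R, 0 < C & forall k : R, 0 < k -> k <= 1 ->
  exists N, forall n, (N <= n)%N -> forall psi (z : R) l, unitf psi -> 0 <= z ->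
  k ^+ 34 * n%:R / 2 <= l%:R -> l%:R <= k ^+ 34 * n%:R -> forall x (w : R), 0 < w ->
  `|K l (win psi z a) x w - a * nuE nu psi / c0 * gausso z 0 (l%:R * v2) w| <=
   C * (k / sqrt n%:R) + C / (k ^+ 17 * sqrt n%:R) * box 0 (k ^+ 12 * sqrt n%:R) x w.
Proof.
have a0' := a0; have v20' := v20; have c01 := sqrt2pi_ge1 R.
have c00 : 0 < c0 by exact: lt_le_trans c01.
have sv : 0 < sqrt v2 by rewrite sqrtr_gt0.
have [C1 C10 HC1] := below_window.
pose Cg := a * ((16 * 16) * (v2 * sqrt v2)).
have Cg0 : 0 < Cg by rewrite /Cg; pos.
exists (C1 + 2 + Cg + 2 * a / sqrt v2); first by pos.
move=> k k0 k1.
have [N1 HN1] := HC1 k k0 k1.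
(* The error [k^18 / sqrt l] becomes [2 k / sqrt n], because [sqrt l >= k^17 sqrt n / 2]. *)
have [N2 HN2] := llt Pst nuP HH1 HH3 Hr Hrho v20 a0 (ltac:(by pos) : 0 < k ^+ 18).
have [N3 HN3] := sqrt_large (2 * (N2.+1)%:R / k ^+ 34 + 1).
exists (maxn N1 N3) => n; rewrite geq_max => /andP[nN1 /HN3[n0 hs]] psi z l Hpsi z0 hl1 hl2 x w w0.
have n0' : 0 < n%:R :> R by rewrite ltr0n.
have s0 : 0 < sqrt n%:R :> R by rewrite sqrtr_gt0.
have low := HN1 n nN1 psi z l Hpsi hl2.
set s := sqrt n%:R in hs s0 low *.
have nE : n%:R = s * s by rewrite /s -expr2 sqr_sqrtr // ltW.
have k34 : 0 < k ^+ 34 by pos.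
have N20 : 0 <= 2 * N2.+1%:R / k ^+ 34 by pos.
have s1 : 1 <= s by move: hs N20; lra0.
have lN : (N2 < l)%N.
  rewrite -(ltr_nat R); apply: lt_le_trans hl1; rewrite ltr_pdivlMr // mulrC.
  apply: (@lt_le_trans _ _ (2 * N2.+1%:R)); first by rewrite ltr_pM2l // ltr_nat.
  have : 2 * N2.+1%:R / k ^+ 34 <= s by move: hs; lra0.
  rewrite ler_pdivrMr // => h; apply: le_trans h _; rewrite mulrC ler_pM2l // nE ler_peMl // ltW //.
have l0 : 0 < l%:R :> R by rewrite ltr0n (leq_ltn_trans _ lN).
have sl : k ^+ 17 * s / 2 <= sqrt l%:R.
  have -> : k ^+ 17 * s / 2 = sqrt ((k ^+ 17 * s / 2) ^+ 2) by rewrite sqrtr_sqr gtr0_norm //; pos.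
  rewrite ler_sqrt ?(ltW l0) //; apply: le_trans hl1.
  have -> : (k ^+ 17 * s / 2) ^+ 2 = k ^+ 34 * n%:R / 4 by rewrite nE; field.
  have : 0 <= k ^+ 34 * n%:R by pos.
  by lra0.
rewrite nE in hl2.
have sl0 : 0 < sqrt l%:R :> R by rewrite sqrtr_gt0.
have /andP[p0 p1] := nuE_unitf Hpsi.
pose c := a * nuE nu psi / c0.
have cge : 0 <= c by rewrite /c; pos.
have cle : c <= a.
  by rewrite /c ler_pdivrMr //; apply: (@le_trans _ _ (a * 1)); [rewrite ler_pM2l|rewrite ler_pM2l].
pose g1 := c * gauss (l%:R * v2) (w - z); pose g2 := c * gauss (l%:R * v2) (w + z).
have gE : a * nuE nu psi / c0 * gausso z 0 (l%:R * v2) w = g1 - g2.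
  by rewrite /gausso !gaussd0 mulrBr.
have g20 : 0 <= g2 by rewrite mulr_ge0 ?gauss_ge0.
have g12 : g2 <= g1.
  rewrite -subr_ge0 -gE mulr_ge0 //; apply: gausso_ge0 => //; [by pos|exact: ltW].
have h1 := HN2 l (ltnW lN) psi z x w (unitf_norm Hpsi).
have g1E : a * nuE nu psi * (gauss (l%:R * v2) (w - z) / c0) = g1 by rewrite /g1 /c; ring.
rewrite g1E in h1.
have h3 : k ^+ 18 / sqrt l%:R <= 2 * (k / s).
  rewrite ler_pdivrMr //.
  have -> : k ^+ 18 = 2 * (k / s) * (k ^+ 17 * s / 2) by field; rewrite gt_eqF.
  by apply: ler_wpM2l => //; pos.
have h4 := le_trans h1 h3.
have W0 : 0 <= K l (win psi z a) x w by apply: (walk_ge0 f Pst) => x' w'; exact: win_ge0.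
have WW : K l (win psi z a) x w <= Q l (win psi z a) x w.
  by apply: (walk_kill_le f Pst) => x' w'; exact: win_ge0.
have ks0 : 0 <= k / s by pos.
have k3 : k ^+ 3 / s <= k / s.
  by rewrite ler_wpM2r ?invr_ge0 ?(ltW s0) // exprS ler_piMr ?exprn_ile1 // ltW.
have far u : k ^+ 12 * s / 2 <= `|u| -> c * gauss (l%:R * v2) u <= Cg * (k / s).
  move=> hu; have h := gauss_far k0 s0 l0 hl2 hu.
  have -> : Cg * (k / s) = a * ((16 * 16) * (v2 * sqrt v2) * (k / s)) by rewrite /Cg; ring.
  apply: ler_pM => //; first exact: gauss_ge0.
  by apply: le_trans h _; apply: ler_wpM2l => //; pos.
have bx : box 0 (k ^+ 12 * s) x w = ind (w <= k ^+ 12 * s) :> R by rewrite /box add0r (ltW w0).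
have box0 := box_ge0 0 (k ^+ 12 * s) x w.
have av0 : 0 <= 2 * a / sqrt v2 by pos.
have Cb0 : 0 <= (C1 + 2 + Cg + 2 * a / sqrt v2) / (k ^+ 17 * s) by pos.
rewrite gE; move: W0 WW h4; set W := K l _ x w; set W' := Q l _ x w => W0 WW h4.
have C1k : 0 <= C1 * (k / s) by pos.
have Cgk : 0 <= Cg * (k / s) by pos.
have avk : 0 <= 2 * a / sqrt v2 * (k / s) by pos.
(* For a window away from 0, paths coming back from the nonpositive half-line contribute little, and
   so does the image term [g2]. *)
case: (lerP (k ^+ 12 * s / 2) z) => hz.
  have M : W' - W <= C1 * (k / s).
    apply: (kill_sup Pst) => //; first by move=> x' w'; exact: win_ge0.
    move=> j x' w' jl w'0; apply: le_trans (low hz j x' w' jl w'0) _.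
    by apply: ler_wpM2l => //; exact: ltW.
  have M2 : g2 <= Cg * (k / s).
    by apply: far; rewrite ger0_norm ?addr_ge0 ?(ltW w0) // (le_trans hz) // lerDr ltW.
  apply: (@le_trans _ _ ((C1 + 2 + Cg + 2 * a / sqrt v2) * (k / s))); last by rewrite lerDl mulr_ge0.
  rewrite !mulrDl; move: h4; rewrite !ler_norml => /andP[h4 h4'].
  move: W0 WW h4 h4' M M2 g20 g12 avk; clr => *; apply/andP; split; lra.
have key : `|W - (g1 - g2)| <= g1 + 2 * (k / s).
  move: h4; rewrite !ler_norml => /andP[h4 h4'].
  move: W0 WW h4 h4' g20 g12 ks0; clr => *; apply/andP; split; lra.
apply: le_trans key _; rewrite bx; case: (lerP w (k ^+ 12 * s)) => hw.
  rewrite indT mulr1.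
  have M : g1 <= 2 * a / sqrt v2 / (k ^+ 17 * s).
    have -> : 2 * a / sqrt v2 / (k ^+ 17 * s) = a * (k ^+ 17 * s / 2 * sqrt v2)^-1 by field; rewrite !gt_eqF.
    apply: ler_pM => //; first exact: gauss_ge0.
    apply: le_trans (gauss_le _ _) _; first by pos.
    rewrite sqrtrM ?(ltW l0) // lef_pV2 ?posrE; [by rewrite ler_wpM2r // ltW|by pos|by pos].
  have M' : 0 <= (C1 + 2 + Cg) / (k ^+ 17 * s) by pos.
  have -> : (C1 + 2 + Cg + 2 * a / sqrt v2) * (k / s) + (C1 + 2 + Cg + 2 * a / sqrt v2) / (k ^+ 17 * s) =
    C1 * (k / s) + 2 * (k / s) + Cg * (k / s) + 2 * a / sqrt v2 * (k / s) +
    ((C1 + 2 + Cg) / (k ^+ 17 * s) + 2 * a / sqrt v2 / (k ^+ 17 * s)) by ring.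
  move: M M' C1k Cgk avk.
  set A := 2 * a / sqrt v2 / _; set A1 := (C1 + _ + _) / _; set A3 := C1 * _; set A4 := Cg * _; set A5 := _ * (k / s); lra0.
(* Here [z] is below half the width of the strip and [w] above the full width, so their distance is
   at least half the width. *)
have M : g1 <= Cg * (k / s).
  by apply: far; apply: le_trans (ler_norm _); move: hz hw; lra0.
rewrite indF mulr0 addr0 !mulrDl; move: M C1k avk; lra0.
Qed.

Lemma box_widen (D D' : R) : D <= D' -> forall (x : T) (w : R), box 0 D x w <= box 0 D' x w.
Proof.
move=> DD x w; rewrite /box !add0r; case: (boolP (0 <= w <= D)) => [/andP[h1 h2]|_].
  by rewrite h1 (le_trans h2 DD).
by rewrite indF ind_ge0.
Qed.

Theorem local_limit : exists2 C : R, 0 < C & forall k : R, 0 < k -> k <= 1 / 2 ->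
  exists N, forall n, (N <= n)%N -> forall psi (z : R) x (y : R), unitf psi -> 0 <= z -> - F <= y ->
  2 * yp y ^+ 2 <= sqrt n%:R ->
  `|K n (win psi z a) x y - a * nuE nu psi / c0 * (gausso z 1 (n%:R * v2) 0 * V0 x y)| <=
   C * k * yp y / n%:R.
Proof.
have a0' := a0; have v20' := v20; have c01 := sqrt2pi_ge1 R.
have c00 : 0 < c0 by exact: lt_le_trans c01.
have [B B0 HG] := heat_gausso R.
have [C1 C10 HC1] := kernel_approx.
have [C2 C20 HC2] := survival_sqrt.
have [C3 C30 HC3] := near_boundary.
have [C4 C40 HC4] := corr_close r rho.
exists (2 * C1 * C2 + 16 * (C1 * C3) + a + 4 * (a * B)); first by pos.
move=> k k0 k12.
have k1 : k <= 1 by move: k12; lra0.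
have k60 : 0 < k ^+ 6 by pos.
have k61 : 2 * k ^+ 6 <= 1.
  have : k ^+ 6 <= k by rewrite exprS ler_piMr ?exprn_ile1 // ltW.
  by move: k12; lra0.
have k340 : 0 < k ^+ 34 by pos.
have k341 : k ^+ 34 <= 1 / 2.
  by apply: le_trans k12; rewrite exprS ler_piMr ?exprn_ile1 // ltW.
have [N1 HN1] := HC1 k k0 k1.
(* With [q = 2 k^6] the strip of width [q^2 sqrt m] covers [k^12 sqrt n], as [sqrt n <= 2 sqrt m].
   Its mass [O(k^18 / sqrt n)] times the error [O(1 / (k^17 sqrt n))] leaves [k / n]. *)
have [N2 HN2] := HC3 (2 * k ^+ 6) (ltac:(by pos)) k61.
have [N3 HN3] := killed_asym (ltac:(by pos) : 0 < v2 * k ^+ 34 / 2) k0.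
(* Inserting the correctors costs [A / sqrt n] times the allowed [k yp y / n], whence the
   requirement [A <= sqrt n]. *)
pose A := 4 * C4 * B * C2 / (v2 * k ^+ 34) / k.
have A0 : 0 < A by rewrite /A; pos.
have [N4 HN4] := sqrt_large (2 / k ^+ 34 + 2 / (v2 * k ^+ 34) + A + 1).
exists (maxn (maxn N1 (2 * maxn N2 N3)) N4) => n; rewrite !geq_max => /andP[/andP[nN1 nN23] /HN4[n0 hs]].
move=> psi z x y Hpsi z0 hy hyn.
have n0' : 0 < n%:R :> R by rewrite ltr0n.
have s0 : 0 < sqrt n%:R :> R by rewrite sqrtr_gt0.
have ker := HN1 n nN1 psi z; set s := sqrt n%:R in hs s0 hyn ker.
have nE : n%:R = s * s by rewrite /s -expr2 sqr_sqrtr // ltW.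
have y0 := yp_gt0 y.
have u1 : 0 <= 2 / k ^+ 34 by pos.
have u2 : 0 <= 2 / (v2 * k ^+ 34) by pos.
have s1 : 1 <= s by move: hs u1 u2 A0; lra0.
have sA : A <= s by move: hs u1 u2 A0; lra0.
have ss : s <= n%:R by rewrite nE ler_peMl // ltW.
have kn2 : 2 <= k ^+ 34 * n%:R.
  have : 2 / k ^+ 34 <= n%:R by apply: le_trans ss; move: hs u1 u2 A0; lra0.
  by rewrite ler_pdivrMr // mulrC.
have kvn2 : 2 <= v2 * k ^+ 34 * n%:R.
  have : 2 / (v2 * k ^+ 34) <= n%:R by apply: le_trans ss; move: hs u1 u2 A0; lra0.
  by rewrite ler_pdivrMr ?mulr_gt0 // mulrC.
have kn0 : 0 <= k ^+ 34 * n%:R by pos.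
have /andP[l1 l2] := Num.Theory.truncn_itv kn0.
set l := Num.truncn _ in l1 l2.
have hl1 : k ^+ 34 * n%:R / 2 <= l%:R.
  have l2' : k ^+ 34 * n%:R < l%:R + 1 by rewrite natr1.
  by move: l2' kn2; lra0.
have hln : l%:R <= n%:R / 2 :> R.
  by apply: le_trans l1 _; rewrite [n%:R / 2]mulrC ler_pM2r // -[2^-1]mul1r.
have ln : (l <= n)%N by rewrite -(ler_nat R); move: hln n0'; lra0.
pose m := (n - l)%N.
have nml : n = (m + l)%N by rewrite subnK.
have mR : m%:R = n%:R - l%:R :> R by rewrite natrB.
have m2 : n%:R <= 2 * m%:R :> R by rewrite mR; move: hln; lra0.
have mn : m%:R <= n%:R :> R by rewrite ler_nat leq_subr.
have mN : (maxn N2 N3 <= m)%N.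
  by rewrite -(leq_pmul2l (isT : (0 < 2)%N)); apply: leq_trans nN23 _; rewrite -(ler_nat R) natrM.
move: mN; rewrite geq_max => /andP[/HN2 nb /HN3 ka].
have m0' : 0 < m%:R :> R by move: m2 n0'; lra0.
have m0 : (0 < m)%N by rewrite -(ltr_nat R).
have sm0 : 0 < sqrt m%:R :> R by rewrite sqrtr_gt0.
have sm : s <= 2 * sqrt m%:R.
  have -> : 2 = sqrt 4 :> R by rewrite (_ : 4 = 2 ^+ 2); [rewrite sqrtr_sqr ger0_norm|ring].
  by rewrite -sqrtrM // ler_sqrt; [move: m2 m0'; lra0|pos].
have ism : (sqrt m%:R)^-1 <= 2 / s.
  by rewrite -[leLHS]mul1r ler_pdivrMr // mulrAC ler_pdivlMr // mul1r.
have hym : yp y ^+ 2 <= sqrt m%:R by move: hyn sm; lra0.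
have sur : survp m x y <= 2 * C2 * yp y / s.
  apply: le_trans (HC2 m x y m0 hy) _.
  have -> : 2 * C2 * yp y / s = C2 * yp y * (2 / s) by ring.
  by apply: ler_wpM2l => //; pos.
have nbd : K m (box 0 (k ^+ 12 * s)) x y <= 16 * C3 * k ^+ 18 * yp y / s.
  apply: (@le_trans _ _ (K m (box 0 ((2 * k ^+ 6) ^+ 2 * sqrt m%:R)) x y)).
    apply: (walk_le f Pst) => x' w'; apply: box_widen.
    have -> : (2 * k ^+ 6) ^+ 2 * sqrt m%:R = k ^+ 12 * (2 * (2 * sqrt m%:R)) by ring.
    by apply: ler_wpM2l; [pos|move: sm sm0; lra0].
  apply: le_trans (nb x y hy hym) _.
  have -> : 16 * C3 * k ^+ 18 * yp y / s = C3 * (2 * k ^+ 6) ^+ 3 * yp y * (2 / s) by ring.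
  by apply: ler_wpM2l => //; pos.
have l0' : 0 < l%:R :> R by move: hl1 kn2; lra0.
pose t := l%:R * v2.
have t1 : 1 <= t.
  have := ler_wpM2r (ltW v20) hl1; rewrite -/t.
  have -> : k ^+ 34 * n%:R / 2 * v2 = v2 * k ^+ 34 * n%:R / 2 by ring.
  by move: kvn2; lra0.
have t0 : 0 < t by rewrite /t; pos.
have tm : v2 * k ^+ 34 / 2 * m%:R <= t.
  have -> : v2 * k ^+ 34 / 2 * m%:R = (k ^+ 34 * m%:R / 2) * v2 by ring.
  apply: ler_wpM2r; first exact: ltW.
  by apply: le_trans hl1; rewrite ler_pM2r // ler_pM2l.
have {ka} ka := ka t tm _ _ _ (HG z) (ltW B0) (fun t _ => gausso_odd z t) isT x y hy hym.
have tmn : t + m%:R * v2 = n%:R * v2 by rewrite /t nml natrD; ring.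
rewrite tmn in ka.
have /andP[p0 p1] := nuE_unitf Hpsi.
pose c := a * nuE nu psi / c0.
have cge : 0 <= c by rewrite /c; pos.
have cle : c <= a.
  by rewrite /c ler_pdivrMr //; apply: (@le_trans _ _ (a * 1)); [rewrite ler_pM2l|rewrite ler_pM2l].
rewrite -/c; pose G0 : T -> R -> R := fun _ w => gausso z 0 t w.
have e1 : `|K n (win psi z a) x y - c * K m G0 x y| <= (2 * C1 * C2 + 16 * (C1 * C3)) * (k * yp y / n%:R).
  have h : `|K m (fun x w => K l (win psi z a) x w - c * G0 x w) x y| <=
     K m (fun x w => C1 * (k / s) * 1 + C1 / (k ^+ 17 * s) * box 0 (k ^+ 12 * s) x w) x y.
    apply: walk_norm_le_pos => // x' w w0; rewrite mulr1; exact: ker.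
  have E1 : K m (fun x w => K l (win psi z a) x w - c * G0 x w) x y = K n (win psi z a) x y - c * K m G0 x y.
    by rewrite walkBf (walkZ P f true m c G0) nml walkD.
  have E2 : K m (fun x w => C1 * (k / s) * 1 + C1 / (k ^+ 17 * s) * box 0 (k ^+ 12 * s) x w) x y =
     C1 * (k / s) * survp m x y + C1 / (k ^+ 17 * s) * K m (box 0 (k ^+ 12 * s)) x y.
    by rewrite walkDf (walkZ P f true m (C1 * (k / s)) (fun _ _ => 1)) (walkZ P f true m (C1 / (k ^+ 17 * s)) (box 0 (k ^+ 12 * s))).
  rewrite E1 E2 in h; apply: le_trans h _.
  have q1 : C1 * (k / s) * survp m x y <= C1 * (k / s) * (2 * C2 * yp y / s) by apply: ler_wpM2l => //; pos.
  have q2 : C1 / (k ^+ 17 * s) * K m (box 0 (k ^+ 12 * s)) x y <= C1 / (k ^+ 17 * s) * (16 * C3 * k ^+ 18 * yp y / s).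
    by apply: ler_wpM2l => //; pos.
  apply: le_trans (lerD q1 q2) _.
  by rewrite nE le_eqVlt; apply/orP; left; apply/eqP; field; rewrite !gt_eqF.
have e2 : `|K m G0 x y - K m (corr (gausso z) t) x y| <= k * yp y / n%:R.
  have h : `|K m (fun x w => G0 x w - corr (gausso z) t x w) x y| <= K m (fun _ _ => C4 * (B / t) * 1) x y.
    apply: (walk_norm_le f Pst) => x' w'; rewrite mulr1 distrC.
    have := HC4 _ _ _ (HG z) (ltW B0) t x' w' t1.
    by rewrite sqr_sqrtr // ltW.
  rewrite walkBf (walkZ P f true m (C4 * (B / t)) (fun _ _ => 1)) -/(survp m x y) in h; apply: le_trans h _.
  apply: (@le_trans _ _ (C4 * (B / (k ^+ 34 * n%:R / 2 * v2)) * (2 * C2 * yp y / s))).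
    apply: ler_pM => //; [by pos|exact: survp_ge0|].
    apply: ler_wpM2l; first exact: ltW.
    apply: ler_wpM2l; first exact: ltW.
    by rewrite lef_pV2 ?posrE //; [rewrite ler_pM2r|pos].
  have -> : C4 * (B / (k ^+ 34 * n%:R / 2 * v2)) * (2 * C2 * yp y / s) = k * yp y / n%:R * (A / s).
    by rewrite /A; field; rewrite !gt_eqF.
  by rewrite ler_piMr //; [pos|rewrite ler_pdivrMr // mul1r].
have e3 : `|K m (corr (gausso z) t) x y - gausso z 1 (n%:R * v2) 0 * V0 x y| <= 4 * B * (k * yp y / n%:R).
  apply: le_trans ka _.
  rewrite sqr_sqrtr ?(ltW m0') //.
  have -> : 4 * B * (k * yp y / n%:R) = k * (B * yp y) * (4 / n%:R) by ring.
  apply: ler_wpM2l; first by pos.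
  rewrite -[leLHS]mul1r ler_pdivrMr // mulrAC ler_pdivlMr // mul1r.
  by move: m2 m0'; lra0.
have e23 : c * (`|K m G0 x y - K m (corr (gausso z) t) x y| +
     `|K m (corr (gausso z) t) x y - gausso z 1 (n%:R * v2) 0 * V0 x y|) <= (a + 4 * (a * B)) * (k * yp y / n%:R).
  have -> : (a + 4 * (a * B)) * (k * yp y / n%:R) = a * (k * yp y / n%:R + 4 * B * (k * yp y / n%:R)) by ring.
  by apply: ler_pM; [done|exact: addr_ge0|done|exact: lerD].
have -> : (2 * C1 * C2 + 16 * (C1 * C3) + a + 4 * (a * B)) * k * yp y / n%:R =
  (2 * C1 * C2 + 16 * (C1 * C3)) * (k * yp y / n%:R) + (a + 4 * (a * B)) * (k * yp y / n%:R) by ring.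
set X := K n _ x y in e1 *; set X1 := K m G0 x y in e1 e23 *; set X2 := K m _ x y in e23 *; set X3 := _ * V0 x y in e23 *.
have -> : X - c * X3 = (X - c * X1) + c * ((X1 - X2) + (X2 - X3)) by ring.
apply: le_trans (ler_normD _ _) _; apply: lerD => //; apply: le_trans e23.
by rewrite normrM (ger0_norm cge); apply: ler_wpM2l => //; exact: ler_normD.
Qed.

(** Each of the two terms has this order by itself. It serves the small [n] and the large [y] that
    [local_limit] does not reach. *)
Lemma crude_bound : exists2 C : R, 0 < C & forall n psi (z : R) x (y : R), (0 < n)%N -> unitf psi ->
  0 <= z -> - F <= y ->
  `|K n (win psi z a) x y - a * nuE nu psi / c0 * (gausso z 1 (n%:R * v2) 0 * V0 x y)| <= C * yp y / n%:R.
Proof.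
have a0' := a0; have v20' := v20; have c01 := sqrt2pi_ge1 R.
have c00 : 0 < c0 by exact: lt_le_trans c01.
have [B B0 HG] := heat_gausso R.
have [C1 C10 HC1] := box_bound.
have [C3 C30 HC3] := V0_bound.
exists (C1 * (1 + a) + a * B * C3 / v2); first by pos.
move=> n psi z x y n0 Hpsi z0 hy.
have n0' : 0 < n%:R :> R by rewrite ltr0n.
have y0 := yp_gt0 y.
have /andP[p0 p1] := nuE_unitf Hpsi.
pose c := a * nuE nu psi / c0.
have cge : 0 <= c by rewrite /c; pos.
have cle : c <= a.
  by rewrite /c ler_pdivrMr //; apply: (@le_trans _ _ (a * 1)); [rewrite ler_pM2l|rewrite ler_pM2l].
rewrite -/c; apply: le_trans (ler_normB _ _) _.
have -> : (C1 * (1 + a) + a * B * C3 / v2) * yp y / n%:R =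
  C1 * yp y * (1 + a) / n%:R + a * (B / (n%:R * v2) * (C3 * yp y)) by field; rewrite !gt_eqF.
apply: lerD.
  rewrite ger0_norm; last by apply: (walk_ge0 f Pst) => x' w'; exact: win_ge0.
  apply: le_trans (HC1 n x y a z n0 (ltW a0) hy).
  by apply: (walk_le f Pst) => x' w'; exact: win_le_box.
rewrite normrM (ger0_norm cge) normrM.
apply: ler_pM; [done|exact: mulr_ge0|done|].
apply: ler_pM; [done|done| |exact: HC3].
have T0 : 0 < n%:R * v2 by pos.
by have := heat_bd (HG z) (k := 1) 0 isT T0; rewrite sqr_sqrtr // ltW.
Qed.

(** [local_limit] is taken at [k = sqrt eps]. When it is not applied, either [n] is below a
    threshold depending on [eps] or [yp y > n^eps]; in both cases [ceps eps * yp y / n^eps >= 1] and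
    [crude_bound] suffices. *)
Lemma uniform_bound : exists c : R, 0 < c /\ exists ceps : R -> R,
  (forall eps, 0 < eps < 1 / 8 -> 0 < ceps eps) /\ forall eps : R, 0 < eps < 1 / 8 ->
  forall psi (y : R) n x (z : R), unitf psi -> (0 < n)%N -> 0 <= z -> - F <= y ->
  n%:R * `|K n (win psi z a) x y - a * nuE nu psi / c0 * (gausso z 1 (n%:R * v2) 0 * V0 x y)| <=
  c * yp y * (sqrt eps + ceps eps * yp y / (n%:R `^ eps)).
Proof.
have [C1 C10 HC1] := local_limit; have [C2 C20 HC2] := crude_bound.
have ex (eps : R) : exists N : nat, 0 < eps < 1 / 8 -> forall n, (N <= n)%N ->
    forall psi (z : R) x (y : R), unitf psi -> 0 <= z -> - F <= y -> 2 * yp y ^+ 2 <= sqrt n%:R ->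
    `|K n (win psi z a) x y - a * nuE nu psi / c0 * (gausso z 1 (n%:R * v2) 0 * V0 x y)| <=
    C1 * sqrt eps * yp y / n%:R.
  case: (boolP (0 < eps < 1 / 8)) => [/andP[e0 e1]|_]; last by exists 0%N.
  have se : 0 < sqrt eps by rewrite sqrtr_gt0.
  have se2 : sqrt eps <= 1 / 2.
    have -> : 1 / 2 = sqrt ((1 / 2) ^+ 2) :> R by rewrite sqrtr_sqr ger0_norm // divr_ge0.
    by rewrite ler_sqrt ?exprn_ge0 ?divr_ge0 //; lra.
  by have [N HN] := HC1 _ se se2; exists N.
have [Nf HN] := choice ex.
exists (C1 + C2); split; first by pos.
(* The 16 ensures [sqrt n >= 4], which absorbs the 4 of [(2 * yp y ^+ 2) ^+ 2]. *)
exists (fun eps => (Nf eps + 16)%N%:R + 1); split; first by move=> eps _; exact: ltr_wpDl.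
move=> eps he psi y n x z Hpsi n0 z0 hy; have /andP[e0 e1] := he.
have n0' : 0 < n%:R :> R by rewrite ltr0n.
have n1 : 1 <= n%:R :> R by rewrite ler1n.
have y1 := yp_ge1 y; have y0 := yp_gt0 y.
set D := `|_|; set q := n%:R `^ eps; set ce := (_ + 1 : R).
have q0 : 0 < q by exact: powR_gt0.
have ce1 : 1 <= ce by rewrite /ce lerDr.
have se0 : 0 <= sqrt eps by exact: sqrtr_ge0.
have key : D <= C1 * sqrt eps * yp y / n%:R \/ (D <= C2 * yp y / n%:R /\ 1 <= ce * yp y / q).
  case: (leqP (Nf eps + 16) n) => hn; last first.
    right; split; first exact: HC2.
    rewrite ler_pdivlMr // mul1r.
    have qn : q <= n%:R.
      rewrite -[leRHS]powRr1 ?(ltW n0') //; apply: ler_powR => //; lra.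
    have nc : n%:R <= ce.
      by apply: (@le_trans _ _ (Nf eps + 16)%N%:R); [rewrite ler_nat ltnW|rewrite /ce lerDl].
    apply: le_trans qn _; apply: le_trans nc _; rewrite ler_peMr //; lra.
  case: (lerP (yp y) q) => hq; last first.
    right; split; first exact: HC2.
    rewrite ler_pdivlMr // mul1r; apply: le_trans (ltW hq) _; rewrite ler_peMl //; exact: ltW.
  left; apply: (HN eps he) => //; first exact: leq_trans (leq_addr _ _) hn.
  have s0 : 0 < sqrt n%:R :> R by rewrite sqrtr_gt0.
  have s4 : 4 <= sqrt n%:R :> R.
    have -> : 4 = sqrt (4 ^+ 2) :> R by rewrite sqrtr_sqr ger0_norm.
    rewrite ler_sqrt ?(ltW n0') // -natrX ler_nat; exact: leq_trans (leq_addl _ _) hn.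
  (* The bound 1/8 on [eps] enters here, as [4 eps <= 1/2]. *)
  have q4 : q ^+ 4 <= sqrt n%:R.
    rewrite -powR12_sqrt ?(ltW n0') // -powR_mulrn ?(ltW q0) // -powRrM; apply: ler_powR => //.
    lra.
  have y4 : yp y ^+ 4 <= sqrt n%:R.
    by apply: le_trans q4; rewrite lerXn2r // nnegrE ltW.
  rewrite -(@ler_pXn2r _ 2) ?nnegrE ?(ltW s0) //; last by pos.
  have -> : (2 * yp y ^+ 2) ^+ 2 = 4 * yp y ^+ 4 by ring.
  rewrite [leRHS]expr2.
  apply: (@le_trans _ _ (4 * sqrt n%:R)); first by rewrite ler_pM2l.
  by rewrite ler_pM2r.
have r0 : 0 <= ce * yp y / q by rewrite divr_ge0 ?(ltW q0) // mulr_ge0 ?(ltW y0) //; lra.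
have cy : 0 <= (C1 + C2) * yp y by pos.
case: key => [h|[h1 h2]].
  have h' : n%:R * D <= C1 * yp y * sqrt eps.
    apply: le_trans (ler_wpM2l (ltW n0') h) _.
    by rewrite le_eqVlt; apply/orP; left; apply/eqP; field; rewrite gt_eqF.
  apply: le_trans h' _; apply: ler_pM => //; first by pos.
    by apply: ler_wpM2r; [exact: ltW|rewrite lerDl ltW].
  by rewrite lerDl.
have h' : n%:R * D <= C2 * yp y * 1.
  apply: le_trans (ler_wpM2l (ltW n0') h1) _.
  by rewrite le_eqVlt; apply/orP; left; apply/eqP; field; rewrite gt_eqF.
apply: le_trans h' _; apply: ler_pM => //; first by pos.
  by apply: ler_wpM2r; [exact: ltW|rewrite lerDr ltW].
by apply: le_trans h2 _; rewrite lerDr.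
Qed.

End KilledWalk.

(** * Starting points far below 0, the limiting profile and normalisation of the test function *)

Lemma killed_far (R : realType) (T : finType) (P : T -> T -> R) (f : T -> R) (F : R) n u x (y : R) :
  (forall x, `|f x| <= F) -> y < - F -> (0 < n)%N -> walk P f true n u x y = 0.
Proof.
move=> HF hy; case: n => // n _; rewrite walkS /step; apply: big1 => x' _.
have := HF x'; rewrite ler_norml => /andP[_ h].
by have -> : y + f x' <= 0 by [lra]; rewrite mulr0.
Qed.

Lemma Vfun_far (R : realType) (T : finType) (P : T -> T -> R) (nu f : T -> R) (F : R) x (y : R) :
  (forall x, `|f x| <= F) -> y < - F -> Vfun P nu f x y = 0.
Proof.
move=> HF hy.
have lim : ((fun n : nat => Num.sqrt n%:R * prob_surv P f n x y) @ \oo --> (0 : R))%classic.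
  apply/cvgrPdist_le => eta eta0; exists 1%N => // n /= n0.
  by rewrite prob_survE /survp (killed_far _ _ _ HF hy n0) mulr0 subrr normr0 ltW.
by rewrite /Vfun (cvg_lim _ lim) // mulr0.
Qed.

(** The Rayleigh profile [phiplus] is the rescaled slope at 0 of the odd kernel with pole [z] at
    time [n v2]. *)
Lemma phiplus_gausso (R : realType) (a p v2 V n z : R) : 0 < v2 -> 0 < n -> 0 <= z ->
  2 * a * p * V / (Num.sqrt (2 * pi) * v2 * n) * phiplus (z / (Num.sqrt n * Num.sqrt v2)) =
  a * p / Num.sqrt (2 * pi) * (gausso z 1 (n * v2) 0 * V).
Proof.
move=> v20 n0 z0; have c00 := lt_le_trans ltr01 (sqrt2pi_ge1 R).
have sn : 0 < Num.sqrt n by rewrite sqrtr_gt0.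
have sv : 0 < Num.sqrt v2 by rewrite sqrtr_gt0.
rewrite /phiplus divr_ge0 ?mulr_ge0 ?sqrtr_ge0 // gausso_slope /gauss (sqrtrM v2 (ltW n0)).
have -> : - (z / (Num.sqrt n * Num.sqrt v2)) ^+ 2 / 2 = - (z ^+ 2 / (2 * (n * v2))).
  have {2}<- : Num.sqrt n ^+ 2 = n by rewrite sqr_sqrtr // ltW.
  have {2}<- : Num.sqrt v2 ^+ 2 = v2 by rewrite sqr_sqrtr // ltW.
  by field; rewrite !gt_eqF.
by field; rewrite !gt_eqF.
Qed.

Lemma supnorm_scale (R : realType) (T : finType) (psi : T -> R) : (forall x, 0 <= psi x) ->
  exists2 psi', unitf psi' & forall x, psi x = supnorm psi * psi' x.
Proof.
move=> p0; have M0 : 0 <= supnorm psi by apply: bigmax_ge_id.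
have pM x : psi x <= supnorm psi by rewrite -[leLHS]ger0_norm //; exact: le_bigmax.
exists (fun x => psi x / supnorm psi) => x.
  apply/andP; split; first by rewrite divr_ge0.
  (* If [supnorm psi = 0] the quotient is 0 by convention, still an admissible [psi']. *)
  case: (eqVneq (supnorm psi) 0) => [->|M1]; first by rewrite invr0 mulr0.
  by rewrite ler_pdivrMr ?mul1r // lt_def M1.
case: (eqVneq (supnorm psi) 0) => [E|M1]; last by rewrite mulrCA divff // mulr1.
by rewrite E mul0r; apply/eqP; rewrite eq_le p0 andbT -E.
Qed.

Theorem theorem2p4 (R : realType) (T : finType) (P : T -> T -> R)
  (f : T -> R) (nu : T -> R) :
  stochastic P -> invariant_prob P nu ->
  H1 P -> H2 nu f -> H3 P f ->
  forall a : R, 0 < a ->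
  exists eps0 : R, 0 < eps0 < 1 / 4 /\
  exists c : R, 0 < c /\
  exists ceps : R -> R, (forall eps, 0 < eps < eps0 -> 0 < ceps eps) /\
  forall eps : R, 0 < eps < eps0 ->
  forall psi : T -> R, (forall x, 0 <= psi x) ->
  forall (y : R) (n : nat), 3 * eps ^-1 ^+ 3 <= n%:R ->
  forall (x : T) (z : R), 0 <= z ->
    n%:R * `| Eloc P f psi n x y z a
             - 2 * a * nuE nu psi * Vfun P nu f x y
               / (Num.sqrt (2 * pi) * sigma2 P nu f * n%:R)
               * phiplus (z / (Num.sqrt n%:R * sigma P nu f)) |
    <= c * (1 + Num.max y 0) * supnorm psi
         * (Num.sqrt eps + ceps eps * (1 + Num.max y 0) / (n%:R `^ eps)).
Proof.
move=> Pst nuP HH1 f0 HH3 a a0.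
have [r [rho [Hr Hrho v20]]] := correctors Pst nuP HH1 f0 HH3.
have [F F0 HF] := fin_ub f.
have [V0 [CV CV0 HV]] := harmonic_exists Pst Hr F0 HF.
have [c [c0 [ceps [ceps0 Hc]]]] := uniform_bound Pst HH1 HH3 Hr Hrho v20 F0 HF CV0 HV nuP a0.
exists (1 / 8); split; first lra.
exists c; split=> //; exists ceps; split=> // eps he psi psi0 y n hn x z z0.
have /andP[e0 _] := he.
have n0' : 0 < n%:R :> R by apply: lt_le_trans hn; rewrite mulr_gt0 // exprn_gt0 // invr_gt0.
have n0 : (0 < n)%N by rewrite -(ltr_nat R).
have M0 : 0 <= supnorm psi by apply: bigmax_ge_id.
rewrite -/(yp y) ElocE; have y0 := yp_gt0 y.
(* [V0] is controlled for [y >= - F] only. Below, the first step kills the walk and [Vfun] vanishes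
   too. *)
case: (ltP y (- F)) => hy.
  rewrite (killed_far _ _ _ HF hy n0) (Vfun_far _ _ _ HF hy) mulr0 !mul0r subrr normr0 mulr0.
  have ce0 := ceps0 eps he; have q0 := powR_ge0 n%:R eps.
  by pos.
rewrite (Vfun_eq Pst HH1 HH3 Hr Hrho v20 F0 HF CV0 HV x erefl hy) /sigma phiplus_gausso //.
have [psi' Hpsi' E] := supnorm_scale psi0.
have -> : walk P f true n (win psi z a) x y = supnorm psi * walk P f true n (win psi' z a) x y.
  rewrite -walkZ; apply: walk_ext => x' w'; rewrite /win; case: ifP => _; [exact: E|by rewrite mulr0].
have -> : nuE nu psi = supnorm psi * nuE nu psi'.
  by rewrite /nuE mulr_sumr; apply: eq_bigr => x' _; rewrite E mulrA.
have h := Hc eps he psi' y n x z Hpsi' n0 z0 hy.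
set G := gausso z 1 _ 0 * _ in h *; set W := walk _ _ _ _ _ _ _ in h *; set s := Num.sqrt (2 * pi) in h *.
have -> : supnorm psi * W - a * (supnorm psi * nuE nu psi') / s * G = supnorm psi * (W - a * nuE nu psi' / s * G).
  by ring.
rewrite normrM (ger0_norm M0) mulrCA.
have := ler_wpM2l M0 h; congr (_ <= _); ring.
Qed.
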